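(* Let $V$ be a complex Hilbert space, $\Omega\subset\mathbb C$ open, and let $P:\Omega\to\mathrm{End}^{\ge0}V$ be weakly upper semicontinuous. For a disc $\overline{D_r(z_0)}\subset\Omega$ write $\oint$ for the average $\frac{1}{2\pi r}\int_{\partial D_r(z_0)}$. The following are equivalent: (i) $P$ has seminegative curvature. (ii) For any disc $\overline{D_r(z_0)}\subset\Omega$, $$\begin{pmatrix}\oint P(z)\,|dz| & \oint P(z)\,dz\\ \oint P(z)\,d\overline z & \oint P(z)\,|dz|\end{pmatrix}\ \ge\ \begin{pmatrix}P(z_0)&0\\0&0\end{pmatrix}$$ in $\mathrm{End}(V\oplus V)$. (iii) For any disc $\overline{D_r(z_0)}\subset\Omega$ and $t\in(0,\infty)$, $$\oint P(z)\,|dz|-\oint P(z)\,dz\left(t\,\mathrm{Id}_V+\oint P(z)\,|dz|\right)^{-1}\oint P(z)\,d\overline z\ \ge\ P(z_0).$$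
   Context: $\mathrm{End}\,V$ is the space of continuous linear operators on $V$, and $\mathrm{End}^{\ge0}V=\{A\in\mathrm{End}\,V: A=A^*\ge0\}$. $P$ is weakly upper semicontinuous if $\langle Pv,v\rangle$ is upper semicontinuous on $\Omega$ for every $v\in V$. $P:\Omega\to\mathrm{End}^{\ge0}V$ has seminegative curvature if $\langle P\varphi,\varphi\rangle$ is subharmonic for any holomorphic $\varphi:\Omega\to V$. $D_r(z_0)=\{z\in\mathbb C:|z-z_0|<r\}$; $|dz|$ is arc length. Integrals of $P$ are understood in the weak sense: $\int P$ is the operator $Q\in\mathrm{End}\,V$ with $\int\langle Pv,w\rangle=\langle Qv,w\rangle$ for all $v,w\in V$. Inequalities are in the order of self-adjoint operators. *)

(* Defs.v *)
From HB Require Import structures.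
From mathcomp Require Import all_boot all_order all_algebra sesquilinear complex.
From mathcomp Require Import all_classical all_reals all_analysis.

Set Implicit Arguments.
Unset Strict Implicit.
Unset Printing Implicit Defensive.

Import Order.TTheory GRing.Theory Num.Theory.
Import numFieldNormedType.Exports.

Local Open Scope classical_set_scope.
Local Open Scope ring_scope.
Local Open Scope complex_scope.

(* [R[i]] is a numFieldType, but being a concrete type it does not inherit the
   norm topology that MathComp-Analysis puts on abstract numFieldTypes. *)
HB.instance Definition _ (R : realType) := NormedModule.copy R[i] R[i]^o.

(* A complex Hilbert space is a complete normed space over [R[i]] whose norm
   comes from the inner product [dot], linear in its first argument. *)
Definition hilbert_norm (R : realType) (V : completeNormedModType R[i])
    (dot : {dot V for (@conjc R)}) : Prop :=
  forall v : V, `|v| ^+ 2 = dot v v.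

Definition is_End (R : realType) (U : normedModType R[i]) (A : U -> U) : Prop :=
  linear A /\ continuous A.

(* The order on [R[i]] is the partial one: [0 <= z] says that [z] is a
   nonnegative real. *)
Definition End_ge0 (R : realType) (U : normedModType R[i])
    (form : U -> U -> R[i]) (A : U -> U) : Prop :=
  [/\ is_End A,
      forall v w, form (A v) w = form v (A w)
    & forall v, 0 <= form (A v) v].

Definition op_le (R : realType) (U : normedModType R[i])
    (form : U -> U -> R[i]) (A B : U -> U) : Prop :=
  End_ge0 form (B \- A).

(* The normed module [V * V] carries the max norm, which is equivalent to the
   Hilbert norm of [V (+) V]; the inner product is the one below. *)
Definition dot_sum (R : realType) (V : Type) (dot : V -> V -> R[i])
    (x y : V * V) : R[i] :=
  dot x.1 y.1 + dot x.2 y.2.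

Definition block_op (V : zmodType) (A B C D : V -> V) (x : V * V) : V * V :=
  (A x.1 + B x.2, C x.1 + D x.2).

Definition is_End_inverse (R : realType) (U : normedModType R[i])
    (A S : U -> U) : Prop :=
  [/\ is_End S, cancel A S & cancel S A].

Definition closed_disc (R : realType) (z0 : R[i]) (r : R) : set R[i] :=
  [set z | `|z - z0| <= r%:C].

Definition expi (R : realType) (t : R) : R[i] := cos t +i* sin t.

Definition circle (R : realType) (z0 : R[i]) (r : R) (t : R) : R[i] :=
  z0 + r%:C * expi t.

Definition angles (R : realType) : set R := `[0, 2 * pi]%classic.

(* The pullbacks of |dz|, dz and d(conj z) under [circle z0 r], as multiples
   of dt. *)
Definition arc_length (R : realType) (r t : R) : R[i] := r%:C.
Definition dz (R : realType) (r t : R) : R[i] := (0 +i* 1) * r%:C * expi t.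
Definition dzbar (R : realType) (r t : R) : R[i] := conjc (dz r t).

Definition integrableC (R : realType) (D : set R) (g : R -> R[i]) : Prop :=
  (@lebesgue_measure R).-integrable D (fun t => (complex.Re (g t))%:E) /\
  (@lebesgue_measure R).-integrable D (fun t => (complex.Im (g t))%:E).

Definition integralC (R : realType) (D : set R) (g : R -> R[i]) : R[i] :=
  Rintegral (@lebesgue_measure R) D (fun t => complex.Re (g t)) +i*
  Rintegral (@lebesgue_measure R) D (fun t => complex.Im (g t)).

(* [Q] is the operator (1 / (2 pi r)) \int P omega, the integral being taken
   in the weak sense over the circle of centre [z0] and radius [r], where
   [omega] is one of the three densities above. Such a [Q] is unique. *)
Definition is_weak_avg (R : realType) (V : normedModType R[i])
    (dot : V -> V -> R[i]) (P : R[i] -> V -> V) (z0 : R[i]) (r : R)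
    (omega : R -> R -> R[i]) (Q : V -> V) : Prop :=
  is_End Q /\
  forall v w : V,
    let g t := dot (P (circle z0 r t) v) w * omega r t in
    integrableC (@angles R) g /\
    ((2 * pi * r)^-1)%:C * integralC (@angles R) g = dot (Q v) w.

Definition usc_on (R : realType) (Omega : set R[i]) (u : R[i] -> \bar R) :
    Prop :=
  forall (z : R[i]) (a : R), Omega z -> (u z < a%:E)%E ->
    \forall y \near z, Omega y -> (u y < a%:E)%E.

Definition subharmonic_on (R : realType) (Omega : set R[i])
    (u : R[i] -> \bar R) : Prop :=
  [/\ forall z, Omega z -> (u z < +oo)%E,
      usc_on Omega u
    & forall (z0 : R[i]) (r : R), 0 < r -> closed_disc z0 r `<=` Omega ->
        (u z0 <= ((2 * pi)^-1)%:E *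
                 \int[@lebesgue_measure R]_(t in @angles R)
                   u (circle z0 r t))%E].

Definition holomorphic_on (R : realType) (V : normedModType R[i])
    (Omega : set R[i]) (phi : R[i] -> V) : Prop :=
  forall z, Omega z -> derivable phi z (1 : R[i]).

Definition weakly_usc (R : realType) (V : normedModType R[i])
    (dot : V -> V -> R[i]) (Omega : set R[i]) (P : R[i] -> V -> V) : Prop :=
  forall v : V, usc_on Omega (fun z => (complex.Re (dot (P z v) v))%:E).

Definition seminegative_curvature (R : realType) (V : normedModType R[i])
    (dot : V -> V -> R[i]) (Omega : set R[i]) (P : R[i] -> V -> V) : Prop :=
  forall phi : R[i] -> V, holomorphic_on Omega phi ->
    subharmonic_on Omega
      (fun z => (complex.Re (dot (P z (phi z)) (phi z)))%:E).

(* Main.v *)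
(* On the circle [dz = i (z - z0) |dz| / r], so the quadratic form of the block
   operator in (ii) at [(v, w)] is the average of [<P phi, phi>] for the affine
   map [phi z = v + (z - z0) (i / r) w]. Hence (i) gives (ii), and (iii) is the
   Schur complement of (ii), with [t] added to the lower right corner and sent to
   [0] in the converse direction. The weak averages exist by the uniform
   boundedness principle and the representation of bounded sesquilinear forms.

   It remains to pass from affine maps to all holomorphic ones. For a polynomial
   map [phi], [u = <P phi, phi>] satisfies [u z <= average of u + o(s^2)] on small
   circles of radius [s], and a maximum principle turns this infinitesimal
   inequality into the mean value inequality on every circle. A holomorphic map is
   a uniform limit on the circle of polynomials with the same value at the centre:
   its negative Fourier coefficients vanish by the theorem of Goursat. *)
Require Import Defs.
From mathcomp Require Import all_boot all_order all_algebra sesquilinear complex.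
From mathcomp Require Import all_classical all_reals all_analysis.
From mathcomp Require Import measurable_realfun zify ring lra.
Import Order.TTheory GRing.Theory Num.Theory.
Import numFieldNormedType.Exports.
Local Open Scope classical_set_scope.
Local Open Scope ring_scope.
Local Open Scope complex_scope.

Set Implicit Arguments.
Unset Strict Implicit.
Unset Printing Implicit Defensive.

(** [P] is merely weakly upper semicontinuous, so no Laplacian can be applied to [<P phi, phi>]; all
    estimates go through circle averages. Only the second order expansion of [phi] matters: beyond
    the affine part there is one term of size [s^2], a rotating multiple of [<P v, x>]. It averages
    to [o(s^2)] because the inequality for constant maps, together with upper semicontinuity, forces
    [<P v, x>] to converge in mean on shrinking circles. For polynomial maps the expansion is plain
    algebra, which is why they replace holomorphic ones. As both maps agree at the centre, only the
    average changes, and it changes little because [P] is bounded on the disc.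

    The maximum principle compares [u] with harmonic functions, but on a circle [u] is only
    semicontinuous. It is replaced there by Lipschitz majorants whose averages come close to that of
    [u], and these by trigonometric polynomials, whose harmonic extensions are explicit. One and the
    same kernel produces these polynomials and the polynomial approximation of [phi]. *)

Local Notation Re := complex.Re.
Local Notation Im := complex.Im.

(** * Real norms and positive Hermitian forms *)

Section RealNorm.
Context (R : realType).
Implicit Types (U : normedModType R[i]) (z w : R[i]).

(** The norm of an [R[i]]-module takes values in the partially ordered field [R[i]]. Its real part
    carries the same information and lives in a totally ordered field, where suprema, minima and
    linear arithmetic are available. *)
Definition rnorm U (u : U) : R := Re `|u|.

Lemma rnormE U (u : U) : `|u| = (rnorm u)%:C.
Proof. by rewrite /rnorm RRe_real // ger0_real. Qed.

Lemma rnorm_ge0 U (u : U) : 0 <= rnorm u.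
Proof. by rewrite -ler0c -rnormE. Qed.

Lemma rnorm0 U : rnorm (0 : U) = 0.
Proof. by rewrite /rnorm normr0. Qed.

Lemma rnorm_eq0 U (u : U) : rnorm u = 0 -> u = 0.
Proof. by move=> u0; apply/normr0_eq0; rewrite rnormE u0. Qed.

Lemma rnormD U (u v : U) : rnorm (u + v) <= rnorm u + rnorm v.
Proof. by rewrite -lecR rmorphD /= -!rnormE ler_normD. Qed.

Lemma rnormN U (u : U) : rnorm (- u) = rnorm u.
Proof. by rewrite /rnorm normrN. Qed.

Lemma rnormB U (u v : U) : rnorm (u - v) <= rnorm u + rnorm v.
Proof. by rewrite -(rnormN v) rnormD. Qed.

Lemma rdistC U (u v : U) : rnorm (u - v) = rnorm (v - u).
Proof. by rewrite -rnormN opprB. Qed.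

Lemma rdist_tri U (u v w : U) : rnorm (u - w) <= rnorm (u - v) + rnorm (v - w).
Proof. by rewrite (le_trans _ (rnormD _ _)) // addrA subrK. Qed.

Lemma rnormZ U (a : R[i]) (u : U) : rnorm (a *: u) = rnorm a * rnorm u.
Proof. by apply: complexI; rewrite rmorphM /= -!rnormE normrZ. Qed.

Lemma rnormM z w : rnorm (z * w) = rnorm z * rnorm w.
Proof. by apply: complexI; rewrite rmorphM /= -!rnormE normrM. Qed.

Lemma rnorm1 : rnorm (1 : R[i]) = 1.
Proof. by rewrite /rnorm normr1. Qed.

Lemma rnormX z n : rnorm (z ^+ n) = rnorm z ^+ n.
Proof. by elim: n => [|n IH]; rewrite ?expr0 ?rnorm1 // !exprS rnormM IH. Qed.

Lemma rnormV z : rnorm z^-1 = (rnorm z)^-1.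
Proof. by apply: complexI; rewrite fmorphV /= -!rnormE normfV. Qed.

Lemma rnorm_sqr z : rnorm z ^+ 2 = Re z ^+ 2 + Im z ^+ 2.
Proof. by apply: complexI; rewrite rmorphXn /= -rnormE -add_Re2_Im2. Qed.

Lemma rnorm_conj z : rnorm (conjc z) = rnorm z.
Proof. by rewrite /rnorm normcJ. Qed.

Lemma rnorm_real (x : R) : rnorm x%:C = `|x|.
Proof. by rewrite /rnorm normc_def /= expr0n addr0 sqrtr_sqr. Qed.

Lemma rnorm_le_sqr U (u : U) (x : R) : 0 <= x -> rnorm u ^+ 2 <= x ^+ 2 -> rnorm u <= x.
Proof. by move=> x0; rewrite ler_sqr // nnegrE rnorm_ge0. Qed.

Lemma normRe_le z : `|Re z| <= rnorm z.
Proof. by rewrite -lecR -rnormE normc_ge_Re. Qed.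

Lemma normIm_le z : `|Im z| <= rnorm z.
Proof.
rewrite -ler_sqr ?nnegrE ?rnorm_ge0 // rnorm_sqr real_normK ?num_real //.
by rewrite lerDr sqr_ge0.
Qed.

Lemma Re_le z : Re z <= rnorm z.
Proof. exact: le_trans (ler_norm _) (normRe_le z). Qed.

Lemma rnorm_le_ReIm z : rnorm z <= `|Re z| + `|Im z|.
Proof.
apply: rnorm_le_sqr; first by rewrite addr_ge0.
rewrite rnorm_sqr -(real_normK (num_real (Re z))) -(real_normK (num_real (Im z))).
by rewrite sqrrD lerD2r lerDl mulrn_wge0 // mulr_ge0.
Qed.

Lemma ReD z w : Re (z + w) = Re z + Re w.
Proof. by case: z w => [a b] [c d]. Qed.

Lemma ImD z w : Im (z + w) = Im z + Im w.
Proof. by case: z w => [a b] [c d]. Qed.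

Lemma ReN z : Re (- z) = - Re z.
Proof. by case: z. Qed.

Lemma ImN z : Im (- z) = - Im z.
Proof. by case: z. Qed.

Lemma ReB z w : Re (z - w) = Re z - Re w.
Proof. by rewrite ReD ReN. Qed.

Lemma ImB z w : Im (z - w) = Im z - Im w.
Proof. by rewrite ImD ImN. Qed.

Lemma ReM z w : Re (z * w) = Re z * Re w - Im z * Im w.
Proof. by case: z w => [a b] [c d]. Qed.

Lemma ImM z w : Im (z * w) = Re z * Im w + Im z * Re w.
Proof. by case: z w => [a b] [c d]. Qed.

Lemma Re_conj z : Re (conjc z) = Re z.
Proof. by case: z. Qed.

Lemma Im_conj z : Im (conjc z) = - Im z.
Proof. by case: z. Qed.

Definition ReImE := (ReD, ImD, ReN, ImN, ReM, ImM, Re_conj, Im_conj).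

Lemma complex_ext z w : Re z = Re w -> Im z = Im w -> z = w.
Proof. by case: z w => [a b] [c d] /= -> ->. Qed.

Lemma conjcD z w : conjc (z + w) = conjc z + conjc w.
Proof. exact: rmorphD. Qed.

Lemma conjcN z : conjc (- z) = - conjc z.
Proof. exact: rmorphN. Qed.

Lemma conjcM z w : conjc (z * w) = conjc z * conjc w.
Proof. exact: rmorphM. Qed.

Lemma conjcX z n : conjc (z ^+ n) = conjc z ^+ n.
Proof. exact: rmorphXn. Qed.

Lemma conjcR (x : R) : conjc x%:C = x%:C.
Proof. exact: conjc_real. Qed.

Lemma realcM (x y : R) : (x * y)%:C = x%:C * y%:C.
Proof. exact: rmorphM. Qed.

Lemma realcD (x y : R) : (x + y)%:C = x%:C + y%:C.
Proof. exact: rmorphD. Qed.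

Lemma realcB (x y : R) : (x - y)%:C = x%:C - y%:C.
Proof. exact: rmorphB. Qed.

Lemma realcV (x : R) : (x^-1)%:C = x%:C^-1.
Proof. exact: fmorphV. Qed.

Lemma mul_conj z : z * conjc z = (rnorm z ^+ 2)%:C.
Proof. by rewrite rmorphXn /= -rnormE sqr_normc. Qed.

(** The conjugate phase rotates [z] onto the nonnegative real axis; at [z = 0] the convention
    [0^-1 = 0] makes both sides vanish. *)
Lemma Re_mul_conj_norm z : Re (z * conjc (z / (rnorm z)%:C)) = rnorm z.
Proof.
rewrite -realcV conjcM conjcR mulrA mul_conj -realcM /=.
have [->|z0] := eqVneq (rnorm z) 0; first by rewrite invr0 mulr0.
by rewrite expr2 mulfK.
Qed.

End RealNorm.

(** * Positive semidefinite Hermitian forms *)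

Section PositiveForm.
Context (R : realType) (V : lmodType R[i]).
Implicit Types (a : V -> V -> R[i]) (u v w : V) (k : R[i]).

(** Semidefiniteness covers both the inner product and the forms [<P z u, v>], which may be
    degenerate. Antilinearity in the second argument follows from the symmetry. *)
Definition psd_form a :=
  [/\ forall k u v w, a (k *: u + v) w = k * a u w + a v w,
      forall u v, a u v = conjc (a v u)
    & forall v, 0 <= Re (a v v)].

Variable a : V -> V -> R[i].
Hypothesis pa : psd_form a.

Lemma form_lin k u v w : a (k *: u + v) w = k * a u w + a v w.
Proof. by case: pa. Qed.

Lemma form_conj u v : a u v = conjc (a v u).
Proof. by case: pa. Qed.

Lemma form_ge0 v : 0 <= Re (a v v).
Proof. by case: pa. Qed.

Lemma formDl u v w : a (u + v) w = a u w + a v w.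
Proof. by rewrite -{1}(scale1r u) form_lin mul1r. Qed.

Lemma form0l w : a 0 w = 0.
Proof. by apply: (addrI (a 0 w)); rewrite -formDl !addr0. Qed.

Lemma formZl k u w : a (k *: u) w = k * a u w.
Proof. by rewrite -(addr0 (k *: u)) form_lin form0l addr0. Qed.

Lemma formNl u w : a (- u) w = - a u w.
Proof. by rewrite -scaleN1r formZl mulN1r. Qed.

Lemma formBl u v w : a (u - v) w = a u w - a v w.
Proof. by rewrite formDl formNl. Qed.

Lemma formDr u v w : a w (u + v) = a w u + a w v.
Proof. by rewrite form_conj formDl rmorphD /= -!form_conj. Qed.

Lemma formZr k u w : a w (k *: u) = conjc k * a w u.
Proof. by rewrite form_conj formZl rmorphM /= -!form_conj. Qed.

Lemma formNr u w : a w (- u) = - a w u.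
Proof. by rewrite form_conj formNl rmorphN /= -!form_conj. Qed.

Lemma formBr u v w : a w (u - v) = a w u - a w v.
Proof. by rewrite formDr formNr. Qed.

Definition formE := (formDl, formDr, formZl, formZr, formNl, formNr).

Lemma formC_Re u v : Re (a u v) = Re (a v u).
Proof. by rewrite form_conj Re_conj. Qed.

Definition quad v := Re (a v v).

Lemma quadD u v : quad (u + v) = quad u + quad v + 2 * Re (a u v).
Proof. by rewrite /quad !formE !ReD (formC_Re v u); lra. Qed.

Lemma quadB u v : quad (u - v) = quad u + quad v - 2 * Re (a u v).
Proof. by rewrite quadD /quad !formE !ReN; lra. Qed.

Lemma quadZ k v : quad (k *: v) = rnorm k ^+ 2 * quad v.
Proof.
rewrite /quad !formE mulrA mul_conj ReM /= mul0r subr0 //.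
Qed.

Lemma parallelogram u v : quad (u + v) + quad (u - v) = 2 * quad u + 2 * quad v.
Proof. by rewrite quadD quadB; lra. Qed.

(** The hypotheses on [P] concern diagonal values only. Polarisation carries measurability and
    convergence in mean over to all the coefficients [<P u, v>]. *)
Lemma polar_Re u v : Re (a u v) = 4^-1 * (quad (u + v) - quad (u - v)).
Proof. by rewrite quadD quadB; lra. Qed.

Lemma polar_Im u v :
  Im (a u v) = 4^-1 * (quad (u + 'i *: v) - quad (u - 'i *: v)).
Proof.
by rewrite -polar_Re !formE ReM /=; lra.
Qed.

(** Positivity at [u - t k v], with [k = a u v] and [t] real, is a quadratic inequality in [t]. It
    is used at its minimum [t = 1 / quad v], or, when [quad v = 0], at a [t] so large that the
    expression would be [-1] if [k] were nonzero. *)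
Lemma form_Cauchy_Schwarz u v : rnorm (a u v) ^+ 2 <= quad u * quad v.
Proof.
pose k := a u v.
have q (t : R) : 0 <= quad u + t ^+ 2 * rnorm k ^+ 2 * quad v - 2 * t * rnorm k ^+ 2.
  have := form_ge0 (u - (t%:C * k) *: v).
  rewrite -/(quad _) quadB quadZ rnormM rnorm_real exprMn real_normK ?num_real //.
  rewrite formZr conjcM conjcR -/k -mulrA (mulrC (conjc k)) mul_conj -realcM /=.
  by rewrite -mulrA; lra.
have qv := form_ge0 v; rewrite -/(quad v) in qv.
have [v0|v0] := eqVneq (quad v) 0.
  rewrite v0 mulr0; have [//|k0] := lerP (rnorm k ^+ 2) 0.
  have := q ((quad u + 1) / (2 * rnorm k ^+ 2)); rewrite v0 mulr0 addr0.
  rewrite (_ : 2 * _ * _ = quad u + 1); first by lra.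
  move: (rnorm k) k0 => n k0; field; apply: contraTneq k0 => ->; by rewrite expr0n ltxx.
have {}qv : 0 < quad v by rewrite lt_neqAle eq_sym v0.
have := q (quad v)^-1.
rewrite (_ : _ + _ - _ = (quad u * quad v - rnorm k ^+ 2) / quad v).
  by rewrite pmulr_lge0 ?invr_gt0 // subr_ge0.
by field.
Qed.

End PositiveForm.

(** * Topology in terms of real norms *)

Section EpsilonDelta.
Context (R : realType).

Lemma gt0_complex (e : R[i]) : 0 < e -> 0 < Re e /\ e = (Re e)%:C.
Proof. by rewrite ltcE /= => /andP[/eqP e0 ->]; split=> //; apply: complex_ext. Qed.

Lemma near_rnorm (U : normedModType R[i]) (x : U) (P : U -> Prop) :
  (\forall y \near x, P y) <->
  exists2 d : R, 0 < d & forall y, rnorm (y - x) < d -> P y.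
Proof.
rewrite nbhs_normP; split=> [[e /= /gt0_complex[e0 ->] h]|[d d0 h]].
  by exists (Re e) => // y yx; apply: h => /=; rewrite distrC rnormE ltcR.
by exists d%:C; rewrite /= ?ltcR // => y /=; rewrite distrC rnormE ltcR => /h.
Qed.

Lemma complete_seq (V : completeNormedModType R[i]) (x : nat -> V) :
  (forall e : R, 0 < e -> exists N, forall m n, (N <= m)%N -> (N <= n)%N ->
     rnorm (x m - x n) < e) ->
  exists l, forall e : R, 0 < e -> exists N, forall n, (N <= n)%N ->
    rnorm (x n - l) < e.
Proof.
move=> cx; have : cauchy (x @ \oo).
  apply/cauchy_ballP => e /gt0_complex[e0 ->].
  have [N hN] := cx _ e0; pose A := [set x n | n in [set n | (N <= n)%N]].
  exists (A, A); first by split; exists N => // n /= Nn; exists n.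
  move=> [_ _] [[/= m Nm <-] [n Nn <-]] /=.
  by rewrite -ball_normE /= rnormE ltcR; exact: hN.
move=> /cauchy_cvg /cvgrPdist_lt h; exists (lim (x @ \oo)) => e e0.
have [|N _ hN] := h e%:C; first by rewrite ltcR.
by exists N => n /hN /=; rewrite distrC rnormE ltcR.
Qed.

Lemma derivable_rnorm (V : normedModType R[i]) (f : R[i] -> V) (z : R[i]) :
  derivable f z 1 <->
  exists w, forall e : R, 0 < e -> exists2 d : R, 0 < d &
    forall y, rnorm (y - z) < d -> rnorm (f y - f z - (y - z) *: w) <= e * rnorm (y - z).
Proof.
split=> [/cvg_ex[/= w /cvgrPdist_le h]|[w h]].
  exists w => e e0; have /h : 0 < e%:C by rewrite ltcR.
  rewrite near_withinE => /near_rnorm[d d0 {}h]; exists d => // y yz.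
  have [->|yz0] := eqVneq y z.
    by rewrite !subrr scale0r subrr !rnorm0 mulr0.
  have yz1 : y - z != 0 by rewrite subr_eq0.
  have := h (y - z); rewrite subr0 => /(_ yz yz1).
  rewrite rnormE lecR /= /GRing.scale /= mulr1 subrK -/(GRing.scale _ _) => h1.
  rewrite mulrC (_ : f y - _ - _ = - ((y - z) *: (w - (y - z)^-1 *: (f y - f z)))).
    by rewrite rnormN rnormZ ler_wpM2l // rnorm_ge0.
  by rewrite scalerBr scalerA divff // scale1r opprB.
apply/cvg_ex; exists w; apply/cvgrPdist_le => e /gt0_complex[e0 ->].
rewrite near_withinE; apply/near_rnorm.
have [d d0 {}h] := h _ e0; exists d => // y; rewrite subr0 => yd y0.
rewrite rnormE lecR /= /GRing.scale /= mulr1 -/(GRing.scale _ _).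
have := h (y + z); rewrite addrK => /(_ yd).
rewrite (_ : f _ - _ - _ = - (y *: (w - y^-1 *: (f (y + z) - f z)))).
  by rewrite rnormN rnormZ mulrC ler_pM2r // lt_neqAle rnorm_ge0 eq_sym andbT; apply: contraNneq y0 => /rnorm_eq0 ->.
by rewrite scalerBr scalerA divff // scale1r opprB.
Qed.

Lemma closed_discE (z0 : R[i]) r z : closed_disc z0 r z <-> rnorm (z - z0) <= r.
Proof. by rewrite /closed_disc /= rnormE lecR. Qed.

Lemma open_rnorm (Omega : set R[i]) z : open Omega -> Omega z ->
  exists2 d : R, 0 < d & forall y, rnorm (y - z) < d -> Omega y.
Proof. by move=> oO Oz; apply/near_rnorm; apply: open_nbhs_nbhs. Qed.

(* Compactness, as an induction principle: a property of subsets that is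
   hereditary, stable under unions and true locally is true. *)
Lemma closed_disc_ind (z0 : R[i]) (r : R) (Q : set R[i] -> Prop) :
  (forall A B, A `<=` B -> Q B -> Q A) -> Q set0 ->
  (forall A B, Q A -> Q B -> Q (A `|` B)) ->
  (forall z, closed_disc z0 r z -> exists2 d : R, 0 < d &
     Q [set y | closed_disc z0 r y /\ rnorm (y - z) < d]) ->
  Q (closed_disc z0 r).
Proof.
move=> QS Q0 QU Qloc; apply: contrapT => nQ.
pose K := closed_disc z0 r.
pose c z : R * R := (Re (z - z0), Im (z - z0)).
pose S := `[- r, r]%classic `*` `[- r, r]%classic.
have cS z : K z -> S (c z).
  move=> /closed_discE zK; split; rewrite /= in_itv /= -ler_norml.
    exact: le_trans (normRe_le _) zK.
  exact: le_trans (normIm_le _) zK.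
(* Sets whose complement is negligible for [Q], read in the real coordinates of the square [S]. If
   [Q] fails on the disc this is a proper filter containing [S], and its cluster point contradicts
   the local hypothesis there. *)
pose F : set_system (R * R) := [set A | Q [set z | K z /\ ~ A (c z)]].
have FF : ProperFilter F.
  apply: Build_ProperFilter_ex => [A FA|].
    apply: contrapT => nA; apply: nQ; apply: QS FA => z Kz; split=> // Az.
    by apply: nA; exists (c z).
  split.
  - by apply: QS Q0 => z [_ /=]; apply.
  - move=> A B FA FB; apply: QS (QU _ _ FA FB) => z [Kz /= /not_andP].
    by case=> nA; [left|right].
  - by move=> A B AB; apply: QS => z [Kz nB]; split=> // /AB.
have cpt : compact S by apply: compact_setX; exact: segment_compact.
have [|p [Sp clp]] := cpt F FF.
  by apply: QS Q0 => z [/cS Sz /=]; apply.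
pose z := z0 + (p.1 +i* p.2).
have [d d0 hd] : exists2 d : R, 0 < d & Q [set y | K y /\ rnorm (y - z) < d].
  have [/Qloc//|/closed_discE/negP] := pselect (K z).
  (* The cluster point may fall in the square but outside the disc; a ball of this radius then
     misses the disc. *)
  rewrite -ltNge => rz; exists (rnorm (z - z0) - r); first by rewrite subr_gt0.
  apply: QS Q0 => y [/closed_discE yr]; have := rdist_tri z y z0.
  by rewrite (rdistC z y); lra.
have nb : nbhs p [set q : R * R | `|q.1 - p.1| < d / 2 /\ `|q.2 - p.2| < d / 2].
  have nx (x : R) : nbhs x [set y | `|y - x| < d / 2].
    apply/nbhs_normP; exists (d / 2) => /=; first by lra.
    by move=> y /=; rewrite distrC.
  by exists ([set y | `|y - p.1| < d / 2], [set y | `|y - p.2| < d / 2]).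
have Fn : F [set q | ~ (`|q.1 - p.1| < d / 2 /\ `|q.2 - p.2| < d / 2)].
  apply: QS hd => y [Ky /= /contrapT [y1 y2]]; split=> //.
  apply: le_lt_trans (rnorm_le_ReIm _) _.
  move: y1 y2; rewrite /z !ReImE /=.
  have e (a b x : R) : a - (b + x) = a + - b - x by lra.
  rewrite !e; lra.
by have [q [/= h1 h2]] := clp _ _ Fn nb.
Qed.
End EpsilonDelta.

(** * Uniform boundedness and the Lax-Milgram lemma *)

Section BoundedOperators.
Context (R : realType).

Lemma invn_lt (e : R) : 0 < e -> exists N, forall n, (N <= n)%N -> n.+1%:R^-1 < e.
Proof.
move=> e0; have [N _ hN] := near_infty_natSinv_lt (PosNum e0).
by exists N => n /hN.
Qed.

Lemma linear_fun0 (U : lmodType R[i]) (A : U -> U) : linear A -> A 0 = 0.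
Proof.
move=> lA; have := lA 1 0 0; rewrite scaler0 addr0 scale1r => h.
by apply: (addrI (A 0)); rewrite addr0 -h.
Qed.

Lemma linear_funZ (U : lmodType R[i]) (A : U -> U) k u : linear A -> A (k *: u) = k *: A u.
Proof. by move=> lA; rewrite -[k *: u]addr0 lA linear_fun0 // addr0. Qed.

Lemma linear_funB (U : lmodType R[i]) (A : U -> U) u v : linear A -> A (u - v) = A u - A v.
Proof.
by move=> lA; rewrite [u - v]addrC -[- v]scaleN1r lA scaleN1r addrC.
Qed.

Lemma bounded_linear_is_End (U : normedModType R[i]) (A : U -> U) (K : R) :
  linear A -> (forall v, rnorm (A v) <= K * rnorm v) -> is_End A.
Proof.
move=> lA bA; split=> // x; apply/cvgrPdist_lt => e /gt0_complex[e0 ->].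
have K1 : 0 < `|K| + 1 by rewrite ltr_wpDl.
apply/near_rnorm; exists (Re e / (`|K| + 1)); first by rewrite divr_gt0.
move=> y yx; rewrite rnormE ltcR rdistC.
rewrite -linear_funB //.
apply: le_lt_trans (bA _) _; move: yx; rewrite ltr_pdivlMr // mulrC.
apply: le_lt_trans; rewrite ler_wpM2r ?rnorm_ge0 //.
by rewrite (le_trans (ler_norm _)) // lerDl.
Qed.

Lemma is_End_bounded (U : normedModType R[i]) (A : U -> U) : is_End A ->
  exists2 K : R, 0 <= K & forall v, rnorm (A v) <= K * rnorm v.
Proof.
move=> [lA cA]; have /cvgrPdist_lt h := cA 0.
have /h : 0 < (1 : R)%:C by rewrite ltcR.
move=> /near_rnorm[d d0 {}h]; exists (2 / d); first by rewrite divr_ge0 // ltW.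
move=> v; have [->|v0] := eqVneq v 0; first by rewrite linear_fun0 // !rnorm0 mulr0.
have nv : 0 < rnorm v.
  by rewrite lt_neqAle rnorm_ge0 andbT eq_sym; apply: contraNneq v0 => /rnorm_eq0 ->.
pose k := d / 2 / rnorm v.
have k0 : 0 < k by rewrite !divr_gt0.
have := h (k%:C *: v); rewrite subr0 rnormZ rnorm_real gtr0_norm // /k divfK ?gt_eqF //.
rewrite linear_fun0 // sub0r normrN linear_funZ // rnormE ltcR rnormZ rnorm_real gtr0_norm // => kv.
have {}kv : k * rnorm (A v) < 1 by apply: kv; lra.
rewrite -(ler_pM2l k0) (le_trans (ltW kv)) // /k.
by rewrite (_ : _ * _ = 1) //; field; rewrite ?gt_eqF.
Qed.

End BoundedOperators.

(** * Forms and operators on a Hilbert space *)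

Section Hilbert.
Context (R : realType) (V : completeNormedModType R[i]).
Variable dot : {dot V for (@conjc R)}.
Hypothesis hV : hilbert_norm dot.

Lemma dot_psd : psd_form dot.
Proof.
split=> [k u v w|u v|v]; first by rewrite linearPl.
  by rewrite hermC expr0 mul1r.
by rewrite -hV rnormE -rmorphXn /= sqr_ge0.
Qed.

Lemma quad_dot v : quad dot v = rnorm v ^+ 2.
Proof. by rewrite /quad -hV rnormE -rmorphXn. Qed.

Lemma dot_eq0 v : (forall w, dot v w = 0) -> v = 0.
Proof.
move=> h; apply: rnorm_eq0; apply/eqP; rewrite -sqrf_eq0 -quad_dot /quad h.
by [].
Qed.

Lemma dot_inj u v : (forall w, dot u w = dot v w) -> u = v.
Proof.
move=> h; apply/eqP; rewrite -subr_eq0; apply/eqP/dot_eq0 => w.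
by rewrite (formBl dot_psd) h subrr.
Qed.

Lemma rnorm_dot_le u v : rnorm (dot u v) <= rnorm u * rnorm v.
Proof.
apply: rnorm_le_sqr; first by rewrite mulr_ge0 ?rnorm_ge0.
by rewrite exprMn -!quad_dot; exact: form_Cauchy_Schwarz dot_psd _ _.
Qed.

Implicit Types a : V -> V -> R[i].

Lemma psd_form_bounded a M : psd_form a -> 0 <= M ->
  (forall v, quad a v <= M * rnorm v ^+ 2) ->
  forall u v, rnorm (a u v) <= M * rnorm u * rnorm v.
Proof.
move=> pa M0 h u v; apply: rnorm_le_sqr; first by rewrite !mulr_ge0 ?rnorm_ge0.
apply: le_trans (form_Cauchy_Schwarz pa _ _) _.
rewrite (_ : (_ * _) ^+ 2 = M * rnorm u ^+ 2 * (M * rnorm v ^+ 2)); last by ring.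
by apply: ler_pM => //; exact: form_ge0.
Qed.

(* [quad a] at [v] is at most the mean of its values at [x + v] and [x - v]. *)
Lemma quad_le_ball a M d x : psd_form a -> 0 < d ->
  (forall y, rnorm (y - x) <= d -> quad a y <= M) ->
  forall v, quad a v <= M / d ^+ 2 * rnorm v ^+ 2.
Proof.
move=> pa d0 h v; have [->|v0] := eqVneq v 0.
  by rewrite /quad (form0l pa) rnorm0 expr0n mulr0.
have nv : 0 < rnorm v.
  by rewrite lt_neqAle rnorm_ge0 andbT eq_sym; apply: contraNneq v0 => /rnorm_eq0 ->.
pose k := d / rnorm v; have k0 : 0 < k by rewrite divr_gt0.
have nk : rnorm (k%:C *: v) = d by rewrite rnormZ rnorm_real gtr0_norm // divfK ?gt_eqF.
have : quad a (k%:C *: v) <= M.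
  have := parallelogram pa x (k%:C *: v).
  have := h (x + k%:C *: v); rewrite addrC addKr nk => /(_ (lexx _)).
  have := h (x - k%:C *: v); rewrite addrC addKr rnormN nk => /(_ (lexx _)).
  by have := form_ge0 pa x; rewrite -/(quad a x); lra.
rewrite quadZ // rnorm_real gtr0_norm // => h1.
have k2 : 0 < k ^+ 2 by rewrite exprn_gt0.
rewrite -(ler_pM2l k2) (le_trans h1) // /k.
have -> // : (d / rnorm v) ^+ 2 * (M / d ^+ 2 * rnorm v ^+ 2) = M.
by move: (rnorm v) nv => n nv; field; rewrite !gt_eqF.
Qed.

(* The nested balls of the proof of the Baire theorem, whose library version
   is restricted to spaces over a [realType]. *)
Lemma uniform_boundedness (I : Type) (D : set I) (a : I -> V -> V -> R[i]) :
  (forall i, D i -> psd_form (a i)) ->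
  (forall i, D i -> exists2 M, 0 <= M & forall v, quad (a i) v <= M * rnorm v ^+ 2) ->
  (forall v, exists M, forall i, D i -> quad (a i) v <= M) ->
  exists2 M, 0 <= M & forall i, D i -> forall v, quad (a i) v <= M * rnorm v ^+ 2.
Proof.
move=> pa ba ptb; apply: contrapT => nb.
(* The premise on the radius stands under the existential so that [choice] gives a total function.
   In the half ball some form exceeds [n], since otherwise [quad_le_ball] would bound all of them
   uniformly. *)
have step (n : nat) (p : V * R) : exists q : V * R, 0 < p.2 ->
    [/\ 0 < q.2, q.2 <= n.+1%:R^-1, rnorm (q.1 - p.1) + q.2 <= p.2 &
      exists2 i, D i & forall y, rnorm (y - q.1) <= q.2 -> n%:R < quad (a i) y].
  have [p0|] := ltP 0 p.2; last by move=> h; exists p => p0; lra.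
  have d0 : 0 < p.2 / 2 by rewrite divr_gt0.
  have [i [Di [x [xp nx]]]] : exists i, D i /\ exists x, rnorm (x - p.1) <= p.2 / 2 /\ n%:R < quad (a i) x.
    apply: contrapT => h; apply: nb; exists (n%:R / (p.2 / 2) ^+ 2).
      by rewrite divr_ge0 // sqr_ge0.
    move=> i Di; apply: (quad_le_ball (x := p.1)) => // [|y yp]; first exact: pa.
    by rewrite leNgt; apply/negP => ny; apply: h; exists i; split=> //; exists y.
  have [M M0 hM] := ba _ Di; have bM := psd_form_bounded (pa _ Di) M0 hM.
  (* Within distance [d] of [x] the form drops by at most [2 M |x| d], its part quadratic in [y - x]
     being nonnegative; [d] keeps this loss below the excess [quad (a i) x - n]. *)
  pose B := 2 * M * rnorm x + 1.
  have B0 : 0 < B by rewrite ltr_wpDl // !mulr_ge0 ?rnorm_ge0.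
  pose d := (quad (a i) x - n%:R) / (2 * B).
  have dd : 0 < d by rewrite divr_gt0 ?subr_gt0 // mulr_gt0.
  have dE : 2 * B * d = quad (a i) x - n%:R.
    by rewrite mulrC divfK // gt_eqF // mulr_gt0.
  exists (x, Num.min d (Num.min (p.2 / 2) n.+1%:R^-1)) => _ /=; split.
  - by rewrite !lt_min dd d0 invr_gt0 ltr0n.
  - by rewrite !ge_min lexx !orbT.
  - have : Num.min d (Num.min (p.2 / 2) n.+1%:R^-1) <= p.2 / 2 by rewrite !ge_min lexx orbT.
    lra.
  exists i => // y yx; have {}yx : rnorm (y - x) <= d by rewrite (le_trans yx) // ge_min lexx.
  have := quadD (pa _ Di) x (y - x); rewrite addrC subrK => ->.
  have := form_ge0 (pa _ Di) (y - x); rewrite -/(quad _ _) => q0.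
  have := normRe_le (a i x (y - x)); rewrite ler_norml => /andP[h1 _].
  have h2 := bM x (y - x).
  have h3 : M * rnorm x * rnorm (y - x) <= M * rnorm x * d.
    by rewrite ler_wpM2l // mulr_ge0 // rnorm_ge0.
  move: dE; rewrite /B => dE; lra.
have [f hf] := choice (fun np : nat * (V * R) => step np.1 np.2).
pose s := fix s n : V * R := if n is n'.+1 then f (n', s n') else (0, 1).
have s0 n : 0 < (s n).2 by elim: n => [|n IH]; [exact: ltr01 | case: (hf (n, s n) IH)].
have ss n k : rnorm ((s (n + k)%N).1 - (s n).1) + (s (n + k)%N).2 <= (s n).2.
  elim: k => [|k IH]; first by rewrite addn0 subrr rnorm0 add0r.
  rewrite addnS; have [_ _ h _] := hf ((n + k)%N, s (n + k)%N) (s0 (n + k)%N); rewrite /= in h *.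
  by have := rdist_tri (f ((n + k)%N, s (n + k)%N)).1 (s (n + k)%N).1 (s n).1; lra.
have sn n : (s n.+1).2 <= n.+1%:R^-1 by have [] := hf (n, s n) (s0 n).
have [l hl] : exists l, forall e : R, 0 < e -> exists N, forall n, (N <= n)%N ->
    rnorm ((s n).1 - l) < e.
  apply: complete_seq => e e0; have [N hN] := @invn_lt R (e / 2) ltac:(by rewrite divr_gt0).
  have sN := le_lt_trans (sn N) (hN N (leqnn N)).
  exists N.+1 => m n Nm Nn; change (rnorm ((s m).1 - (s n).1) < e).
  apply: le_lt_trans (rdist_tri _ (s N.+1).1 _) _; rewrite (rdistC (s N.+1).1).
  have := ss N.+1 (m - N.+1)%N; have := ss N.+1 (n - N.+1)%N.
  rewrite !subnKC //; have := s0 m; have := s0 n.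
  move: (s N.+1) sN => q sN; lra.
have ln n : rnorm (l - (s n).1) <= (s n).2.
  apply/ler_addgt0Pr => e e0; have [N hN] := hl _ e0.
  have := hN (n + N)%N (leq_addl _ _); have := ss n N; have := s0 (n + N)%N.
  by have := rdist_tri l (s (n + N)%N).1 (s n).1; rewrite (rdistC l (s (n + N)%N).1); lra.
have [M hM] := ptb l.
(* The limit [l] lies in every ball, and throughout ball number [n + 1] some form exceeds
   [n > M]. *)
pose n := (Num.truncn `|M|).+1.
have [_ _ _ [i Di /(_ l (ln n.+1))]] := hf (n, s n) (s0 n).
apply/negP; rewrite -leNgt; apply: le_trans (hM _ Di) _.
by rewrite (le_trans (ler_norm _)) // ltW // truncnS_gt.
Qed.

(* Minimisation of [quad a x - 2 Re (f x)]: by the parallelogram law a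
   minimising sequence is Cauchy. *)
Lemma lax_milgram a (f : V -> R[i]) M m K : psd_form a -> 0 < m ->
  (forall u v, rnorm (a u v) <= M * rnorm u * rnorm v) ->
  (forall v, m * rnorm v ^+ 2 <= quad a v) ->
  (forall k u v, f (k *: u + v) = conjc k * f u + f v) ->
  (forall v, rnorm (f v) <= K * rnorm v) ->
  exists x, forall v, a x v = f v.
Proof.
move=> pa m0 bM cm lf bf.
have f0 : f 0 = 0 by have := lf (-1) 0 0; rewrite scaler0 addr0 rmorphN rmorph1 mulN1r addNr.
have fZ k u : f (k *: u) = conjc k * f u by rewrite -[k *: u]addr0 lf f0 addr0.
have fD u v : f (u + v) = f u + f v by rewrite -{1}[u]scale1r lf rmorph1 mul1r.
pose J x := quad a x - 2 * Re (f x).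
have JD x h : J (x + h) = J x + quad a h + 2 * Re (a x h) - 2 * Re (f h).
  by rewrite /J quadD // fD ReD; lra.
pose E := [set J x | x in setT].
have Elb : has_lbound E.
  (* Minimum of [m s^2 - 2 K s] over [s], by completing the square. *)
  exists (- (K ^+ 2 / m)) => _ [x _ <-].
  have := cm x; have := bf x; have := Re_le (f x); rewrite /J.
  have := sqr_ge0 (m * rnorm x - K); rewrite sqrrB exprMn => h1 h2 h3 h4.
  have : 0 <= m * rnorm x ^+ 2 - 2 * K * rnorm x + K ^+ 2 / m.
    rewrite -(pmulr_rge0 _ m0).
    have -> // : m * (m * rnorm x ^+ 2 - 2 * K * rnorm x + K ^+ 2 / m) =
      m ^+ 2 * rnorm x ^+ 2 - m * rnorm x * K *+ 2 + K ^+ 2.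
    by move: (rnorm x) => r; field; rewrite gt_eqF.
  lra.
have E0 : E !=set0 by exists (J 0), 0.
have infE : has_inf E by [].
have Jge x : inf E <= J x by apply: ge_inf => //; exists x.
have xn n : exists x, J x < inf E + n.+1%:R^-1.
  have [|_ [x _ <-] h] := @inf_adherent _ E n.+1%:R^-1 _ infE; first by rewrite invr_gt0 ltr0n.
  by exists x.
have [x hx] := choice xn.
(* The parallelogram law, with [J] at least [inf E] at the midpoint of [u] and [v]. *)
have Jq u v : quad a (u - v) <= 2 * (J u + J v - 2 * inf E).
  have := Jge (2^-1%:C *: (u + v)).
  rewrite /J quadZ // rnorm_real fZ conjcR ReM /= mul0r subr0 fD ReD ger0_norm ?invr_ge0 //.
  by have := parallelogram pa u v; lra.
have [l hl] : exists l, forall e : R, 0 < e -> exists N, forall n, (N <= n)%N ->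
    rnorm (x n - l) < e.
  apply: complete_seq => e e0.
  have e1 : 0 < m * e ^+ 2 / 4 by rewrite divr_gt0 // mulr_gt0 // exprn_gt0.
  have [N hN] := @invn_lt R _ e1.
  exists N => p q Np Nq; rewrite -ltr_sqr ?nnegrE ?rnorm_ge0 ?(ltW e0) //.
  rewrite -(ltr_pM2l m0) (le_lt_trans (cm _)) // (le_lt_trans (Jq _ _)) //.
  have := lt_trans (hx p) (ler_ltD (lexx (inf E)) (hN _ Np)).
  by have := lt_trans (hx q) (ler_ltD (lexx (inf E)) (hN _ Nq)); lra.
have Jl : J l <= inf E.
  apply/ler_addgt0Pr => e e0.
  pose B := 2 * `|M| * rnorm l + 2 * `|K| + 1.
  have B0 : 0 < B by rewrite ltr_wpDl // addr_ge0 // !mulr_ge0 ?rnorm_ge0.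
  have [N1 h1] := hl (e / 2 / B) ltac:(by rewrite !divr_gt0).
  have [N2 h2] := @invn_lt R (e / 2) ltac:(by rewrite divr_gt0).
  pose n := maxn N1 N2; have := h1 n (leq_maxl _ _).
  have := lt_trans (hx n) (ler_ltD (lexx (inf E)) (h2 n (leq_maxr _ _))).
  have := JD l (x n - l); rewrite addrC subrK => -> {}h1.
  rewrite ltr_pdivlMr // /B => h3.
  set h := x n - l in h1 h3 *.
  have q0 := form_ge0 pa h; rewrite -/(quad a h) in q0.
  have := normRe_le (a l h); rewrite ler_norml => /andP[h4 _].
  have := Re_le (f h); have := bf h; have := bM l h.
  have : K * rnorm h <= `|K| * rnorm h by rewrite ler_wpM2r ?rnorm_ge0 ?ler_norm.
  have : M * rnorm l * rnorm h <= `|M| * rnorm l * rnorm h.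
    by rewrite -!mulrA ler_wpM2r ?mulr_ge0 ?rnorm_ge0 ?ler_norm.
  have := rnorm_ge0 h; lra.
exists l => v; pose g := a l v - f v.
suff : rnorm g ^+ 2 <= 0.
  rewrite -[0](expr0n _ 2) => /(rnorm_le_sqr (lexx 0)) g0.
  apply/eqP; rewrite -subr_eq0; apply/eqP/rnorm_eq0/eqP.
  by rewrite eq_le g0 rnorm_ge0.
have qv := form_ge0 pa v; rewrite -/(quad a v) in qv.
(* Moving the minimiser [l] by [- t g v] changes [J] by [t |g|^2 (t quad v - 2)]. Since
   [t quad v <= 1], this is negative unless [g = 0]; the added [1] covers [quad v = 0]. *)
pose t := (quad a v + 1)^-1; have t0 : 0 < t by rewrite invr_gt0 ltr_wpDl.
have tq : t * quad a v <= 1.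
  by rewrite -ler_pdivlMl // invrK mulr1 lerDl.
have := Jge (l + (- (t%:C * g)) *: v); rewrite JD quadZ // (formZr pa) fZ => h.
have {}h : 0 <= t * (rnorm g ^+ 2 * (t * quad a v) - 2 * rnorm g ^+ 2).
  have -> : t * (rnorm g ^+ 2 * (t * quad a v) - 2 * rnorm g ^+ 2) =
      rnorm (- (t%:C * g)) ^+ 2 * quad a v + 2 * Re (conjc (- (t%:C * g)) * g).
    have -> : conjc (- (t%:C * g)) * g = - (t * rnorm g ^+ 2)%:C.
      by rewrite conjcN conjcM conjcR realcM -mul_conj; ring.
    by rewrite rnormN rnormM rnorm_real gtr0_norm // ReN /=; ring.
  move: h; set c := conjc _; rewrite (_ : c * g = c * a l v - c * f v) ?ReB; last by rewrite -mulrBr.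
  lra.
move: h; rewrite pmulr_rge0 // => h.
have : rnorm g ^+ 2 * (t * quad a v) <= rnorm g ^+ 2 * 1 by rewrite ler_wpM2l ?sqr_ge0.
lra.
Qed.

(** For the form [dot] itself, [lax_milgram] is the Riesz representation theorem, and it gives [Q u]
    vector by vector. Linearity comes from the uniqueness of the representative, boundedness from
    testing [Q v] against itself. *)
Lemma bounded_sesquilinear_op (b : V -> V -> R[i]) K :
  (forall k u v w, b (k *: u + v) w = k * b u w + b v w) ->
  (forall k u v w, b w (k *: u + v) = conjc k * b w u + b w v) ->
  (forall u v, rnorm (b u v) <= K * rnorm u * rnorm v) ->
  exists2 Q : V -> V, is_End Q & forall u v, dot (Q u) v = b u v.
Proof.
move=> bl br bK.
have Qx u : exists q, forall v, dot q v = b u v.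
  apply: (lax_milgram (m := 1) (M := 1) dot_psd) => // [u' v|v].
    by rewrite mul1r rnorm_dot_le.
  by rewrite mul1r quad_dot.
have [Q hQ] := choice Qx; exists Q => //.
apply: (bounded_linear_is_End (K := `|K|)) => [k u v|v].
  by apply: dot_inj => w; rewrite (form_lin dot_psd) !hQ bl.
have [->|Q0] := eqVneq (rnorm (Q v)) 0; first by rewrite mulr_ge0 ?rnorm_ge0.
have {}Q0 : 0 < rnorm (Q v) by rewrite lt_neqAle rnorm_ge0 andbT eq_sym.
rewrite -(ler_pM2r Q0) -expr2 -quad_dot /quad hQ.
apply: le_trans (Re_le _) _; apply: le_trans (bK _ _) _.
by rewrite -!mulrA ler_wpM2r ?mulr_ge0 ?rnorm_ge0 ?ler_norm.
Qed.

(** [lax_milgram] gives surjectivity. Coercivity and Cauchy-Schwarz give [m |v| <= |T v|], hence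
    injectivity and the bound [1 / m] for the inverse. *)
Lemma coercive_inverse (T : V -> V) m K : linear T -> 0 < m ->
  psd_form (fun u v => dot (T u) v) ->
  (forall v, rnorm (T v) <= K * rnorm v) ->
  (forall v, m * rnorm v ^+ 2 <= Re (dot (T v) v)) ->
  exists S, is_End_inverse T S.
Proof.
move=> lT m0 pT bT cT.
have Sx u : exists x, T x = u.
  have bT' v w : rnorm (dot (T v) w) <= K * rnorm v * rnorm w.
    by rewrite (le_trans (rnorm_dot_le _ _)) // ler_wpM2r ?rnorm_ge0.
  have lu k v w : dot u (k *: v + w) = conjc k * dot u v + dot u w.
    by rewrite (formDr dot_psd) (formZr dot_psd).
  have [x hx] := lax_milgram pT m0 bT' cT lu (rnorm_dot_le u).
  by exists x; apply: dot_inj.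
have [S hS] := choice Sx.
have Tm v : m * rnorm v <= rnorm (T v).
  have [->|v0] := eqVneq (rnorm v) 0; first by rewrite mulr0 rnorm_ge0.
  have {}v0 : 0 < rnorm v by rewrite lt_neqAle rnorm_ge0 andbT eq_sym.
  rewrite -(ler_pM2r v0) -mulrA -expr2 (le_trans (cT _)) //.
  by rewrite (le_trans (Re_le _)) // rnorm_dot_le.
have Tinj u v : T u = T v -> u = v.
  move=> h; apply/eqP; rewrite -subr_eq0; apply/eqP/rnorm_eq0/eqP.
  have := Tm (u - v); rewrite linear_funB // h subrr rnorm0.
  by rewrite pmulr_rle0 // eq_le rnorm_ge0 andbT.
exists S; split; last 2 first.
- by move=> v; apply: Tinj; rewrite hS.
- by move=> v; rewrite hS.
apply: (bounded_linear_is_End (K := m^-1)) => [k u v|v].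
  by apply: Tinj; rewrite lT !hS.
by rewrite -(ler_pM2l m0) mulrA divff ?gt_eqF // mul1r (le_trans (Tm _)) // hS.
Qed.

End Hilbert.

(** * Averages over the circle *)

Section CircleAverage.
Context (R : realType).
Implicit Types (f g : R -> R) (F G : R -> R[i]).

(** A class closed under sums and products whose members are all integrable over [angles]. Both
    conditions are imposed on the whole line, which costs nothing for functions of a point on the
    circle. *)
Definition bounded_measurable f : Prop :=
  measurable_fun setT f /\ exists M, forall t, `|f t| <= M.

Local Notation bm := bounded_measurable.

Definition aver f : R := (2 * pi)^-1 * Rintegral (@lebesgue_measure R) (@angles R) f.

Lemma measurable_angles : measurable (@angles R).
Proof. exact: measurable_itv. Qed.

Lemma twopi_gt0 : 0 < 2 * pi :> R.
Proof. by rewrite mulr_gt0 ?pi_gt0. Qed.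

Lemma measure_angles : @lebesgue_measure R (@angles R) = (2 * pi)%:E.
Proof.
by rewrite /angles lebesgue_measure_itv /= lte_fin twopi_gt0 -EFinB subr0.
Qed.

Lemma bm_integrable f : bm f ->
  (@lebesgue_measure R).-integrable (@angles R) (EFin \o f).
Proof.
move=> [mf [M hM]]; apply: measurable_bounded_integrable.
- exact: measurable_angles.
- by rewrite [X in (X < _)%E]measure_angles ltry.
- exact: measurable_funTS.
- exists M; split; first exact: num_real.
  by move=> K MK t _ /=; rewrite (le_trans (hM t)) // ltW.
Qed.

Lemma bm_cst (c : R) : bm (fun=> c).
Proof. by split; [exact: measurable_cst | exists `|c|]. Qed.

Lemma bmD f g : bm f -> bm g -> bm (fun t => f t + g t).
Proof.
move=> [mf [M hM]] [mg [N hN]]; split; first exact: measurable_funD.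
by exists (M + N) => t; rewrite (le_trans (ler_normD _ _)) // lerD.
Qed.

Lemma bmM f g : bm f -> bm g -> bm (fun t => f t * g t).
Proof.
move=> [mf [M hM]] [mg [N hN]]; split; first exact: measurable_funM.
by exists (M * N) => t; rewrite normrM ler_pM.
Qed.

Lemma bmZ k f : bm f -> bm (fun t => k * f t).
Proof. exact: bmM (bm_cst k). Qed.

Lemma bm_ext f g : f =1 g -> bm f -> bm g.
Proof. by move=> /funext ->. Qed.

Lemma bmN f : bm f -> bm (fun t => - f t).
Proof. by move=> /(bmZ (-1)); apply: bm_ext => t; rewrite mulN1r. Qed.

Lemma bmB f g : bm f -> bm g -> bm (fun t => f t - g t).
Proof. by move=> bf /bmN; exact: bmD. Qed.

Lemma bm_norm f : bm f -> bm (fun t => `|f t|).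
Proof.
move=> [mf [M hM]]; split; first exact: measurableT_comp.
by exists M => t; rewrite normr_id.
Qed.

Lemma bm_continuous f M : continuous f -> (forall t, `|f t| <= M) -> bm f.
Proof. by move=> cf hM; split; [exact: continuous_measurable_fun | exists M]. Qed.

Lemma bm_cos : bm (@cos R).
Proof. by apply: (bm_continuous (M := 1)) => [|t]; [exact: continuous_cos | exact: cos_max]. Qed.

Lemma bm_sin : bm (@sin R).
Proof. by apply: (bm_continuous (M := 1)) => [|t]; [exact: continuous_sin | exact: sin_max]. Qed.

Lemma averD f g : bm f -> bm g -> aver (fun t => f t + g t) = aver f + aver g.
Proof.
move=> bf bg; rewrite /aver RintegralD ?mulrDr //.
- exact: measurable_angles.
- exact: bm_integrable.
- exact: bm_integrable.
Qed.

Lemma averZ k f : bm f -> aver (fun t => k * f t) = k * aver f.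
Proof.
move=> bf; rewrite /aver RintegralZl; first by rewrite mulrCA.
- exact: measurable_angles.
- exact: bm_integrable.
Qed.

Lemma aver_ext f g : f =1 g -> aver f = aver g.
Proof. by move=> /funext ->. Qed.

Lemma averN f : bm f -> aver (fun t => - f t) = - aver f.
Proof.
by move=> bf; rewrite -mulN1r -averZ //; apply: aver_ext => t; rewrite mulN1r.
Qed.

Lemma averB f g : bm f -> bm g -> aver (fun t => f t - g t) = aver f - aver g.
Proof. by move=> bf bg; rewrite averD ?averN //; exact: bmN. Qed.

Lemma aver_cst c : aver (fun=> c) = c.
Proof.
rewrite /aver Rintegral_cst; last exact: measurable_angles.
rewrite [X in fine X]measure_angles /=.
by rewrite mulrCA mulVf ?mulr1 // gt_eqF // twopi_gt0.
Qed.

Lemma le_aver f g : bm f -> bm g -> (forall t, f t <= g t) -> aver f <= aver g.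
Proof.
move=> bf bg fg; rewrite /aver ler_pM2l ?invr_gt0 ?twopi_gt0 //.
apply: le_Rintegral => //; first exact: measurable_angles.
- exact: bm_integrable.
- exact: bm_integrable.
Qed.

Lemma aver_le_cst f c : bm f -> (forall t, f t <= c) -> aver f <= c.
Proof. by move=> bf h; rewrite -[c]aver_cst le_aver //; exact: bm_cst. Qed.

Lemma aver_ge_cst f c : bm f -> (forall t, c <= f t) -> c <= aver f.
Proof. by move=> bf h; rewrite -[c]aver_cst le_aver //; exact: bm_cst. Qed.

Definition cbm F : Prop := bm (fun t => Re (F t)) /\ bm (fun t => Im (F t)).

Definition caver F : R[i] := aver (fun t => Re (F t)) +i* aver (fun t => Im (F t)).

Lemma cbm_ext F G : F =1 G -> cbm F -> cbm G.
Proof. by move=> /funext ->. Qed.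

Lemma caver_ext F G : F =1 G -> caver F = caver G.
Proof. by move=> /funext ->. Qed.

Lemma cbm_cst c : cbm (fun=> c).
Proof. by split; exact: bm_cst. Qed.

Lemma cbmD F G : cbm F -> cbm G -> cbm (fun t => F t + G t).
Proof.
move=> [F1 F2] [G1 G2]; split.
  by apply: bm_ext (bmD F1 G1) => t; rewrite ReD.
by apply: bm_ext (bmD F2 G2) => t; rewrite ImD.
Qed.

Lemma cbmM F G : cbm F -> cbm G -> cbm (fun t => F t * G t).
Proof.
move=> [F1 F2] [G1 G2]; split.
  by apply: bm_ext (bmB (bmM F1 G1) (bmM F2 G2)) => t; rewrite ReM.
by apply: bm_ext (bmD (bmM F1 G2) (bmM F2 G1)) => t; rewrite ImM.
Qed.

Lemma cbmZ k F : cbm F -> cbm (fun t => k * F t).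
Proof. exact: cbmM (cbm_cst k). Qed.

Lemma cbmX F n : cbm F -> cbm (fun t => F t ^+ n).
Proof.
move=> cF; elim: n => [|n IH]; first exact: cbm_cst.
by apply: cbm_ext (cbmM cF IH) => t; rewrite exprS.
Qed.

Lemma cbm_conj F : cbm F -> cbm (fun t => conjc (F t)).
Proof.
move=> [F1 F2]; split; first by apply: bm_ext F1 => t; rewrite Re_conj.
by apply: bm_ext (bmN F2) => t; rewrite Im_conj.
Qed.

Lemma cbm_real f : bm f -> cbm (fun t => (f t)%:C).
Proof. by move=> bf; split=> //=; exact: bm_cst. Qed.

Lemma cbm_rnorm F : cbm F -> bm (fun t => rnorm (F t)).
Proof.
move=> [F1 F2]; have [_ [M hM]] := F1; have [_ [N hN]] := F2; split; last first.
  exists (M + N) => t; rewrite ger0_norm ?rnorm_ge0 //.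
  by rewrite (le_trans (rnorm_le_ReIm _)) // lerD.
have [m _] := bmD (bmM F1 F1) (bmM F2 F2).
rewrite (_ : (fun t => _) = Num.sqrt \o (fun t => Re (F t) * Re (F t) + Im (F t) * Im (F t))).
  by apply: measurableT_comp m; apply: continuous_measurable_fun; exact: sqrt_continuous.
by apply/funext => t /=; rewrite -!expr2 -rnorm_sqr sqrtr_sqr ger0_norm ?rnorm_ge0.
Qed.

Lemma cbm_expi : cbm (@expi R).
Proof. by split=> /=; [exact: bm_cos | exact: bm_sin]. Qed.

Lemma cbm_sum (I : Type) (s : seq I) (F : I -> R -> R[i]) :
  (forall i, cbm (F i)) -> cbm (fun t => \sum_(i <- s) F i t).
Proof.
move=> cF; elim: s => [|i s IH].
  by apply: cbm_ext (cbm_cst 0) => t; rewrite big_nil.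
by apply: cbm_ext (cbmD (cF i) IH) => t; rewrite big_cons.
Qed.

Lemma caverD F G : cbm F -> cbm G -> caver (fun t => F t + G t) = caver F + caver G.
Proof.
move=> [F1 F2] [G1 G2]; apply: complex_ext; rewrite ?ReD ?ImD /= -averD //.
  by apply: aver_ext => t; rewrite ReD.
by apply: aver_ext => t; rewrite ImD.
Qed.

Lemma caverZ k F : cbm F -> caver (fun t => k * F t) = k * caver F.
Proof.
move=> [F1 F2]; apply: complex_ext; rewrite ?ReM ?ImM /=.
  rewrite -!averZ // -averB; [|exact: bmZ..].
  by apply: aver_ext => t; rewrite ReM.
rewrite -!averZ // -averD; [|exact: bmZ..].
by apply: aver_ext => t; rewrite ImM.
Qed.

Lemma caver_sum (I : Type) (s : seq I) (F : I -> R -> R[i]) :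
  (forall i, cbm (F i)) -> caver (fun t => \sum_(i <- s) F i t) = \sum_(i <- s) caver (F i).
Proof.
move=> cF; elim: s => [|i s IH].
  rewrite big_nil (_ : (fun t => _) = fun=> 0); last by apply/funext => t; rewrite big_nil.
  by apply: complex_ext; rewrite /= aver_cst.
rewrite big_cons -IH -caverD //; last exact: cbm_sum.
by apply: caver_ext => t; rewrite big_cons.
Qed.

Lemma caver_cst c : caver (fun=> c) = c.
Proof. by apply: complex_ext; rewrite /= aver_cst. Qed.

Lemma caver_conj F : cbm F -> caver (fun t => conjc (F t)) = conjc (caver F).
Proof.
move=> [F1 F2]; apply: complex_ext; rewrite ?Re_conj ?Im_conj /=.
  by apply: aver_ext => t; rewrite Re_conj.
by rewrite -averN //; apply: aver_ext => t; rewrite Im_conj.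
Qed.

Lemma caver_real f : caver (fun t => (f t)%:C) = (aver f)%:C.
Proof. by apply: complex_ext => //=; rewrite aver_cst. Qed.

Lemma Re_caver F : Re (caver F) = aver (fun t => Re (F t)).
Proof. by []. Qed.

(** A factor [k] of modulus at most one rotates the average onto the nonnegative real axis; under
    the integral, [Re (k F) <= |F|]. *)
Lemma rnorm_caver F : cbm F -> rnorm (caver F) <= aver (fun t => rnorm (F t)).
Proof.
move=> cF; set c := caver F.
pose k := conjc (c / (rnorm c)%:C).
have k1 : rnorm k <= 1.
  rewrite rnorm_conj rnormM rnormV rnorm_real ger0_norm ?rnorm_ge0 //.
  have [->|c0] := eqVneq (rnorm c) 0; first by rewrite mul0r.
  by rewrite divff.
rewrite -[leLHS]Re_mul_conj_norm mulrC -/k -caverZ // Re_caver.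
apply: le_aver; [by have [] := cbmZ k cF | exact: cbm_rnorm|] => t.
by rewrite (le_trans (Re_le _)) // rnormM ler_piMl // rnorm_ge0.
Qed.

Lemma rnorm_caver_le F c : cbm F -> (forall t, rnorm (F t) <= c) -> rnorm (caver F) <= c.
Proof.
move=> cF h; apply: le_trans (rnorm_caver cF) _.
by apply: aver_le_cst => //; exact: cbm_rnorm.
Qed.

Lemma expiD (s t : R) : expi (s + t) = expi s * expi t.
Proof.
by apply: complex_ext; rewrite ?ReM ?ImM /= ?cosD ?sinD //; ring.
Qed.

Lemma expi0 : expi 0 = 1 :> R[i].
Proof. by rewrite /expi cos0 sin0. Qed.

Lemma expiX (t : R) n : expi t ^+ n = expi (n%:R * t).
Proof.
elim: n => [|n IH]; first by rewrite mul0r expi0.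
by rewrite exprS IH -expiD mulrSr mulrDl mul1r addrC.
Qed.

Lemma rnorm_expi (t : R) : rnorm (expi t) = 1.
Proof.
apply/eqP; rewrite -(@eqrXn2 _ 2) ?rnorm_ge0 // rnorm_sqr /= cos2Dsin2 expr1n //.
Qed.

Lemma expi_conj (t : R) : expi t * conjc (expi t) = 1.
Proof. by rewrite mul_conj rnorm_expi expr1n. Qed.

(** The derivative is required only slightly beyond the interval, because the primitives to which
    this is applied are integrals starting at [-1]. *)
Lemma aver_FTC (f G : R -> R) : continuous f ->
  (forall x : R, -1 < x < 2 * pi + 1 -> is_derive x 1 G (f x)) ->
  aver f = (2 * pi)^-1 * (G (2 * pi) - G 0).
Proof.
move=> cf dG; rewrite /aver /Rintegral.
have p0 := twopi_gt0.
have cG (x : R) : -1 < x < 2 * pi + 1 -> G @ x --> G x.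
  move=> /dG dGx; apply/differentiable_continuous/derivable1_diffP; exact: ex_derive.
have in1 (x : R) : x \in `]0, (2 * pi)[ -> -1 < x < 2 * pi + 1.
  by rewrite in_itv /=; lra.
rewrite (@continuous_FTC2 _ f G) //.
- exact: continuous_subspaceT.
- split; first by move=> x /in1 /dG dGx; exact: ex_derive.
    by apply: cvg_at_right_filter; apply: cG; lra.
  by apply: cvg_at_left_filter; apply: cG; lra.
- by move=> x /in1 /dG dGx; rewrite derive1E; exact: derive_val.
Qed.

Lemma aver_eq0 (f G : R -> R) : continuous f ->
  (forall x : R, is_derive x 1 G (f x)) -> G 0 = G (2 * pi) -> aver f = 0.
Proof.
by move=> cf dG G0; rewrite (aver_FTC (G := G)) // G0 subrr mulr0.
Qed.

Lemma caver_expiX n : (0 < n)%N -> caver (fun t => expi t ^+ n) = 0.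
Proof.
move=> n0; have nR : n%:R != 0 :> R by rewrite pnatr_eq0 -lt0n.
have cM : continuous (fun x : R => n%:R * x).
  by move=> x; apply: cvgM; [exact: cvg_cst | exact: cvg_id].
have per : (expi (n%:R * (2 * pi)) : R[i]) = 1.
  by rewrite -expiX /expi mulr_natl cos2pi sin2pi; exact: expr1n.
have dM (x : R) : is_derive x 1 (fun x : R => n%:R * x) n%:R.
  by apply: is_derive_eq; rewrite /GRing.scale /=; ring.
have cper : cos (n%:R * (2 * pi)) = 1 :> R by case: per.
have sper : sin (n%:R * (2 * pi)) = 0 :> R by case: per.
have ccos : continuous (fun x : R => cos (n%:R * x)).
  by move=> x; apply: continuous_comp; [exact: cM | exact: continuous_cos].
have csin : continuous (fun x : R => sin (n%:R * x)).
  by move=> x; apply: continuous_comp; [exact: cM | exact: continuous_sin].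
apply: complex_ext => /=.
  rewrite (_ : (fun t => _) = (fun t : R => cos (n%:R * t))); last first.
    by apply/funext => t; rewrite expiX.
  apply: (aver_eq0 (G := fun t => n%:R^-1 * sin (n%:R * t))) => //.
    move=> x; apply: is_derive_eq; rewrite /GRing.scale /=; field.
    by rewrite nR.
  by rewrite sper !mulr0 sin0 mulr0.
rewrite (_ : (fun t => _) = (fun t : R => sin (n%:R * t))); last first.
  by apply/funext => t; rewrite expiX.
apply: (aver_eq0 (G := fun t => - n%:R^-1 * cos (n%:R * t))) => //.
  move=> x; apply: is_derive_eq; rewrite /GRing.scale /=; field.
  by rewrite nR.
by rewrite cper !mulr0 cos0.
Qed.

Lemma caver_expi_eq0 (j n : nat) : j != n ->
  caver (fun t => conjc (expi t ^+ j) * expi t ^+ n) = 0.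
Proof.
have cE k : cbm (fun t => expi t ^+ k) by apply: cbmX; exact: cbm_expi.
have eK (t : R) a b : conjc (expi t ^+ a) * expi t ^+ (a + b) = expi t ^+ b.
  by rewrite exprD mulrA conjcX -exprMn (mulrC (conjc _)) expi_conj expr1n mul1r.
case: ltngtP => // jn _.
  rewrite (_ : (fun t => _) = (fun t => expi t ^+ (n - j))); last first.
    by apply/funext => t; rewrite -{1}(subnKC (ltnW jn)) eK.
  by rewrite caver_expiX // subn_gt0.
rewrite (_ : (fun t => _) = (fun t => conjc (expi t ^+ (j - n)))); last first.
  apply/funext => t; rewrite -{1}(subnKC (ltnW jn)) -(eK t n (j - n)%N).
  by rewrite !conjcM conjcK mulrC.
by rewrite caver_conj // caver_expiX ?subn_gt0 // conjc0.
Qed.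

End CircleAverage.

(** * Weak averages of the operator function *)

Section UpperSemicontinuous.
Context (R : realType).
Variables (Omega : set R[i]) (u : R[i] -> R).

Lemma usc_onP : usc_on Omega (fun z => (u z)%:E) <->
  forall z (a : R), Omega z -> u z < a ->
    exists2 d : R, 0 < d & forall y, rnorm (y - z) < d -> Omega y -> u y < a.
Proof.
split=> h z a Oz; [move=> ua|rewrite lte_fin => ua].
  have := h z a Oz; rewrite lte_fin => /(_ ua)/near_rnorm[d d0 {}h].
  by exists d => // y yz Oy; have := h y yz Oy; rewrite lte_fin.
by have [d d0 {}h] := h z a Oz ua; apply/near_rnorm; exists d.
Qed.

Hypothesis uscu : usc_on Omega (fun z => (u z)%:E).
Variables (z0 : R[i]) (r : R).
Hypothesis KO : closed_disc z0 r `<=` Omega.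

Lemma usc_bounded : exists M, forall z, closed_disc z0 r z -> u z <= M.
Proof.
apply: (closed_disc_ind (Q := fun A => exists M, forall z, A z -> u z <= M)).
- by move=> A B AB [M hM]; exists M => z /AB; exact: hM.
- by exists 0.
- move=> A B [M hM] [N hN]; exists (Num.max M N) => z [/hM|/hN] h.
    by rewrite le_max h.
  by rewrite le_max h orbT.
move=> z Kz; have /usc_onP h := uscu.
have [d d0 hd] := h z (u z + 1) (KO Kz) ltac:(by rewrite ltrDl).
exists d => //; exists (u z + 1) => y [/KO Oy yz].
by rewrite ltW // hd.
Qed.

(** If the supremum were not attained, then near each [z] the function would stay below the midpoint
    of [u z] and the supremum. By compactness it would stay below a single constant less than the
    supremum. *)
Lemma usc_max : 0 <= r ->
  exists2 z1, closed_disc z0 r z1 & forall z, closed_disc z0 r z -> u z <= u z1.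
Proof.
move=> r0; pose E := [set u z | z in closed_disc z0 r].
have E0 : E !=set0.
  by exists (u z0), z0 => //; apply/closed_discE; rewrite subrr rnorm0.
have Eub : has_ubound E.
  by have [M hM] := usc_bounded; exists M => _ [z Kz <-]; exact: hM.
have supE : has_sup E by [].
apply: contrapT => nmax.
have lt_sup z : closed_disc z0 r z -> u z < sup E.
  move=> Kz; rewrite lt_neqAle ub_le_sup ?andbT //; last by exists z.
  apply/eqP => uz; apply: nmax; exists z => // y Ky; rewrite uz ub_le_sup //.
  by exists y.
pose Q A := exists2 a : R, a < sup E & forall z, A z -> u z <= a.
have [||A B|z Kz|a asup ha] := @closed_disc_ind _ z0 r Q.
- by move=> A B AB [a asup ha]; exists a => // z /AB; exact: ha.
- by exists (sup E - 1) => //; rewrite ltrBlDr ltrDl.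
- move=> [a as1 ha] [b bs1 hb]; exists (Num.max a b); first by rewrite gt_max as1 bs1.
  by move=> z [/ha|/hb] h; rewrite le_max h ?orbT.
- have uz := lt_sup _ Kz; have /usc_onP h := uscu.
  have [d d0 hd] := h z ((u z + sup E) / 2) (KO Kz) ltac:(lra).
  exists d => //; exists ((u z + sup E) / 2); first by lra.
  by move=> y [/KO Oy yz]; rewrite ltW // hd.
suff : sup E <= a by rewrite leNgt asup.
by apply: ge_sup => // _ [z Kz <-]; exact: ha.
Qed.

Lemma circleB (t : R) : circle z0 r t - z0 = r%:C * expi t.
Proof. by rewrite /circle addrC addKr. Qed.

Lemma rnorm_circle (t : R) : 0 < r -> rnorm (circle z0 r t - z0) = r.
Proof. by move=> r0; rewrite circleB rnormM rnorm_real rnorm_expi mulr1 gtr0_norm. Qed.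

Lemma circle_closed_disc (t : R) : 0 < r -> closed_disc z0 r (circle z0 r t).
Proof. by move=> r0; apply/closed_discE; rewrite rnorm_circle. Qed.

Lemma circle_near (t d : R) : 0 < d ->
  \forall s \near t, rnorm (circle z0 r s - circle z0 r t) < d.
Proof.
move=> d0; pose e := d / 2 / (`|r| + 1).
have r1 : 0 < `|r| + 1 by rewrite ltr_wpDl.
have e0 : 0 < e by rewrite !divr_gt0.
have /cvgrPdist_lt /(_ _ e0) hc := @continuous_cos R t.
have /cvgrPdist_lt /(_ _ e0) hs := @continuous_sin R t.
near=> s.
have h1 : `|cos t - cos s| < e by near: s.
have h2 : `|sin t - sin s| < e by near: s.
rewrite rdistC (_ : _ - _ = r%:C * (expi t - expi s)); last by rewrite /circle; ring.
rewrite rnormM rnorm_real.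
have h3 : rnorm (expi t - expi s) <= `|cos t - cos s| + `|sin t - sin s|.
  exact: le_trans (rnorm_le_ReIm _) _.
have {}h3 : rnorm (expi t - expi s) < 2 * e by lra.
apply: (@le_lt_trans _ _ (`|r| * (2 * e))); first by rewrite ler_wpM2l // ltW.
have : (`|r| + 1) * (2 * e) = d.
  by rewrite /e; move: (`|r|) r1 => x x1; field; rewrite gt_eqF.
by lra.
Unshelve. all: by end_near. Qed.

(** Semicontinuity and compactness bound [u] from above; nonnegativity supplies the bound from
    below. Measurability is that of the lower semicontinuous function [- u] along the circle. *)
Lemma usc_circle_bm : 0 < r -> (forall z, Omega z -> 0 <= u z) ->
  bounded_measurable (fun t => u (circle z0 r t)).
Proof.
move=> r0 u0; split; last first.
  have [M hM] := usc_bounded; exists M => t.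
  rewrite ger0_norm; first by apply: hM; exact: circle_closed_disc.
  by apply/u0/KO/circle_closed_disc.
have : measurable_fun setT (EFin \o (fun t => - u (circle z0 r t))).
  apply: lower_semicontinuous_measurable => t a /=; rewrite lte_fin ltrNr => ua.
  have /usc_onP h := uscu.
  have [d d0 {}h] := h _ _ (KO (circle_closed_disc t r0)) ua.
  exists [set s | rnorm (circle z0 r s - circle z0 r t) < d].
    exact: circle_near.
  move=> s /= /h; rewrite lte_fin ltrNr; apply.
  exact/KO/circle_closed_disc.
move=> /measurable_EFinP mN.
rewrite (_ : (fun t => _) = -%R \o (fun t => - u (circle z0 r t))).
  exact: measurableT_comp.
by apply/funext => t /=; rewrite opprK.
Qed.

End UpperSemicontinuous.

Section Averages.
Context (R : realType).
Implicit Types (f : R -> R).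

Lemma integral_aver f : bounded_measurable f ->
  (((2 * pi)^-1)%:E * \int[@lebesgue_measure R]_(t in @angles R) (f t)%:E)%E =
  (aver f)%:E.
Proof.
move=> bf; rewrite /aver /Rintegral EFinM fineK //.
apply: integrable_fin_num; [exact: measurable_angles | exact: bm_integrable].
Qed.

Lemma integralC_caver (r : R) (h : R -> R[i]) : 0 < r -> cbm h ->
  ((2 * pi * r)^-1)%:C * integralC (@angles R) (fun t => r%:C * h t) = caver h.
Proof.
move=> r0 ch; have E (g : R -> R[i]) : caver g = ((2 * pi)^-1)%:C * integralC (@angles R) g.
  by apply: complex_ext; rewrite ?ReM ?ImM /= ?mul0r ?subr0 ?addr0.
have := caverZ r%:C ch; rewrite E => h1.
rewrite invfM realcM mulrAC h1 mulrAC -realcM divff ?gt_eqF // mul1r //.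
Qed.

End Averages.

(** * Averages of [P] over a circle as bounded operators, and their adjoints *)

Section WeakAverages.
Context (R : realType) (V : completeNormedModType R[i]).
Variable dot : {dot V for (@conjc R)}.
Hypothesis hV : hilbert_norm dot.
Let dp := dot_psd hV.

Lemma End_ge0_psd (A : V -> V) : End_ge0 dot A -> psd_form (fun u v => dot (A u) v).
Proof.
move=> [[lA _] sA pA]; split=> [k u v w|u v|v]; first by rewrite lA (form_lin dp).
  by rewrite sA (form_conj dp).
by have := pA v; rewrite lecE /= => /andP[].
Qed.

Variables (Omega : set R[i]) (P : R[i] -> V -> V).
Hypothesis hOmega : open Omega.
Hypothesis hP : forall z, Omega z -> End_ge0 dot (P z).
Hypothesis husc : weakly_usc dot Omega P.

Definition pform z u v := dot (P z u) v.

Lemma pform_psd z : Omega z -> psd_form (pform z).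
Proof. by move=> /hP; exact: End_ge0_psd. Qed.

Lemma pform_usc v : usc_on Omega (fun z => (quad (pform z) v)%:E).
Proof. exact: husc. Qed.

Variables (z0 : R[i]) (r : R).
Hypothesis r0 : 0 < r.
Hypothesis KO : closed_disc z0 r `<=` Omega.

(** For each fixed [v], upper semicontinuity on the compact disc bounds [<P v, v>] there. These are
    the pointwise bounds from which [uniform_boundedness] produces one bound for all [v]. *)
Lemma pform_bounded : exists2 M : R, 0 <= M &
  forall z, closed_disc z0 r z -> forall v, quad (pform z) v <= M * rnorm v ^+ 2.
Proof.
apply: uniform_boundedness.
- by move=> z /KO; exact: pform_psd.
- move=> z /KO /hP [/is_End_bounded[K K0 hK] _ _]; exists K => // v.
  rewrite (le_trans (Re_le _)) // (le_trans (rnorm_dot_le hV _ _)) //.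
  by rewrite expr2 mulrA ler_wpM2r ?rnorm_ge0.
- by move=> v; apply: usc_bounded KO; exact: pform_usc.
Qed.

Local Notation c := (circle z0 r).

Lemma circle_Omega t : Omega (c t).
Proof. exact/KO/circle_closed_disc. Qed.

Lemma bm_quad_pform v : bounded_measurable (fun t => quad (pform (c t)) v).
Proof.
apply: (usc_circle_bm (u := fun z => quad (pform z) v) (Omega := Omega)) => //.
  exact: pform_usc.
by move=> z Oz; exact: form_ge0 (pform_psd Oz) _.
Qed.

Lemma cbm_pform v w : cbm (fun t => pform (c t) v w).
Proof.
have b v' w' : bounded_measurable (fun t => 4^-1 * (quad (pform (c t)) v' - quad (pform (c t)) w')).
  by apply: bmZ; apply: bmB; exact: bm_quad_pform.
split.
  by apply: bm_ext (b (v + w) (v - w)) => t; rewrite (polar_Re (pform_psd (circle_Omega t))).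
by apply: bm_ext (b (v + 'i *: w) (v - 'i *: w)) => t; rewrite (polar_Im (pform_psd (circle_Omega t))).
Qed.

Lemma weak_average (om : R -> R[i]) K : cbm om -> (forall t, rnorm (om t) <= K) ->
  exists2 Q : V -> V, is_End Q &
    forall v w, dot (Q v) w = caver (fun t => pform (c t) v w * om t).
Proof.
move=> co hK; have [M M0 hM] := pform_bounded.
have K0 : 0 <= K := le_trans (rnorm_ge0 _) (hK 0).
have cF v w := cbmM (cbm_pform v w) co.
apply: (bounded_sesquilinear_op hV (K := M * K)) => [k u v w|k u v w|u v].
- rewrite -caverZ // -caverD //; last exact: cbmZ.
  by apply: caver_ext => t; rewrite (form_lin (pform_psd (circle_Omega t))); ring.
- rewrite -caverZ // -caverD //; last exact: cbmZ.
  apply: caver_ext => t.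
  by rewrite (formDr (pform_psd (circle_Omega t))) (formZr (pform_psd (circle_Omega t))); ring.
apply: rnorm_caver_le => // t; rewrite rnormM.
rewrite (_ : M * K * _ * _ = M * rnorm u * rnorm v * K); last by ring.
apply: ler_pM; rewrite ?rnorm_ge0 //.
apply: (psd_form_bounded (pform_psd (circle_Omega t))) => //.
by apply: hM; exact: circle_closed_disc.
Qed.

Lemma is_weak_avgP (omega : R -> R -> R[i]) (om : R -> R[i]) Q : cbm om ->
  (forall t, omega r t = r%:C * om t) ->
  is_weak_avg dot P z0 r omega Q <->
  is_End Q /\ forall v w, dot (Q v) w = caver (fun t => pform (c t) v w * om t).
Proof.
move=> co omE; have cF v w := cbmM (cbm_pform v w) co.
have gE v w : (fun t => dot (P (c t) v) w * omega r t) =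
    (fun t => r%:C * (pform (c t) v w * om t)).
  by apply/funext => t; rewrite omE /pform; ring.
split=> -[EQ h]; split=> // v w.
  by have [_] := h v w; rewrite gE integralC_caver.
rewrite /= gE integralC_caver //; split=> //.
have [h1 h2] := cbmZ r%:C (cF v w).
by split; [exact: bm_integrable h1 | exact: bm_integrable h2].
Qed.

(* [dz / |dz|] on the circle. *)
Definition om_dz (t : R) : R[i] := 'i * expi t.

Lemma rnorm_om_dz t : rnorm (om_dz t) = 1.
Proof.
rewrite rnormM rnorm_expi mulr1.
by apply/eqP; rewrite -(@eqrXn2 _ 2) ?rnorm_ge0 // rnorm_sqr /= expr0n add0r expr1n.
Qed.

Lemma cbm_om_dz : cbm om_dz.
Proof. by apply: cbmZ; exact: cbm_expi. Qed.

Lemma weak_avg_arcP Q : is_weak_avg dot P z0 r (@arc_length R) Q <->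
  is_End Q /\ forall v w, dot (Q v) w = caver (fun t => pform (c t) v w).
Proof.
rewrite (is_weak_avgP (om := fun=> 1)); [|exact: cbm_cst|by move=> t; rewrite mulr1].
by split=> -[EQ h]; split=> // v w; rewrite h; apply: caver_ext => t; rewrite mulr1.
Qed.

Lemma weak_avg_dzP Q : is_weak_avg dot P z0 r (@dz R) Q <->
  is_End Q /\ forall v w, dot (Q v) w = caver (fun t => pform (c t) v w * om_dz t).
Proof.
by apply: is_weak_avgP; [exact: cbm_om_dz | move=> t; rewrite /dz /om_dz -mulrA mulrCA].
Qed.

Lemma weak_avg_dzbarP Q : is_weak_avg dot P z0 r (@dzbar R) Q <->
  is_End Q /\ forall v w, dot (Q v) w = caver (fun t => pform (c t) v w * conjc (om_dz t)).
Proof.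
apply: is_weak_avgP; first by apply: cbm_conj; exact: cbm_om_dz.
by move=> t; rewrite /dzbar /dz /om_dz !conjcM conjcR; ring.
Qed.

Section Blocks.
Variables A B C : V -> V.
Hypothesis hA : is_weak_avg dot P z0 r (@arc_length R) A.
Hypothesis hB : is_weak_avg dot P z0 r (@dz R) B.
Hypothesis hC : is_weak_avg dot P z0 r (@dzbar R) C.

Let AE := ((weak_avg_arcP A).1 hA).2.
Let BE := ((weak_avg_dzP B).1 hB).2.
Let CE := ((weak_avg_dzbarP C).1 hC).2.

Lemma avg_arc_sym v w : dot (A v) w = dot v (A w).
Proof.
rewrite [RHS](form_conj dp) !AE -caver_conj; last exact: cbm_pform.
by apply: caver_ext => t; exact: form_conj (pform_psd (circle_Omega t)) _ _.
Qed.

Lemma avg_dz_adj v w : dot (B v) w = dot v (C w).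
Proof.
rewrite [RHS](form_conj dp) BE CE -caver_conj; last first.
  by apply: cbmM; [exact: cbm_pform | apply: cbm_conj; exact: cbm_om_dz].
apply: caver_ext => t.
by rewrite conjcM conjcK (form_conj (pform_psd (circle_Omega t)) v w).
Qed.

Lemma avg_dzbar_adj v w : dot (C v) w = dot v (B w).
Proof. by rewrite (form_conj dp) -avg_dz_adj -(form_conj dp). Qed.

Lemma avg_arc_psd : psd_form (fun u v => dot (A u) v).
Proof.
have [lA _] := ((weak_avg_arcP A).1 hA).1.
split=> [k u v w|u v|v]; first by rewrite lA (form_lin dp).
  by rewrite avg_arc_sym (form_conj dp).
rewrite AE Re_caver; apply: aver_ge_cst; first by have [] := cbm_pform v v.
by move=> t; exact: form_ge0 (pform_psd (circle_Omega t)) _.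
Qed.

Lemma avg_affine v w :
  aver (fun t => quad (pform (c t)) (v + om_dz t *: w)) =
  Re (dot (A v) v) + Re (dot (B w) v) + Re (dot (C v) w) + Re (dot (A w) w).
Proof.
rewrite AE BE CE AE -!ReD.
have c1 := cbm_pform v v; have c2 := cbmM (cbm_pform w v) cbm_om_dz.
have c3 := cbmM (cbm_pform v w) (cbm_conj cbm_om_dz); have c4 := cbm_pform w w.
rewrite -!caverD; do ?[exact: c1 | exact: c2 | exact: c3 | exact: c4 | apply: cbmD].
rewrite Re_caver; apply: aver_ext => t.
have pp := pform_psd (circle_Omega t).
rewrite /quad (formDl pp) !(formDr pp) !(formZl pp) !(formZr pp); congr Re.
rewrite mulrA mul_conj rnorm_om_dz expr1n mul1r; ring.
Qed.

End Blocks.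
End WeakAverages.

(** * Block operators and Schur complements *)

Section ProductNorm.
Context (R : realType) (V : completeNormedModType R[i]).
Implicit Types (x y : V * V).

Lemma rnorm_pairE x : rnorm x = Num.max (rnorm x.1) (rnorm x.2).
Proof.
apply: complexI; rewrite -rnormE prod_normE !rnormE.
by rewrite [in LHS]/Num.max ltcR [in RHS]/Num.max; case: ifP.
Qed.

Lemma rnorm_fst x : rnorm x.1 <= rnorm x.
Proof. by rewrite rnorm_pairE le_max lexx. Qed.

Lemma rnorm_snd x : rnorm x.2 <= rnorm x.
Proof. by rewrite rnorm_pairE le_max lexx orbT. Qed.

Lemma rnorm_pair_le x : rnorm x <= rnorm x.1 + rnorm x.2.
Proof. by rewrite rnorm_pairE ge_max lerDl lerDr !rnorm_ge0. Qed.

Lemma block_op_is_End (A B C D : V -> V) :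
  is_End A -> is_End B -> is_End C -> is_End D ->
  is_End (U := (V * V)%type) (block_op A B C D).
Proof.
move=> EA EB EC ED.
have [[lA _] [lB _] [lC _] [lD _]] := And4 EA EB EC ED.
have [Ka _ hA] := is_End_bounded EA; have [Kb _ hB] := is_End_bounded EB.
have [Kc _ hC] := is_End_bounded EC; have [Kd _ hD] := is_End_bounded ED.
have up K (T : V -> V) v x : (forall v, rnorm (T v) <= K * rnorm v) ->
    rnorm v <= rnorm x -> rnorm (T v) <= `|K| * rnorm x.
  move=> hT vx; apply: le_trans (hT v) _.
  apply: (@le_trans _ _ (`|K| * rnorm v)).
    by rewrite ler_wpM2r ?rnorm_ge0 ?ler_norm.
  by rewrite ler_wpM2l.
apply: (bounded_linear_is_End (K := `|Ka| + `|Kb| + `|Kc| + `|Kd|)) => [k x y|x].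
  congr (_, _); rewrite /= ?lA ?lB ?lC ?lD /= !scalerDr; by rewrite addrACA.
apply: le_trans (rnorm_pair_le _) _ => /=.
have := rnormD (A x.1) (B x.2); have := rnormD (C x.1) (D x.2).
have := up _ _ _ _ hA (rnorm_fst x); have := up _ _ _ _ hB (rnorm_snd x).
by have := up _ _ _ _ hC (rnorm_fst x); have := up _ _ _ _ hD (rnorm_snd x); lra.
Qed.

Lemma is_EndB (U : normedModType R[i]) (A B : U -> U) :
  is_End A -> is_End B -> is_End (A \- B).
Proof.
move=> EA EB; have [[lA _] [lB _]] := conj EA EB.
have [K _ hA] := is_End_bounded EA; have [L _ hB] := is_End_bounded EB.
apply: (bounded_linear_is_End (K := K + L)) => [k x y|x].
  by rewrite /= lA lB scalerBr opprD addrACA.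
by rewrite mulrDl (le_trans (rnormB _ _)) // lerD.
Qed.

Lemma is_End_comp (U : normedModType R[i]) (A B : U -> U) :
  is_End A -> is_End B -> is_End (A \o B).
Proof.
move=> EA EB; have [[lA _] [lB _]] := conj EA EB.
have [K K0 hA] := is_End_bounded EA; have [L _ hB] := is_End_bounded EB.
apply: (bounded_linear_is_End (K := K * L)) => [k x y|x]; first by rewrite /= lB lA.
by rewrite -mulrA (le_trans (hA _)) // ler_wpM2l.
Qed.

Lemma is_End0 (U : normedModType R[i]) : is_End (fun _ : U => 0).
Proof.
apply: (bounded_linear_is_End (K := 0)) => [k x y|x]; first by rewrite scaler0 addr0.
by rewrite rnorm0 mul0r.
Qed.

End ProductNorm.

(** * The operator inequalities and the mean value inequality for affine maps *)

Section Equivalences.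
Context (R : realType) (V : completeNormedModType R[i]).
Variable dot : {dot V for (@conjc R)}.
Hypothesis hV : hilbert_norm dot.
Let dp := dot_psd hV.
Variables (Omega : set R[i]) (P : R[i] -> V -> V).
Hypothesis hP : forall z, Omega z -> End_ge0 dot (P z).
Hypothesis husc : weakly_usc dot Omega P.
Variables (z0 : R[i]) (r : R).
Hypothesis r0 : 0 < r.
Hypothesis KO : closed_disc z0 r `<=` Omega.

Local Notation c := (circle z0 r).

Let Oz0 : Omega z0.
Proof. by apply/KO/closed_discE; rewrite subrr rnorm0 ltW. Qed.

Lemma weak_averages_exist : exists A B C : V -> V,
  [/\ is_weak_avg dot P z0 r (@arc_length R) A,
      is_weak_avg dot P z0 r (@dz R) B
    & is_weak_avg dot P z0 r (@dzbar R) C].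
Proof.
have w := weak_average hV hP husc r0 KO.
have [A EA hA] := w (fun=> 1) 1 (cbm_cst 1) ltac:(by move=> t; rewrite rnorm1).
have [B EB hB] := w _ 1 (cbm_om_dz R) ltac:(by move=> t; rewrite rnorm_om_dz).
have [C EC hC] := w _ 1 (cbm_conj (cbm_om_dz R)) ltac:(by move=> t; rewrite rnorm_conj rnorm_om_dz).
exists A, B, C; split.
- apply/(weak_avg_arcP hV hP husc r0 KO); split=> // v w'.
  by rewrite hA; apply: caver_ext => t; rewrite mulr1.
- exact/(weak_avg_dzP hV hP husc r0 KO).
- exact/(weak_avg_dzbarP hV hP husc r0 KO).
Qed.

Lemma affine_holomorphic (v w : V) : holomorphic_on Omega (fun z => v + (z - z0) *: w : V).
Proof.
move=> z _; apply/derivable_rnorm; exists w => e e0; exists 1 => // y _.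
rewrite (_ : v + (y - z0) *: w - (v + (z - z0) *: w) - (y - z) *: w = 0) ?rnorm0 ?mulr_ge0 ?rnorm_ge0 ?(ltW e0) //.
by rewrite opprD addrACA subrr add0r -!scalerBl opprB addrA subrK subrr scale0r.
Qed.

Definition block_inequality := exists A B C : V -> V,
  [/\ is_weak_avg dot P z0 r (@arc_length R) A,
      is_weak_avg dot P z0 r (@dz R) B,
      is_weak_avg dot P z0 r (@dzbar R) C
    & op_le (U := (V * V)%type) (dot_sum dot)
        (block_op (P z0) (fun=> 0) (fun=> 0) (fun=> 0)) (block_op A B C A)].

Definition schur_inequality (t : R) := exists A B C S : V -> V,
  [/\ is_weak_avg dot P z0 r (@arc_length R) A,
      is_weak_avg dot P z0 r (@dz R) B,
      is_weak_avg dot P z0 r (@dzbar R) C,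
      is_End_inverse (fun v => t%:C *: v + A v) S
    & op_le dot (P z0) (fun v => A v - B (S (C v)))].

Lemma om_circle t : (c t - z0) * ('i / r%:C) = om_dz t.
Proof.
have rn : r%:C != 0 by apply/eqP => -[]; apply/eqP; rewrite gt_eqF.
rewrite circleB /om_dz mulrAC; congr (_ * _).
by rewrite mulrCA divff // mulr1.
Qed.

Lemma curvature_affine_submean v w : seminegative_curvature dot Omega P ->
  quad (pform dot P z0) v <=
  aver (fun t => quad (pform dot P (c t)) (v + om_dz t *: w)).
Proof.
move=> sc.
have [_ usc sub] := sc _ (@affine_holomorphic v (('i / r%:C) *: w)).
pose phi z := v + (z - z0) *: (('i / r%:C) *: w).
have uscu : usc_on Omega (fun z => (quad (pform dot P z) (phi z))%:E) by exact: usc.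
have bm : bounded_measurable (fun t => quad (pform dot P (c t)) (phi (c t))).
  apply: (usc_circle_bm (u := fun z => quad (pform dot P z) (phi z)) uscu KO r0).
  by move=> z Oz; exact: form_ge0 (pform_psd hV hP Oz) _.
have := sub z0 r r0 KO; rewrite (integral_aver bm) lee_fin subrr scale0r addr0.
move/le_trans; apply; rewrite le_eqVlt; apply/orP; left; apply/eqP.
by apply: aver_ext => t; rewrite /phi scalerA om_circle.
Qed.

Lemma curvature_block : seminegative_curvature dot Omega P -> block_inequality.
Proof.
move=> sc; have [A [B [C [hA hB hC]]]] := weak_averages_exist.
exists A, B, C; split=> //.
have [EA _] := (weak_avg_arcP hV hP husc r0 KO A).1 hA.
have [EB _] := (weak_avg_dzP hV hP husc r0 KO B).1 hB.
have [EC _] := (weak_avg_dzbarP hV hP husc r0 KO C).1 hC.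
have [EP sP _] := hP Oz0.
rewrite /op_le; set T := _ \- _.
have TE x y : dot_sum dot (T x) y =
    dot (A x.1) y.1 + dot (B x.2) y.1 + (dot (C x.1) y.2 + dot (A x.2) y.2)
    - dot (P z0 x.1) y.1.
  rewrite /T /dot_sum /= !(formBl dp) !(formDl dp) !(form0l dp) !addr0 subr0.
  by ring.
have Tsym x y : dot_sum dot (T x) y = dot_sum dot x (T y).
  have -> : dot_sum dot x (T y) = conjc (dot_sum dot (T y) x).
    by rewrite /dot_sum conjcD -!(form_conj dp).
  rewrite !TE conjcD conjcN !conjcD -!(form_conj dp).
  rewrite (avg_arc_sym hV hP husc r0 KO hA) (avg_arc_sym hV hP husc r0 KO hA x.2).
  rewrite (avg_dz_adj hV hP husc r0 KO hB hC) (avg_dzbar_adj hV hP husc r0 KO hB hC) sP.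
  by ring.
split=> // [|x].
  apply: is_EndB; apply: block_op_is_End => //; exact: is_End0.
(* Nonnegativity in [R[i]] includes being real, which self-adjointness provides. *)
have self : dot_sum dot (T x) x = conjc (dot_sum dot (T x) x).
  by rewrite {1}Tsym /dot_sum conjcD -!(form_conj dp).
rewrite lecE /=; apply/andP; split.
  have := congr1 (@complex.Im R) self; rewrite Im_conj => h.
  by apply/eqP; lra.
rewrite TE ReB subr_ge0.
have := curvature_affine_submean x.1 x.2 sc.
rewrite (avg_affine hV hP husc r0 KO hA hB hC) => h; apply: le_trans h _.
by rewrite !ReD; lra.
Qed.

(** [t + A] is coercive, hence invertible. The block form is tested at [(v, -s)] with [s = S (C v)],
    the minimiser in the second variable of the form with [t |w|^2] added. As [C v = t s + A s], the
    terms [<A s, s> - <C v, s>] reduce to [- t |s|^2], which has the right sign. *)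
Lemma block_schur (t : R) : 0 < t -> block_inequality -> schur_inequality t.
Proof.
move=> t0 [A [B [C [hA hB hC [_ _ Tge]]]]].
have [EA _] := (weak_avg_arcP hV hP husc r0 KO A).1 hA.
have [EB _] := (weak_avg_dzP hV hP husc r0 KO B).1 hB.
have [EC _] := (weak_avg_dzbarP hV hP husc r0 KO C).1 hC.
have [EP sP _] := hP Oz0.
have Asym := avg_arc_sym hV hP husc r0 KO hA.
have Badj := avg_dz_adj hV hP husc r0 KO hB hC.
have Cadj := avg_dzbar_adj hV hP husc r0 KO hB hC.
have Apos := form_ge0 (avg_arc_psd hV hP husc r0 KO hA).
have [lA _] := EA; have [K K0 bA] := is_End_bounded EA.
pose T v := t%:C *: v + A v.
have lT : linear T.
  by move=> k u v; rewrite /T lA !scalerDr addrACA !scalerA (mulrC t%:C).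
have Tdot u v : dot (T u) v = t%:C * dot u v + dot (A u) v.
  by rewrite (formDl dp) (formZl dp).
have Tsym u v : dot (T u) v = dot u (T v).
  by rewrite Tdot (formDr dp) (formZr dp) conjcR Asym.
have Tco v : t * rnorm v ^+ 2 <= Re (dot (T v) v).
  rewrite Tdot ReD ReM /= mul0r subr0 -(quad_dot hV) lerDl; exact: Apos.
have [|v|S hS] := coercive_inverse hV (T := T) (K := t + K) lT t0 _ _ Tco.
- split=> [k u v w|u v|v]; first by rewrite lT (form_lin dp).
    by rewrite Tsym (form_conj dp).
  by rewrite (le_trans _ (Tco v)) // mulr_ge0 ?sqr_ge0 ?ltW.
- rewrite (le_trans (rnormD _ _)) // mulrDl lerD // rnormZ rnorm_real gtr0_norm //.
exists A, B, C, S; split=> //.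
have [ES TS ST] := hS.
have Ssym u v : dot (S u) v = dot u (S v) by rewrite -{2}(ST u) Tsym ST.
rewrite /op_le; set Q := _ \- _.
have Qsym v w : dot (Q v) w = dot v (Q w).
  rewrite /Q /= !(formBl dp) !(formBr dp) Asym Badj Ssym Cadj sP //.
split=> // [|v].
  apply: is_EndB => //; apply: is_EndB => //.
  by apply: (is_End_comp EB); exact: is_End_comp.
rewrite lecE /=; apply/andP; split.
  have := congr1 (@complex.Im R) (form_conj dp (Q v) v).
  by rewrite -Qsym Im_conj => h; apply/eqP; lra.
have := Tge (v, - S (C v)); rewrite lecE => /andP[_].
pose s := S (C v).
have [[lB _] [lC _]] := conj EB EC.
rewrite /dot_sum /= !(formBl dp) !(formDl dp) !(form0l dp) !addr0 subr0 !(formNr dp).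
have N (L : V -> V) u : linear L -> L (- u) = - L u.
  by move=> lL; rewrite -scaleN1r linear_funZ // scaleN1r.
rewrite !N // !(formNl dp) -/s opprK => h.
have h1 : dot (C v) s = dot v (B s) by rewrite Cadj.
have h2 : dot (C v) s = t%:C * dot s s + dot (A s) s by rewrite -Tdot ST.
have := congr1 (@complex.Re R) h2; rewrite ReD ReM /= mul0r subr0 => h3.
have h4 : 0 <= t * Re (dot s s) by rewrite mulr_ge0 ?(form_ge0 dp) // ltW.
rewrite !ReB.
move: h; rewrite !ReD !ReN; lra.
Qed.

(** Completing the square: [<(t + A) y, y> >= 0] for [y = w + S (C v)], added to the Schur
    inequality at [v], gives the desired inequality up to the term [t |w|^2]. *)
Lemma schur_affine_submean v w : (forall t, 0 < t -> schur_inequality t) ->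
  quad (pform dot P z0) v <=
  aver (fun t => quad (pform dot P (c t)) (v + om_dz t *: w)).
Proof.
move=> sch; apply/ler_addgt0Pr => e e0.
(* Makes [t |w|^2 <= e], including the case [w = 0]. *)
pose t := e / (rnorm w ^+ 2 + 1).
have w0 : 0 < rnorm w ^+ 2 + 1 by rewrite ltr_wpDl ?sqr_ge0.
have t0 : 0 < t by rewrite divr_gt0.
have [A [B [C [S [hA hB hC [ES TS ST] [_ _ Qge]]]]]] := sch t t0.
rewrite (avg_affine hV hP husc r0 KO hA hB hC).
have [EA _] := (weak_avg_arcP hV hP husc r0 KO A).1 hA.
have Asym := avg_arc_sym hV hP husc r0 KO hA.
have Badj := avg_dz_adj hV hP husc r0 KO hB hC.
have Cadj := avg_dzbar_adj hV hP husc r0 KO hB hC.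
have [lA _] := EA.
have Apos := form_ge0 (avg_arc_psd hV hP husc r0 KO hA).
pose s := S (C v); pose y := w + s.
have Ts : t%:C *: s + A s = C v by exact: ST.
have h0 : 0 <= Re (dot (t%:C *: y + A y) y).
  rewrite (formDl dp) (formZl dp) ReD ReM /= mul0r subr0.
  by rewrite addr_ge0 // ?Apos // mulr_ge0 ?(form_ge0 dp) // ltW.
have yE : t%:C *: y + A y = (t%:C *: w + A w) + C v.
  have AD : A (w + s) = A w + A s by rewrite -{1}(scale1r w) lA scale1r.
  by rewrite /y AD scalerDr -Ts addrACA.
have h1 : dot (t%:C *: w + A w) s = dot (B w) v.
  by rewrite (formDl dp) (formZl dp) Asym Badj -Ts (formDr dp) (formZr dp) conjcR.
have h2 : Re (dot (C v) s) = Re (dot (B s) v) by rewrite Cadj (formC_Re dp).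
have := Qge v; rewrite lecE /= => /andP[_]; rewrite !(formBl dp) !ReB -/s => h3.
move: h0; rewrite yE /y (formDl dp) !(formDr dp) h1 (formDl dp) (formZl dp).
rewrite !ReD ReM /= mul0r subr0 h2 => h0.
have h4 : t * Re (dot w w) <= e.
  rewrite -/(quad dot w) (quad_dot hV) /t mulrAC ler_pdivrMr // ler_pM2l // lerDl.
  exact: ler01.
rewrite /quad /pform; lra.
Qed.

End Equivalences.

(** * The theorem of Goursat and the mean value property *)

Section RealDerivative.
Context (R : realType).

Lemma expn2_lt (w d : R) : 0 < d -> exists n, w / 2 ^+ n < d.
Proof.
move=> d0; pose n := (Num.truncn `|w / d|).+1; exists n.
have : `|w / d| < n%:R by exact: truncnS_gt.
have : (n%:R : R) < 2 ^+ n by rewrite -natrX ltr_nat ltn_expl.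
move=> h1 h2; have h3 := le_lt_trans (ler_norm _) (lt_trans h2 h1).
by rewrite ltr_pdivrMr ?exprn_gt0 // mulrC -ltr_pdivrMr.
Qed.

Lemma nested_halving (a : nat -> R) (w : R) : 0 <= w ->
  (forall n, a n <= a n.+1 /\ a n.+1 + w / 2 ^+ n.+1 <= a n + w / 2 ^+ n) ->
  exists x, forall n, a n <= x <= a n + w / 2 ^+ n.
Proof.
move=> w0 h; have wn n : 0 <= w / 2 ^+ n by rewrite divr_ge0 // exprn_ge0.
have up n k : a n <= a (n + k)%N.
  by elim: k => [|k IH]; rewrite ?addn0 // addnS (le_trans IH) //; case: (h (n + k)%N).
have down n k : a (n + k)%N + w / 2 ^+ (n + k) <= a n + w / 2 ^+ n.
  by elim: k => [|k IH]; rewrite ?addn0 // addnS (le_trans _ IH) //; case: (h (n + k)%N).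
have ub n m : a m <= a n + w / 2 ^+ n.
  apply: (@le_trans _ _ (a (n + m)%N)); first by rewrite addnC up.
  by apply: le_trans (down n m); rewrite lerDl.
have E0 : range a !=set0 by exists (a 0%N), 0%N.
exists (sup (range a)) => n; apply/andP; split.
  apply: ub_le_sup; last by exists n.
  by exists (a 0%N + w / 2 ^+ 0) => _ [m _ <-].
by apply: ge_sup => // _ [m _ <-].
Qed.

Lemma is_derive_small (f : R -> R) (x D e : R) : is_derive x 1 f D -> 0 < e ->
  exists2 d, 0 < d & forall y, `|y - x| < d -> `|f y - f x - D * (y - x)| <= e * `|y - x|.
Proof.
move=> dfx e0; have dx := @ex_derive _ _ _ _ _ _ _ dfx.
have : (fun h : R => h^-1 *: ((f \o shift x) (h *: 1) - f x)) @ 0^' --> D.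
  by rewrite -(@derive_val _ _ _ _ _ _ _ dfx).
move=> /cvgrPdist_le /(_ _ e0); rewrite near_withinE => /nbhs_normP[d /= d0 h].
exists d => // y yx; have [->|yx0] := eqVneq y x.
  by rewrite !subrr mulr0 subrr normr0 mulr0.
have := h (y - x); rewrite /= sub0r normrN subr_eq0 => /(_ yx yx0).
rewrite /GRing.scale /= mulr1 subrK => h1.
have yn : y - x != 0 by rewrite subr_eq0.
rewrite (_ : f y - f x - D * (y - x) = - ((D - (y - x)^-1 * (f y - f x)) * (y - x))).
  by rewrite normrN normrM ler_wpM2r.
by field.
Qed.

(** Derivative in a real variable of a function with values in [R[i]], taken on real and imaginary
    parts because the mean value theorem applies to each of them separately. *)
Definition cderiv (g : R -> R[i]) (y : R) (d : R[i]) : Prop :=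
  is_derive y 1 (fun t => Re (g t)) (Re d) /\ is_derive y 1 (fun t => Im (g t)) (Im d).

Lemma cderivD g1 g2 y d1 d2 : cderiv g1 y d1 -> cderiv g2 y d2 ->
  cderiv (fun t => g1 t + g2 t) y (d1 + d2).
Proof.
move=> [h1 h2] [h3 h4]; split.
  rewrite ReD (_ : (fun t => _) = (fun t => Re (g1 t)) + (fun t => Re (g2 t))).
    exact: is_deriveD.
  by apply/funext => t; rewrite ReD.
rewrite ImD (_ : (fun t => _) = (fun t => Im (g1 t)) + (fun t => Im (g2 t))).
  exact: is_deriveD.
by apply/funext => t; rewrite ImD.
Qed.

Lemma cderivN g y d : cderiv g y d -> cderiv (fun t => - g t) y (- d).
Proof.
move=> [h1 h2]; split.
  rewrite ReN (_ : (fun t => _) = - (fun t => Re (g t))); first exact: is_deriveN.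
  by apply/funext => t; rewrite ReN.
rewrite ImN (_ : (fun t => _) = - (fun t => Im (g t))); first exact: is_deriveN.
by apply/funext => t; rewrite ImN.
Qed.

Lemma cderivB g1 g2 y d1 d2 : cderiv g1 y d1 -> cderiv g2 y d2 ->
  cderiv (fun t => g1 t - g2 t) y (d1 - d2).
Proof. by move=> h1 /cderivN; exact: cderivD. Qed.

Lemma cderivZ (c : R[i]) (y : R) : cderiv (fun t => c * t%:C) y c.
Proof.
split.
  rewrite (_ : (fun t => _) = (fun t => Re c * t)); last first.
    by apply/funext => t; rewrite ReM /= mulr0 subr0.
  by apply: is_derive_eq; rewrite /GRing.scale /=; ring.
rewrite (_ : (fun t => _) = (fun t => Im c * t)); last first.
  by apply/funext => t; rewrite ImM /= mulr0 add0r.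
by apply: is_derive_eq; rewrite /GRing.scale /=; ring.
Qed.

(** The real and imaginary parts attain their mean slopes at different points; adding the two
    estimates costs the factor [2]. *)
Lemma cderiv_mean_value (g dg : R -> R[i]) (a l M : R) : 0 <= l ->
  (forall y, a <= y <= a + l -> cderiv g y (dg y)) ->
  (forall y, a <= y <= a + l -> rnorm (dg y) <= M) ->
  rnorm (g (a + l) - g a) <= 2 * M * l.
Proof.
move=> l0 dgy hM.
have real (f df : R -> R) : (forall y, a <= y <= a + l -> is_derive y 1 f (df y)) ->
    (forall y, a <= y <= a + l -> `|df y| <= M) -> `|f (a + l) - f a| <= M * l.
  move=> dfy hdf; have al : a <= a + l by rewrite lerDl.
  have [||c cin ->] := @MVT_segment _ f df a (a + l) al.
  - by move=> y; rewrite in_itv /= => /andP[h1 h2]; apply: dfy; rewrite !ltW.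
  - apply: continuous_in_subspaceT => y; rewrite inE /= in_itv /= => /dfy dfy'.
    by apply/differentiable_continuous/derivable1_diffP; exact: ex_derive.
  by rewrite addrAC subrr add0r normrM (ger0_norm l0) ler_wpM2r // hdf.
apply: le_trans (rnorm_le_ReIm _) _; rewrite ReB ImB (_ : 2 * M * l = M * l + M * l); last by ring.
apply: lerD.
  apply: (real (fun t => Re (g t)) (fun t => Re (dg t))) => y hy; first by case: (dgy y hy).
  exact: le_trans (normRe_le _) (hM y hy).
apply: (real (fun t => Im (g t)) (fun t => Im (dg t))) => y hy; first by case: (dgy y hy).
exact: le_trans (normIm_le _) (hM y hy).
Qed.

End RealDerivative.

(** * Goursat's theorem on rectangles *)

Section Goursat.
Context (R : realType).
Variables (h G1 G2 : R -> R -> R[i]) (x1 x2 y1 y2 : R).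

Let D (x y : R) := [&& x1 < x, x < x2, y1 < y & y < y2].

Hypothesis dG1 : forall x y, D x y -> cderiv (G1 x) y (h x y).
Hypothesis dG2 : forall x y, D x y -> cderiv (G2^~ y) x (h x y).
Hypothesis dh : forall x0 y0, D x0 y0 -> exists c, forall e : R, 0 < e ->
  exists2 d : R, 0 < d & forall x y, `|x - x0| < d -> `|y - y0| < d ->
    rnorm (h x y - h x0 y0 - c * ((x - x0) +i* (y - y0))) <= e * (`|x - x0| + `|y - y0|).

(* As [G1] and [G2] are primitives of [h] in [y] and in [x], this is the
   integral of [h * (dx + i dy)] along the boundary of a rectangle. *)
Definition boundary_int (a b w l : R) : R[i] :=
  'i * (G1 (a + w) (b + l) - G1 (a + w) b - G1 a (b + l) + G1 a b)
  - (G2 (a + w) (b + l) - G2 a (b + l) - G2 (a + w) b + G2 a b).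

Lemma boundary_int_split a b w l :
  boundary_int a b w l =
  boundary_int a b (w / 2) (l / 2) + boundary_int (a + w / 2) b (w / 2) (l / 2) +
  boundary_int a (b + l / 2) (w / 2) (l / 2) +
  boundary_int (a + w / 2) (b + l / 2) (w / 2) (l / 2).
Proof.
rewrite /boundary_int -!addrA -!splitr !addrA; set i : R[i] := 'i; clearbody i; ring.
Qed.

(** The affine part of [h] at [(x0, y0)] has zero boundary integral: its contributions [i c w l] and
    [c (i l) w] cancel. What remains is an error of size [e (w + l)] on each side, and pairing
    opposite sides with the mean value bound gives [4 e (w + l) l + 4 e (w + l) w]. *)
Lemma boundary_int_local x0 y0 e : D x0 y0 -> 0 < e ->
  exists2 d : R, 0 < d & forall a b w l, 0 <= w -> 0 <= l -> w < d -> l < d ->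
    a <= x0 <= a + w -> b <= y0 <= b + l ->
    x1 < a -> a + w < x2 -> y1 < b -> b + l < y2 ->
    rnorm (boundary_int a b w l) <= 4 * e * (w + l) ^+ 2.
Proof.
move=> D0 e0; have [c hc] := dh D0; have [d d0 {}hc] := hc e e0.
exists d => // a b w l w0 l0 wd ld ax bx xa ax2 yb by2.
pose E x y := h x y - h x0 y0 - c * ((x - x0) +i* (y - y0)).
have hE x y : a <= x <= a + w -> b <= y <= b + l -> rnorm (E x y) <= e * (w + l).
  move=> hx hy; have hx' : `|x - x0| <= w by rewrite ler_norml; lra.
  have hy' : `|y - y0| <= l by rewrite ler_norml; lra.
  apply: le_trans (hc x y (le_lt_trans hx' wd) (le_lt_trans hy' ld)) _.
  by rewrite ler_wpM2l ?(ltW e0) // lerD.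
have hD x y : a <= x <= a + w -> b <= y <= b + l -> D x y by rewrite /D; lra.
have e2 : rnorm (G1 (a + w) (b + l) - G1 a (b + l) - c * w%:C * (b + l)%:C
             - (G1 (a + w) b - G1 a b - c * w%:C * b%:C)) <= 2 * (2 * (e * (w + l))) * l.
  apply: (cderiv_mean_value (g := fun y => G1 (a + w) y - G1 a y - c * w%:C * y%:C)
    (dg := fun y => h (a + w) y - h a y - c * w%:C)) => // y hy.
    by apply: cderivB; [apply: cderivB; apply: dG1; apply: hD => //; lra | exact: cderivZ].
  rewrite (_ : _ - _ - _ = E (a + w) y - E a y).
    apply: le_trans (rnormB _ _) _; rewrite mulrDl mul1r.
    by apply: lerD; apply: hE => //; lra.
  rewrite /E; have -> : w%:C = ((a + w - x0) +i* (y - y0)) - ((a - x0) +i* (y - y0)).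
    by apply: complex_ext; rewrite !ReImE /=; lra.
  by ring.
have e3 : rnorm (G2 (a + w) (b + l) - G2 (a + w) b - c * (0 +i* l) * (a + w)%:C
             - (G2 a (b + l) - G2 a b - c * (0 +i* l) * a%:C)) <= 2 * (2 * (e * (w + l))) * w.
  apply: (cderiv_mean_value (g := fun x => G2 x (b + l) - G2 x b - c * (0 +i* l) * x%:C)
    (dg := fun x => h x (b + l) - h x b - c * (0 +i* l))) => // x hx.
    by apply: cderivB; [apply: cderivB; apply: dG2; apply: hD => //; lra | exact: cderivZ].
  rewrite (_ : _ - _ - _ = E x (b + l) - E x b).
    apply: le_trans (rnormB _ _) _; rewrite mulrDl mul1r.
    by apply: lerD; apply: hE => //; lra.
  rewrite /E; have -> : 0 +i* l = ((x - x0) +i* (b + l - y0)) - ((x - x0) +i* (b - y0)).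
    by apply: complex_ext; rewrite !ReImE /=; lra.
  by ring.
set u1 := _ - _ in e2; set u2 := _ - _ in e3.
have -> : boundary_int a b w l = 'i * u1 - u2.
  rewrite /boundary_int /u1 /u2 (_ : 0 +i* l = 'i * l%:C); last first.
    by apply: complex_ext; rewrite !ReImE /=; lra.
  rewrite !realcD; set i : R[i] := 'i; clearbody i; ring.
have ni : rnorm ('i : R[i]) = 1.
  by apply/eqP; rewrite -(@eqrXn2 _ 2) ?rnorm_ge0 // rnorm_sqr /= expr0n add0r expr1n.
apply: le_trans (rnormB _ _) _; rewrite rnormM ni mul1r.
by rewrite expr2; lra.
Qed.

(** Repeated quartering: some quarter carries at least a fourth of the boundary integral. At the
    common point of the nested rectangles, [boundary_int_local] bounds the integral by [e] times the
    square of the size, which also shrinks by four at each stage. *)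
Theorem goursat a b w l : 0 <= w -> 0 <= l ->
  x1 < a -> a + w < x2 -> y1 < b -> b + l < y2 -> boundary_int a b w l = 0.
Proof.
move=> w0 l0 xa ax2 yb by2; apply: contrapT => I0.
pose mu := rnorm (boundary_int a b w l).
have mu0 : 0 < mu.
  by rewrite lt_neqAle rnorm_ge0 eq_sym andbT; apply/eqP => /rnorm_eq0.
have step (v k : R) (p : R * R) : exists q : R * R, 0 <= v -> 0 <= k ->
    [/\ p.1 <= q.1 <= p.1 + v / 2, p.2 <= q.2 <= p.2 + k / 2 &
     rnorm (boundary_int p.1 p.2 v k) <= 4 * rnorm (boundary_int q.1 q.2 (v / 2) (k / 2))].
  pose J (q : R * R) := rnorm (boundary_int q.1 q.2 (v / 2) (k / 2)).
  pose q1 := (p.1, p.2); pose q2 := (p.1 + v / 2, p.2).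
  pose q3 := (p.1, p.2 + k / 2); pose q4 := (p.1 + v / 2, p.2 + k / 2).
  have hs : rnorm (boundary_int p.1 p.2 v k) <= J q1 + J q2 + J q3 + J q4.
    rewrite boundary_int_split (le_trans (rnormD _ _)) // lerD //.
    by rewrite (le_trans (rnormD _ _)) // lerD // (le_trans (rnormD _ _)).
  have [hq|h1] := lerP (rnorm (boundary_int p.1 p.2 v k)) (4 * J q1).
    by exists q1 => v0 k0; split=> //=; lra.
  have [hq|h2] := lerP (rnorm (boundary_int p.1 p.2 v k)) (4 * J q2).
    by exists q2 => v0 k0; split=> //=; lra.
  have [hq|h3] := lerP (rnorm (boundary_int p.1 p.2 v k)) (4 * J q3).
    by exists q3 => v0 k0; split=> //=; lra.
  have [hq|h4] := lerP (rnorm (boundary_int p.1 p.2 v k)) (4 * J q4).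
    by exists q4 => v0 k0; split=> //=; lra.
  by exfalso; lra.
pose W n := w / 2 ^+ n; pose L n := l / 2 ^+ n.
have W0 n : 0 <= W n by rewrite divr_ge0 // exprn_ge0.
have L0 n : 0 <= L n by rewrite divr_ge0 // exprn_ge0.
have half (v : R) n : v / 2 ^+ n / 2 = v / 2 ^+ n.+1 by rewrite exprSr invfM mulrA.
have [f hf] := choice (fun np : nat * (R * R) => step (W np.1) (L np.1) np.2).
pose s := fix s n : R * R := if n is n'.+1 then f (n', s n') else (a, b).
have sS n := hf (n, s n) (W0 n) (L0 n).
have hI n : mu <= 4 ^+ n * rnorm (boundary_int (s n).1 (s n).2 (W n) (L n)).
  elim: n => [|n IH]; first by rewrite expr0 mul1r /W /L !expr0 !divr1.
  have [_ _ hq] := sS n; rewrite /= in hq; apply: le_trans IH _.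
  by rewrite exprSr -mulrA ler_pM2l ?exprn_gt0 // /W /L -!half.
have [x0 hx0] : exists x, forall n, (s n).1 <= x <= (s n).1 + W n.
  apply: nested_halving => // n; have [/andP[h1 h2] _ _] := sS n; split=> //.
  by move: h2; rewrite /= /W half -half; lra.
have [y0 hy0] : exists y, forall n, (s n).2 <= y <= (s n).2 + L n.
  apply: nested_halving => // n; have [_ /andP[h1 h2] _] := sS n; split=> //.
  by move: h2; rewrite /= /L half -half; lra.
have sx n : a <= (s n).1 /\ (s n).1 + W n <= a + w.
  elim: n => [|n [h1 h2]]; first by rewrite /W expr0 divr1 /=.
  have [/andP[h3 h4] _ _] := sS n; move: h4; rewrite /= /W -half in h3 *.
  by move: h2; rewrite /W; lra.
have sy n : b <= (s n).2 /\ (s n).2 + L n <= b + l.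
  elim: n => [|n [h1 h2]]; first by rewrite /L expr0 divr1 /=.
  have [_ /andP[h3 h4] _] := sS n; move: h4; rewrite /= /L -half in h3 *.
  by move: h2; rewrite /L; lra.
have D0 : D x0 y0.
  have := hx0 0%N; have := hy0 0%N; have [] := sx 0%N; have [] := sy 0%N.
  by rewrite /D; lra.
(* Chosen so that [4 e (w + l)^2 < mu]; the added [1] allows for a degenerate rectangle. *)
pose e := mu / (8 * ((w + l) ^+ 2 + 1)).
have wl : 0 < (w + l) ^+ 2 + 1 by rewrite ltr_wpDl ?sqr_ge0.
have e0 : 0 < e by rewrite divr_gt0 // mulr_gt0.
have [d d0 hd] := boundary_int_local D0 e0.
have [n hn] := expn2_lt (w + l) d0.
have Wn : W n <= (w + l) / 2 ^+ n by rewrite ler_wpM2r ?invr_ge0 ?exprn_ge0 // lerDl.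
have Ln : L n <= (w + l) / 2 ^+ n by rewrite ler_wpM2r ?invr_ge0 ?exprn_ge0 // lerDr.
have [sx1 sx2] := sx n; have [sy1 sy2] := sy n.
have hB := hd _ _ _ _ (W0 n) (L0 n) (le_lt_trans Wn hn) (le_lt_trans Ln hn) (hx0 n) (hy0 n)
  (lt_le_trans xa sx1) (le_lt_trans sx2 ax2) (lt_le_trans yb sy1) (le_lt_trans sy2 by2).
have := hI n; apply/negP; rewrite -ltNge.
apply: (@le_lt_trans _ _ (4 * e * (w + l) ^+ 2)).
  apply: le_trans (ler_wpM2l (exprn_ge0 n (ler0n _ 4)) hB) _.
  have E4 : (4 : R) ^+ n = (2 ^+ n) ^+ 2.
    by rewrite -exprM mulnC exprM; congr (_ ^+ _); ring.
  rewrite E4 /W /L -mulrDl; have : (2 : R) ^+ n != 0 by rewrite expf_neq0.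
  move: (2 ^+ n) (w + l) => x y xn0; rewrite le_eqVlt; apply/orP; left; apply/eqP.
  by field.
have : 8 * e * ((w + l) ^+ 2 + 1) = mu.
  by rewrite /e; move: ((w + l) ^+ 2 + 1) wl => v v0; field; rewrite gt_eqF.
have := sqr_ge0 (w + l); have := mulr_ge0 (ltW e0) (sqr_ge0 (w + l)); lra.
Qed.

End Goursat.

(** * The mean value property over circles, in logarithmic polar coordinates *)

Section MeanValue.
Context (R : realType).

(** Compactness gives a distance [d] within which every point of the disc stays in [Omega]. A point
    of the disc of radius [r + d / 2] is either in the old disc or closer than [d] to its radial
    projection [z]. *)
Lemma closed_disc_enlarge (Omega : set R[i]) (z0 : R[i]) (r : R) : 0 <= r ->
  open Omega -> closed_disc z0 r `<=` Omega ->
  exists2 d : R, 0 < d & closed_disc z0 (r + d) `<=` Omega.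
Proof.
move=> r0 oO KO.
pose Q (A : set R[i]) := exists2 d : R, 0 < d &
  forall z y, A z -> rnorm (y - z) < d -> Omega y.
have [||A B|z Kz|d d0 hd] := @closed_disc_ind _ z0 r Q.
- by move=> A B AB [d d0 hd]; exists d => // z y /AB; exact: hd.
- by exists 1.
- move=> [d1 d10 hd1] [d2 d20 hd2]; exists (Num.min d1 d2).
    by rewrite lt_min d10.
  by move=> z y [Az|Bz]; rewrite lt_min => /andP[h1 h2]; [exact: hd1 h1 | exact: hd2 h2].
- have [d d0 hd] := open_rnorm oO (KO _ Kz).
  exists (d / 2); first by rewrite divr_gt0.
  exists (d / 2); first by rewrite divr_gt0.
  move=> x y [_ xz] yx; apply: hd; have := rdist_tri y x z; lra.
exists (d / 2) => [|y /closed_discE yr]; first by rewrite divr_gt0.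
have [yr'|ry] := lerP (rnorm (y - z0)) r; first exact/KO/closed_discE.
set n := rnorm (y - z0) in yr ry.
have n0 : 0 < n by exact: le_lt_trans ry.
pose z := z0 + (r / n)%:C * (y - z0).
have Kz : closed_disc z0 r z.
  apply/closed_discE; rewrite /z addrC addKr rnormM rnorm_real -/n.
  by rewrite ger0_norm ?divr_ge0 ?(ltW n0) // divfK ?gt_eqF.
apply: hd Kz _.
have -> : y - z = ((n - r) / n)%:C * (y - z0).
  rewrite mulrBl divff ?gt_eqF // rmorphB /= rmorph1 /z; ring.
rewrite rnormM rnorm_real -/n ger0_norm ?divfK ?gt_eqF //; last first.
  by rewrite divr_ge0 // ?(ltW n0) // subr_ge0 ltW.
lra.
Qed.

Lemma continuous_lipschitz_at (g : R -> R) (x K d : R) : 0 < d ->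
  (forall y, `|y - x| < d -> `|g y - g x| <= K * `|y - x|) -> {for x, continuous g}.
Proof.
move=> d0 h; apply/cvgrPdist_lt => e e0.
have K1 : 0 < `|K| + 1 by rewrite ltr_wpDl.
apply/nbhs_normP; exists (Num.min d (e / (`|K| + 1))) => /=.
  by rewrite lt_min d0 divr_gt0.
move=> y /=; rewrite lt_min distrC => /andP[yd ye]; rewrite distrC.
apply: le_lt_trans (h y yd) _; move: ye; rewrite ltr_pdivlMr //.
have : K * `|y - x| <= `|K| * `|y - x| by rewrite ler_wpM2r // ler_norm.
by have := normr_ge0 (y - x); lra.
Qed.

Definition primitive (A : R) (g : R -> R) (x : R) : R :=
  Rintegral (@lebesgue_measure R) `[A, x]%classic g.

(** Continuity is asked on a left half-line, the range of the logarithm of an admissible radius. The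
    intermediate [u] turns it into integrability on a compact interval around [x]. *)
Lemma is_derive_primitive (A X x : R) (g : R -> R) :
  (forall y, y < X -> {for y, continuous g}) -> A < x < X ->
  is_derive x 1 (primitive A g) (g x).
Proof.
move=> cg /andP[Ax xX]; pose u := (x + X) / 2.
have xu : x < u by rewrite /u; lra.
have uX : u < X by rewrite /u; lra.
have ig : (@lebesgue_measure R).-integrable `[A, u] (EFin \o g).
  apply: continuous_compact_integrable; first exact: segment_compact.
  apply: continuous_in_subspaceT => y; rewrite inE /= in_itv /= => /andP[_ yu].
  by apply: cg; exact: le_lt_trans uX.
have [d1 d2] := continuous_FTC1_closed xu ig Ax (cg x xX).
apply: DeriveDef; first exact: d1.
by rewrite -d2 derive1E.
Qed.

(** Differentiability of the complex exponential at [0], from those of its real factors. The origin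
    suffices, since the exponential turns translations into multiplications. *)
Lemma complex_exp_derivable (e : R) : 0 < e -> exists2 d : R, 0 < d &
  forall x y : R, `|x| < d -> `|y| < d ->
    rnorm ((expR x)%:C * expi y - 1 - (x +i* y)) <= e * (`|x| + `|y|).
Proof.
move=> e0; pose e1 := Num.min (e / 8) 1.
have e10 : 0 < e1 by rewrite lt_min ltr01 divr_gt0.
have e11 : e1 <= 1 by rewrite ge_min lexx orbT.
have e18 : e1 <= e / 8 by rewrite ge_min lexx.
have [d1 d10 h1] := is_derive_small (is_derive_expR (0 : R)) e10.
have [d2 d20 h2] := is_derive_small (is_derive_cos (0 : R)) e10.
have [d3 d30 h3] := is_derive_small (is_derive_sin (0 : R)) e10.
exists (Num.min (Num.min d1 (Num.min d2 d3)) (Num.min (e / 8) 2^-1)).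
  by rewrite !lt_min d10 d20 d30 divr_gt0 //= invr_gt0.
move=> x y; rewrite !lt_min => /andP[/andP[xd1 _] /andP[xe x2]] /andP[/andP[_ /andP[yd2 yd3]] _].
have {}h1 := h1 x; rewrite subr0 expR0 mul1r in h1.
have {}h2 := h2 y; rewrite subr0 cos0 sin0 oppr0 mul0r subr0 in h2.
have {}h3 := h3 y; rewrite subr0 sin0 cos0 mul1r subr0 in h3.
have {}h1 := h1 xd1; have {}h2 := h2 yd2; have {}h3 := h3 yd3.
have hx1 : `|expR x - 1| <= 2 * `|x|.
  have : `|expR x - 1| <= `|expR x - 1 - x| + `|x|.
    by rewrite -{1}(subrK x (expR x - 1)) ler_normD.
  have : e1 * `|x| <= 1 * `|x| by rewrite ler_wpM2r.
  lra.
have hx : `|expR x| <= 2.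
  by have := ler_normD (expR x - 1) 1; rewrite subrK normr1; lra.
apply: le_trans (rnorm_le_ReIm _) _.
set q := _ - _.
have -> : Re q = expR x * (cos y - 1) + (expR x - 1 - x) by rewrite /q !ReImE /=; ring.
have -> : Im q = expR x * (sin y - y) + (expR x - 1) * y by rewrite /q !ReImE /=; ring.
have a1 : `|expR x * (cos y - 1)| <= 2 * (e1 * `|y|) by rewrite normrM ler_pM.
have a2 : `|expR x * (sin y - y)| <= 2 * (e1 * `|y|) by rewrite normrM ler_pM.
have a3 : `|(expR x - 1) * y| <= 2 * (e / 8) * `|y|.
  rewrite normrM ler_wpM2r // (le_trans hx1) // ler_wpM2l // ltW //.
have b1 := ler_normD (expR x * (cos y - 1)) (expR x - 1 - x).
have b2 := ler_normD (expR x * (sin y - y)) ((expR x - 1) * y).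
have b3 : e1 * `|y| <= e / 8 * `|y| by rewrite ler_wpM2r.
have b4 : e1 * `|x| <= e / 8 * `|x| by rewrite ler_wpM2r.
have b5 : 0 <= e * `|x| by rewrite mulr_ge0 // ltW.
have b6 : 0 <= e * `|y| by rewrite mulr_ge0 // ltW.
lra.
Qed.

Definition holomorphic_at (f : R[i] -> R[i]) (z : R[i]) : Prop :=
  exists w, forall e : R, 0 < e -> exists2 d : R, 0 < d &
    forall y, rnorm (y - z) < d -> rnorm (f y - f z - (y - z) * w) <= e * rnorm (y - z).

Lemma holomorphic_at_continuous f z (e : R) : holomorphic_at f z -> 0 < e ->
  exists2 d : R, 0 < d & forall y, rnorm (y - z) < d -> rnorm (f y - f z) <= e.
Proof.
move=> [w hw] e0; have [d d0 hd] := hw 1 ltr01.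
have K0 : 0 < 1 + rnorm w by rewrite ltr_pwDl // rnorm_ge0.
exists (Num.min d (e / (1 + rnorm w))); first by rewrite lt_min d0 divr_gt0.
move=> y; rewrite lt_min => /andP[yd]; rewrite ltr_pdivlMr // => ye.
have := rnormD (f y - f z - (y - z) * w) ((y - z) * w); rewrite subrK rnormM.
by have := hd y yd; lra.
Qed.

(** The chain rule for [f (z0 + exp)]: the displacement factors as [p q] with [p = exp (x0 + i y0)]
    and [q = exp (u + i v) - 1], so the derivative is [w p]. *)
Lemma holomorphic_polar (f : R[i] -> R[i]) (z0 : R[i]) (x0 y0 : R) :
  holomorphic_at f (z0 + (expR x0)%:C * expi y0) ->
  exists c, forall e : R, 0 < e -> exists2 d : R, 0 < d &
    forall x y, `|x - x0| < d -> `|y - y0| < d ->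
    rnorm (f (z0 + (expR x)%:C * expi y) - f (z0 + (expR x0)%:C * expi y0)
           - c * ((x - x0) +i* (y - y0))) <= e * (`|x - x0| + `|y - y0|).
Proof.
set p := (expR x0)%:C * expi y0 => -[w hw]; exists (w * p) => e e0.
pose K := rnorm p; have K0 : 0 <= K by exact: rnorm_ge0.
pose W := rnorm w; have W0 : 0 <= W by exact: rnorm_ge0.
pose e1 := e / (2 * (2 * K + 1)).
have e10 : 0 < e1 by rewrite divr_gt0 // mulr_gt0 // ltr_wpDl // mulr_ge0.
pose e2 := Num.min 1 (e / (2 * (W * K + 1))).
have WK : 0 <= W * K by rewrite mulr_ge0.
have e20 : 0 < e2 by rewrite lt_min ltr01 divr_gt0 // mulr_gt0 // ltr_wpDl.
have [d1 d10 h1] := hw e1 e10; have [d2 d20 h2] := complex_exp_derivable e20.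
exists (Num.min d2 (d1 / (4 * (K + 1)))).
  by rewrite lt_min d20 divr_gt0 // mulr_gt0 // ltr_wpDl.
move=> x y; rewrite !lt_min => /andP[xd xd'] /andP[yd yd'].
set u := x - x0 in xd xd' *; set v := y - y0 in yd yd' *.
pose q := (expR u)%:C * expi v - 1.
have qE : z0 + (expR x)%:C * expi y - (z0 + p) = p * q.
  have -> : x = x0 + u by rewrite /u addrC subrK.
  have -> : y = y0 + v by rewrite /v addrC subrK.
  by rewrite expRD expiD realcM /p /q; ring.
have hq := h2 u v xd yd; rewrite -/q in hq.
have e21 : e2 <= 1 by rewrite ge_min lexx.
have uv0 : 0 <= `|u| + `|v| by rewrite addr_ge0.
have nq : rnorm q <= 2 * (`|u| + `|v|).
  have := rnormD (q - (u +i* v)) (u +i* v); rewrite subrK.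
  have := rnorm_le_ReIm (u +i* v); rewrite /=.
  have : e2 * (`|u| + `|v|) <= 1 * (`|u| + `|v|) by rewrite ler_wpM2r.
  lra.
have Kq : K * rnorm q <= K * (2 * (`|u| + `|v|)) by rewrite ler_wpM2l.
have pq : rnorm (p * q) < d1.
  rewrite rnormM -/K; apply: le_lt_trans Kq _.
  have dE : d1 / (4 * (K + 1)) * (4 * (K + 1)) = d1.
    by rewrite divfK // gt_eqF // mulr_gt0 // ltr_wpDl.
  move: dE xd' yd'; move: (d1 / (4 * (K + 1))) => dd dE xd' yd'.
  have dd0 : 0 < dd by apply: le_lt_trans xd'.
  have : K * (`|u| + `|v|) <= K * (dd + dd) by rewrite ler_wpM2l // lerD // ltW.
  by rewrite -dE; lra.
have := h1 (z0 + (expR x)%:C * expi y); rewrite qE => /(_ pq) h3.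
have -> : f (z0 + (expR x)%:C * expi y) - f (z0 + p) - w * p * (u +i* v) =
   (f (z0 + (expR x)%:C * expi y) - f (z0 + p) - p * q * w) + w * p * (q - (u +i* v)).
  by ring.
rewrite (rnormM p) -/K in h3; apply: le_trans (rnormD _ _) _.
rewrite (rnormM (w * p)) (rnormM w p) -/K -/W.
have h4 : W * K * rnorm (q - (u +i* v)) <= W * K * (e2 * (`|u| + `|v|)) by rewrite ler_wpM2l.
have h5 : e1 * (K * rnorm q) <= e1 * (K * (2 * (`|u| + `|v|))).
  by rewrite ler_wpM2l // ltW.
have e1E : e1 * (2 * (2 * K + 1)) = e.
  by rewrite divfK // gt_eqF // mulr_gt0 // ltr_wpDl // mulr_ge0.
have e2E : e2 * (2 * (W * K + 1)) <= e.
  by rewrite -ler_pdivlMr ?ge_min ?lexx ?orbT // mulr_gt0 // ltr_wpDl.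
move: (`|u| + `|v|) uv0 h3 h4 h5 => s s0 h3 h4 h5.
have g1 : e1 * (2 * (2 * K + 1)) * s = e * s by rewrite e1E.
have g2 : e2 * (2 * (W * K + 1)) * s <= e * s by rewrite ler_wpM2r.
have g3 : 0 <= e1 * s by rewrite mulr_ge0 // ltW.
have g4 : 0 <= e2 * s by rewrite mulr_ge0 // ltW.
lra.
Qed.

(* In the coordinates [z = z0 + exp (x + i y)] the two horizontal sides of
   [[a, ln r] x [0, 2 pi]] cancel by periodicity, so the average over the circle
   of radius [exp a] does not depend on [a]. *)
Theorem circle_mean_value (f : R[i] -> R[i]) (Omega : set R[i]) (z0 : R[i]) (r : R) :
  0 < r -> open Omega -> closed_disc z0 r `<=` Omega ->
  (forall z, Omega z -> holomorphic_at f z) ->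
  caver (fun t => f (circle z0 r t)) = f z0.
Proof.
move=> r0 oO KO hf.
have [eta eta0 KO'] := closed_disc_enlarge (ltW r0) oO KO.
pose X := ln (r + eta).
have re0 : 0 < r + eta by rewrite addr_gt0.
pose h x y := f (z0 + (expR x)%:C * expi y).
have hO x y : x < X -> Omega (z0 + (expR x)%:C * expi y).
  move=> xX; apply/KO'/closed_discE; rewrite addrC addKr rnormM rnorm_expi mulr1 rnorm_real.
  rewrite gtr0_norm ?expR_gt0 // -[leRHS]lnK ?posrE // ler_expR ltW //.
have dh x y : x < X -> exists c, forall e : R, 0 < e -> exists2 d : R, 0 < d &
    forall x' y', `|x' - x| < d -> `|y' - y| < d ->
    rnorm (h x' y' - h x y - c * ((x' - x) +i* (y' - y))) <= e * (`|x' - x| + `|y' - y|).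
  by move=> xX; apply: holomorphic_polar; apply: hf; exact: hO.
have lip x y : x < X -> exists K, exists2 d : R, 0 < d & forall x' y',
    `|x' - x| < d -> `|y' - y| < d -> rnorm (h x' y' - h x y) <= K * (`|x' - x| + `|y' - y|).
  move=> xX; have [c /(_ 1 ltr01)[d d0 hd]] := dh x y xX.
  exists (1 + rnorm c), d => // x' y' hx' hy'.
  have := rnormD (h x' y' - h x y - c * ((x' - x) +i* (y' - y))) (c * ((x' - x) +i* (y' - y))).
  have := hd x' y' hx' hy'; rewrite subrK rnormM => h1 h2.
  have := ler_wpM2l (rnorm_ge0 c) (rnorm_le_ReIm ((x' - x) +i* (y' - y))); rewrite /= => h3.
  by rewrite mulrDl; lra.
have cy (p : R[i] -> R) x y : (forall z, `|p z| <= rnorm z) -> (forall z w, p (z - w) = p z - p w) ->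
    x < X -> {for y, continuous (fun y => p (h x y))}.
  move=> pn pB xX; have [K [d d0 hd]] := lip x y xX.
  apply: (continuous_lipschitz_at (K := K) d0) => y' yy; rewrite -pB.
  apply: le_trans (pn _) _; have := hd x y'; rewrite subrr normr0 add0r; exact.
have cx (p : R[i] -> R) x y : (forall z, `|p z| <= rnorm z) -> (forall z w, p (z - w) = p z - p w) ->
    x < X -> {for x, continuous (fun x => p (h x y))}.
  move=> pn pB xX; have [K [d d0 hd]] := lip x y xX.
  apply: (continuous_lipschitz_at (K := K) d0) => x' xx; rewrite -pB.
  apply: le_trans (pn _) _; have := hd x' y; rewrite subrr normr0 addr0; exact.
have cRy x y := cy _ x y (@normRe_le R) (@ReB R).
have cIy x y := cy _ x y (@normIm_le R) (@ImB R).
have cRx x y := cx _ x y (@normRe_le R) (@ReB R).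
have cIx x y := cx _ x y (@normIm_le R) (@ImB R).
(* Integration starts strictly to the left of [0], so that the primitive has a two-sided derivative
   on all of [[0, 2 pi]]. *)
pose G1 x y := primitive (- 1) (fun y => Re (h x y)) y +i* primitive (- 1) (fun y => Im (h x y)) y.
have averE x : x < X -> caver (h x) = ((2 * pi)^-1)%:C * (G1 x (2 * pi) - G1 x 0).
  move=> xX; apply: complex_ext; rewrite !ReImE /= ?mul0r ?subr0 ?addr0.
    apply: aver_FTC => [y|y hy]; first exact: cRy.
    by apply: is_derive_primitive hy => y' _; exact: cRy.
  apply: aver_FTC => [y|y hy]; first exact: cIy.
  by apply: is_derive_primitive hy => y' _; exact: cIy.
pose b := ln r.
have bX : b < X by rewrite ltr_ln ?posrE // ltrDl.
have p0 := @twopi_gt0 R.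
have const a : a < b -> caver (h a) = caver (h b).
  move=> ab; pose G2 x y := primitive (a - 1) (fun x => Re (h x y)) x +i* primitive (a - 1) (fun x => Im (h x y)) x.
  have gz : boundary_int G1 G2 a 0 (b - a) (2 * pi) = 0.
    apply: (@goursat _ h G1 G2 (a - 1) X (- 1) (2 * pi + 1)); try lra.
    - move=> x y /and4P[h1 h2 h3 h4]; split=> /=.
        by apply: (@is_derive_primitive _ (2 * pi + 1)) => [y' _|]; [exact: cRy | rewrite h3].
      by apply: (@is_derive_primitive _ (2 * pi + 1)) => [y' _|]; [exact: cIy | rewrite h3].
    - move=> x y /and4P[h1 h2 h3 h4]; split=> /=.
        by apply: (@is_derive_primitive _ X) => [x' xX|]; [exact: cRx | rewrite h1].
      by apply: (@is_derive_primitive _ X) => [x' xX|]; [exact: cIx | rewrite h1].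
    - by move=> x y /and4P[_ h2 _ _]; exact: dh.
  have per x : h x (0 + 2 * pi) = h x 0.
    by rewrite /h expiD /expi mulr_natl cos2pi sin2pi mulr1.
  have G2E x : G2 x (0 + 2 * pi) = G2 x 0.
    by rewrite /G2; congr (primitive _ _ _ +i* primitive _ _ _); apply/funext => x'; rewrite per.
  have h0 : G1 b (2 * pi) - G1 b 0 = G1 a (2 * pi) - G1 a 0.
    move: gz; rewrite /boundary_int !G2E add0r (addrC a) subrK.
    move: (G1 b _) (G1 b _) (G1 a _) (G1 a _) (G2 b _) (G2 a _) => u1 u2 u3 u4 v1 v2.
    rewrite (_ : v1 - _ - _ + _ = 0); last by ring.
    rewrite subr0 => /eqP; rewrite mulf_eq0 => /orP[/eqP[]/eqP|/eqP].
      by rewrite oner_eq0.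
    move=> u0; apply/eqP; rewrite -subr_eq0; apply/eqP; rewrite -u0; ring.
  by rewrite (averE a (lt_trans ab bX)) (averE b bX) h0.
have -> : (fun t => f (circle z0 r t)) = h b by rewrite /h /b lnK ?posrE.
have ch x : x < X -> (exists M, forall y, rnorm (h x y) <= M) -> cbm (h x).
  move=> xX [M hM]; split; apply: (bm_continuous (M := M)) => y.
  - exact: cRy.
  - exact: le_trans (normRe_le _) (hM y).
  - exact: cIy.
  - exact: le_trans (normIm_le _) (hM y).
apply/eqP; rewrite -subr_eq0; apply/eqP/rnorm_eq0/eqP; rewrite eq_le rnorm_ge0 andbT.
apply/ler_addgt0Pr => e e0; rewrite add0r.
have Oz0 : Omega z0 by apply/KO/closed_discE; rewrite subrr rnorm0 ltW.
have [d d0 hd] := holomorphic_at_continuous (hf _ Oz0) e0.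
(* The circle of radius [exp a <= d / 2] lies where [f] is within [e] of [f z0], and [a < b] lets
   the constancy of the averages apply. *)
pose a := Num.min (b - 1) (ln (d / 2)).
have ab : a < b by rewrite gt_min ltrBlDr ltrDl ltr01.
have aX := lt_trans ab bX.
have hae y : rnorm (h a y - f z0) <= e.
  apply: hd; rewrite addrC addKr rnormM rnorm_expi mulr1 rnorm_real gtr0_norm ?expR_gt0 //.
  apply: (@le_lt_trans _ _ (d / 2)); last by lra.
  by rewrite -[leRHS]lnK ?posrE ?divr_gt0 // ler_expR ge_min lexx orbT.
have cha : cbm (h a).
  apply: ch => //; exists (e + rnorm (f z0)) => y.
  by have := rnormD (h a y - f z0) (f z0); rewrite subrK; have := hae y; lra.
rewrite -(const a ab) -[f z0]caver_cst -[X in _ - X]mul1r -mulNr -caverZ; last exact: cbm_cst.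
rewrite -caverD //; last by apply: cbmZ; exact: cbm_cst.
apply: rnorm_caver_le => [|t]; last by rewrite mulN1r.
by apply: cbmD => //; apply: cbmZ; exact: cbm_cst.
Qed.

End MeanValue.

(** * Approximation by trigonometric polynomials *)

Section TrigonometricKernel.
Context (R : realType).
Implicit Types (n j : nat) (s t : R) (F : R -> R[i]).

(** The central coefficient is the largest of the [2 n + 1] coefficients of sum [4^n]. The proof is
    by induction, through [(n + 1) C(2 n + 2, n + 1) = 2 (2 n + 1) C(2 n, n)]. *)
Lemma exp4_le_central_bin n : (4 ^ n <= (2 * n + 1) * 'C(2 * n, n))%N.
Proof.
elim: n => [|n IH]; first by rewrite muln0 bin0.
have e1 : ((2 * n).+2 * 'C((2 * n).+1, n) = n.+1 * 'C((2 * n).+2, n.+1))%N.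
  by rewrite mul_bin_diag.
have e2 : (n.+1 * 'C((2 * n).+1, n) = (2 * n).+1 * 'C(2 * n, n))%N.
  have := mul_bin_down (2 * n).+1 n; rewrite (_ : (2 * n).+1 - n = n.+1)%N //.
  by rewrite subSn ?mul2n -?addnn ?leq_addl // addnK.
rewrite (_ : 2 * n.+1 = (2 * n).+2)%N; last by rewrite mulnS add2n.
have e3 : (n.+1 * 'C((2 * n).+2, n.+1) = 2 * (2 * n).+1 * 'C(2 * n, n))%N.
  by move: e1 e2; move: 'C(_, n) 'C(_, n.+1) 'C(_, n) => X Y Z; nia.
rewrite expnS.
apply: (@leq_trans (2 * (n.+1 * 'C((2 * n).+2, n.+1)))).
  by rewrite e3; move: IH; move: (4 ^ n)%N 'C(_, n) => u Z; nia.
by rewrite mulnA leq_mul2r; apply/orP; right; lia.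
Qed.

(** Fourier coefficients of [kernel], index [j] standing for the frequency [j - n]. The value [1] at
    frequency zero gives the kernel average one, and lets approximants keep the mean of the
    approximated function. *)
Definition kappa n j : R := 'C(2 * n, j)%:R / 'C(2 * n, n)%:R.

Lemma central_bin_gt0 n : 0 < 'C(2 * n, n)%:R :> R.
Proof. by rewrite ltr0n bin_gt0 mul2n -addnn leq_addl. Qed.

Lemma kappa_diag n : kappa n n = 1.
Proof. by rewrite /kappa divff // gt_eqF // central_bin_gt0. Qed.

(* [trig n j t] is [e^{i (j - n) t}]. *)
Definition trig n j t : R[i] := expi t ^+ j * conjc (expi t) ^+ n.

Definition fourier n j F : R[i] := caver (fun s => F s * conjc (trig n j s)).

(* The de la Vallee Poussin kernel [|1 + e^{i (t - s)}|^(2 n) / C(2 n, n)]. *)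
Definition kernel n t s : R :=
  (4 - rnorm (expi s - expi t) ^+ 2) ^+ n / 'C(2 * n, n)%:R.

Lemma cbm_trig n j : cbm (trig n j).
Proof. by apply: cbmM; apply: cbmX; [|apply: cbm_conj]; exact: cbm_expi. Qed.

(** The parallelogram law for unit vectors: [4 - |e^{is} - e^{it}|^2 = |e^{is} + e^{it}|^2]. The
    left side shows the decay away from [t], the right side the trigonometric polynomial. *)
Lemma four_sub_sqr s t :
  (4 - rnorm (expi s - expi t) ^+ 2)%:C =
  (1 + expi t * conjc (expi s)) * (1 + conjc (expi t) * expi s).
Proof.
rewrite realcB -mul_conj conjcD conjcN (rmorph_nat (real_complex R) 4).
have h1 := expi_conj s; have h2 := expi_conj t.
move: (expi s) (conjc (expi s)) (expi t) (conjc (expi t)) h1 h2 => a a' b b' h1 h2.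
transitivity (4 - (a * a' + b * b' - a * b' - b * a')); first by ring.
transitivity (1 + b * a' + b' * a + (b * b') * (a * a')); last by ring.
by rewrite h1 h2; ring.
Qed.

(** For [x' = 1 / x] one has [((1 + x) (1 + x'))^n = (1 + x)^(2 n) x'^n], and the binomial theorem
    reads off the coefficients. *)
Lemma kernelE n t s :
  \sum_(j < (2 * n).+1) (kappa n j)%:C * trig n j t * conjc (trig n j s) =
  (kernel n t s)%:C.
Proof.
rewrite /kernel realcM realcV [in RHS]rmorphXn /= four_sub_sqr.
pose x := expi t * conjc (expi s); pose x' := conjc (expi t) * expi s.
have xx : x * x' = 1.
  have h1 := expi_conj s; have h2 := expi_conj t.
  rewrite /x /x' (_ : _ * _ = (expi t * conjc (expi t)) * (expi s * conjc (expi s))); last by ring.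
  by rewrite h1 h2 mulr1.
have -> : ((1 + x) * (1 + x')) ^+ n = (1 + x) ^+ (2 * n) * x' ^+ n.
  rewrite exprM -exprMn; congr (_ ^+ _).
  rewrite (_ : (1 + x) ^+ 2 * x' = x' + 2 * (x * x') + x * (x * x')); last by ring.
  rewrite (_ : (1 + x) * _ = 1 + x + x' + x * x'); last by ring.
  by rewrite xx; ring.
rewrite exprDn !mulr_suml; apply: eq_bigr => j _.
rewrite expr1n mul1r /kappa realcM realcV rmorph_nat /trig conjcM !conjcX conjcK.
rewrite /x /x' !exprMn -mulr_natl.
by move: (_^-1) => k; ring.
Qed.

Lemma kernel_ge0 n t s : 0 <= kernel n t s.
Proof.
rewrite divr_ge0 ?(ltW (central_bin_gt0 _)) // exprn_ge0 // subr_ge0.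
rewrite (_ : 4 = 2 ^+ 2); last by ring.
rewrite lerXn2r ?nnegrE ?rnorm_ge0 // (le_trans (rnormB _ _)) // !rnorm_expi.
by lra.
Qed.

(** The numerator is at most [4^n (1 - d^2 / 4)^n], and [exp4_le_central_bin] bounds
    [4^n / C(2 n, n)] by [2 n + 1]. *)
Lemma kernel_far n t s d : 0 <= d -> d <= rnorm (expi s - expi t) ->
  kernel n t s <= (2 * n + 1)%:R * (1 - d ^+ 2 / 4) ^+ n.
Proof.
move=> d0 hd; have := central_bin_gt0 n; set c := 'C(2 * n, n)%:R => c0.
have h4 : 0 <= 4 - rnorm (expi s - expi t) ^+ 2.
  rewrite subr_ge0 (_ : 4 = 2 ^+ 2); last by ring.
  rewrite lerXn2r ?nnegrE ?rnorm_ge0 // (le_trans (rnormB _ _)) // !rnorm_expi.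
  by lra.
have hq : 4 - rnorm (expi s - expi t) ^+ 2 <= 4 - d ^+ 2.
  by rewrite lerD2l lerN2 lerXn2r ?nnegrE // rnorm_ge0.
have hc : (4 : R) ^+ n <= (2 * n + 1)%:R * c.
  by rewrite /c -natrX -natrM ler_nat exp4_le_central_bin.
rewrite /kernel ler_pdivrMr //.
apply: (@le_trans _ _ ((4 - d ^+ 2) ^+ n)); first by rewrite lerXn2r ?nnegrE // (le_trans h4).
have -> : 4 - d ^+ 2 = 4 * (1 - d ^+ 2 / 4) by field.
have q0 : 0 <= 1 - d ^+ 2 / 4 by lra.
by rewrite exprMn [leRHS]mulrAC ler_wpM2r // exprn_ge0.
Qed.

Lemma caver_kernel n t : caver (fun s => (kernel n t s)%:C) = 1.
Proof.
transitivity (caver (fun s => \sum_(j < (2 * n).+1) (kappa n j)%:C * trig n j t * conjc (trig n j s))).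
  by apply: caver_ext => s; rewrite kernelE.
have c j : cbm (fun s => (kappa n j)%:C * trig n j t * conjc (trig n j s)).
  by apply: cbmZ; apply: cbm_conj; exact: cbm_trig.
rewrite caver_sum //.
have nn : (n < (2 * n).+1)%N by rewrite ltnS mul2n -addnn leq_addl.
have cE j : caver (fun s => conjc (trig n j s)) = (j == n)%:R.
  case: eqVneq => [->|jn].
    rewrite -[RHS]caver_cst; apply: caver_ext => s.
    by rewrite /trig -exprMn expi_conj expr1n conjc1.
  rewrite -[RHS](caver_expi_eq0 R jn); apply: caver_ext => s.
  by rewrite /trig conjcM !conjcX conjcK.
rewrite (bigD1 (Ordinal nn)) //= big1 => [|j jn].
  rewrite caverZ ?cE ?eqxx; last by apply: cbm_conj; exact: cbm_trig.
  by rewrite addr0 mulr1 kappa_diag mul1r /trig -exprMn expi_conj expr1n.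
rewrite caverZ ?cE; last by apply: cbm_conj; exact: cbm_trig.
by rewrite (_ : (j == n :> nat) = false) ?mulr0 //; apply/negbTE.
Qed.

Lemma cbm_kernel n t : cbm (fun s => (kernel n t s)%:C).
Proof.
apply: (@cbm_ext _ (fun s => \sum_(j < (2 * n).+1) (kappa n j)%:C * trig n j t * conjc (trig n j s))).
  by move=> s; exact: kernelE.
by apply: cbm_sum => j; apply: cbmZ; apply: cbm_conj; exact: cbm_trig.
Qed.

(** The sum is the convolution of [F] with the kernel, which is nonnegative of average one. Where
    [s] is near [t] the oscillation of [F] is at most [e]; elsewhere it is at most [2 M] and the
    kernel is small by [kernel_far]. *)
Lemma trig_approx n F t (M d e : R) : cbm F -> 0 <= d -> d <= 1 -> 0 <= e ->
  (forall s, rnorm (F s) <= M) ->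
  (forall s, rnorm (expi s - expi t) <= d -> rnorm (F s - F t) <= e) ->
  rnorm (\sum_(j < (2 * n).+1) (kappa n j)%:C * fourier n j F * trig n j t - F t) <=
  e + 2 * M * ((2 * n + 1)%:R * (1 - d ^+ 2 / 4) ^+ n).
Proof.
move=> cF d0 d1 e0 hM hd.
have ck := cbm_kernel n t.
have cFk : cbm (fun s => F s * (kernel n t s)%:C) by exact: cbmM.
have -> : \sum_(j < (2 * n).+1) (kappa n j)%:C * fourier n j F * trig n j t - F t =
    caver (fun s => (F s - F t) * (kernel n t s)%:C).
  have -> : (fun s => (F s - F t) * (kernel n t s)%:C) =
      (fun s => F s * (kernel n t s)%:C + (- F t) * (kernel n t s)%:C).
    by apply/funext => s; rewrite mulrDl.
  rewrite caverD //; last exact: cbmZ.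
  rewrite caverZ // caver_kernel mulr1; congr (_ - _).
  have cj j : cbm (fun s => F s * conjc (trig n j s)).
    by apply: cbmM => //; apply: cbm_conj; exact: cbm_trig.
  transitivity (caver (fun s => \sum_(j < (2 * n).+1)
      (kappa n j)%:C * trig n j t * (F s * conjc (trig n j s)))).
    rewrite caver_sum => [|j]; last exact: cbmZ.
    by apply: eq_bigr => j _; rewrite caverZ // /fourier mulrAC.
  apply: caver_ext => s; rewrite -kernelE mulr_sumr; apply: eq_bigr => j _; ring.
set B := _ * (1 - _) ^+ n.
have M0 : 0 <= M by apply: le_trans (hM 0); exact: rnorm_ge0.
have bk : bounded_measurable (kernel n t) by case: ck.
apply: le_trans (rnorm_caver _) _.
  by apply: cbmM => //; apply: cbmD => //; exact: cbm_cst.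
apply: (@le_trans _ _ (aver (fun s => e * kernel n t s + 2 * M * B))); last first.
  rewrite (averD (bmZ e bk) (bm_cst _)) (averZ e bk) aver_cst.
  have /(congr1 (@complex.Re R)) := caver_kernel n t; rewrite Re_caver /= => ->.
  by rewrite mulr1.
have BB s : d <= rnorm (expi s - expi t) -> kernel n t s <= B by exact: kernel_far.
apply: le_aver.
- apply: cbm_rnorm; apply: cbmM => //; apply: cbmD => //; exact: cbm_cst.
- by apply: bmD; [exact: bmZ | exact: bm_cst].
move=> s; rewrite rnormM rnorm_real ger0_norm ?kernel_ge0 //.
have kB : 0 <= e * kernel n t s by rewrite mulr_ge0 // kernel_ge0.
have [h|h] := lerP (rnorm (expi s - expi t)) d.
  have B0 : 0 <= B.
    rewrite mulr_ge0 // exprn_ge0 //.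
    by have : d ^+ 2 <= 1 by [apply: exprn_ile1]; lra.
  have := ler_wpM2r (kernel_ge0 n t s) (hd s h).
  by have := mulr_ge0 (mulr_ge0 (ler0n R 2) M0) B0; lra.
have := BB s (ltW h) => kb.
have := ler_pM (rnorm_ge0 (F s - F t)) (kernel_ge0 n t s)
  (le_trans (rnormB _ _) (lerD (hM s) (hM t))) kb; lra.
Qed.

(** With [y = d^2 / 8] the ratio is [q = 1 - 2 y], and [q (1 + y)^2 <= 1]. Bernoulli's inequality
    then gives [q^n <= (1 + n y)^(-2)], whose quadratic decay beats the factor [2 n + 1]. *)
Lemma trig_error_small (d eta : R) : 0 < d -> d <= 1 -> 0 < eta ->
  exists n, (2 * n + 1)%:R * (1 - d ^+ 2 / 4) ^+ n < eta.
Proof.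
move=> d0 d1 eta0; pose y := d ^+ 2 / 8.
have y0 : 0 < y by rewrite divr_gt0 // exprn_gt0.
have d2 : d ^+ 2 <= 1 by apply: exprn_ile1 => //; exact: ltW.
have y1 : y <= 1 by rewrite /y; lra.
pose q := 1 - d ^+ 2 / 4; have qE : q = 1 - 2 * y by rewrite /q /y; lra.
have q0 : 0 <= q by rewrite /q; lra.
have bern n : 1 + n%:R * y <= (1 + y) ^+ n.
  elim: n => [|n IH]; first by rewrite mul0r addr0 expr0.
  rewrite exprS (le_trans _ (ler_wpM2l _ IH)) //; last by lra.
  rewrite mulrSr; have : 0 <= n%:R * y * y by rewrite !mulr_ge0 // ltW.
  by lra.
have qn n : q ^+ n * (1 + n%:R * y) ^+ 2 <= 1.
  apply: (@le_trans _ _ (q ^+ n * ((1 + y) ^+ n) ^+ 2)).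
    rewrite ler_wpM2l ?exprn_ge0 // lerXn2r ?nnegrE //; last by rewrite exprn_ge0 //; lra.
    by rewrite addr_ge0 // mulr_ge0 // ltW.
  rewrite -exprM mulnC exprM -exprMn exprn_ile1 //.
    by rewrite mulr_ge0 // sqr_ge0.
  rewrite qE expr2; have : 0 <= y ^+ 2 * (3 + 2 * y).
    by rewrite mulr_ge0 ?sqr_ge0 //; lra.
  by lra.
have [N hN] := @invn_lt R (eta * y ^+ 2 / 2) ltac:(by rewrite divr_gt0 // mulr_gt0 // exprn_gt0).
exists N; rewrite -/q.
have {}hN := hN N (leqnn N).
have w0 : 0 < 1 + N%:R * y by rewrite ltr_pwDl // mulr_ge0 // ltW.
have wy : y * N.+1%:R <= 1 + N%:R * y by rewrite mulrSr mulrDr mulr1 addrC mulrC lerD2r.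
have h1 : (2 * N + 1)%:R * q ^+ N * (1 + N%:R * y) ^+ 2 <= 2 * N.+1%:R.
  rewrite -mulrA -[leRHS]mulr1 ler_pM //.
  - by rewrite mulr_ge0 ?sqr_ge0 // exprn_ge0.
  - by rewrite -natrM ler_nat mulnS addn1 -addn1 addnC leq_add2r.
have h2 : 2 * N.+1%:R < eta * (y * N.+1%:R) ^+ 2.
  move: hN; rewrite invf_plt ?posrE ?ltr0n //; last by rewrite divr_gt0 // mulr_gt0 // exprn_gt0.
  move=> hN; rewrite exprMn mulrA [_ ^+ 2 in ltRHS]expr2 mulrA ltr_pM2r ?ltr0n //.
  move: hN; rewrite invf_div ltr_pdivrMr; last by rewrite mulr_gt0 // exprn_gt0.
  by rewrite mulrC.
have h3 : eta * (y * N.+1%:R) ^+ 2 <= eta * (1 + N%:R * y) ^+ 2.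
  by rewrite ler_wpM2l ?(ltW eta0) // lerXn2r ?nnegrE ?(ltW w0) // mulr_ge0 // ltW.
rewrite -(ltr_pM2r (exprn_gt0 2 w0)); exact: le_lt_trans h1 (lt_le_trans h2 h3).
Qed.

End TrigonometricKernel.

(** * From infinitesimal to global mean value inequalities *)

Section SubMean.
Context (R : realType).

Lemma polar_unit (z : R[i]) : rnorm z = 1 -> exists t, z = expi t.
Proof.
move=> z1; have z2 : Re z ^+ 2 + Im z ^+ 2 = 1 by rewrite -rnorm_sqr z1 expr1n.
have x1 : -1 <= Re z <= 1 by rewrite -ler_norml -z1 normRe_le.
have s2 : Num.sqrt (1 - Re z ^+ 2) = `|Im z|.
  by rewrite -z2 addrC addKr sqrtr_sqr.
have [y0|y0] := lerP 0 (Im z).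
  exists (acos (Re z)); apply: complex_ext => /=; first by rewrite acosK.
  by rewrite sin_acos // s2 ger0_norm.
exists (- acos (Re z)); apply: complex_ext => /=; first by rewrite cosN acosK.
by rewrite sinN sin_acos // s2 ltr0_norm // opprK.
Qed.

Lemma polar_circle (z0 z : R[i]) (r : R) : 0 < r -> rnorm (z - z0) = r ->
  exists t, z = circle z0 r t.
Proof.
move=> r0 zr; have rn : r%:C != 0 by apply/eqP => -[]; apply/eqP; rewrite gt_eqF.
have [|t ht] := @polar_unit ((z - z0) / r%:C).
  by rewrite rnormM rnormV rnorm_real gtr0_norm // zr divff // gt_eqF.
by exists t; rewrite /circle -ht mulrCA divff // mulr1 addrC subrK.
Qed.

(** The tolerated error [o(r^2)] is what a multiple of [|z - z0|^2] compensates: its average over a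
    circle of radius [r] exceeds its central value by that multiple of [r^2]. *)
Definition local_submean (u : R[i] -> R) (z : R[i]) : Prop :=
  forall e : R, 0 < e -> exists2 d : R, 0 < d & forall r, 0 < r -> r < d ->
    u z <= aver (fun t => u (circle z r t)) + e * r ^+ 2.

Lemma aver_sqr_dist (z0 z1 : R[i]) (r : R) :
  bounded_measurable (fun t => rnorm (circle z1 r t - z0) ^+ 2) /\
  aver (fun t => rnorm (circle z1 r t - z0) ^+ 2) = rnorm (z1 - z0) ^+ 2 + r ^+ 2.
Proof.
pose f t : R := 2 * r * Re ((z1 - z0) * conjc (expi t)).
have cE : cbm (fun t : R => (z1 - z0) * conjc (expi t)).
  by apply: cbmZ; apply: cbm_conj; exact: cbm_expi.
have E t : rnorm (z1 - z0) ^+ 2 + r ^+ 2 + f t = rnorm (circle z1 r t - z0) ^+ 2.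
  have h : cos t ^+ 2 + sin t ^+ 2 = 1 by exact: cos2Dsin2.
  rewrite /f /circle !rnorm_sqr !ReImE /=; move: h.
  move: (cos t) (sin t) (Re z1) (Re z0) (Im z1) (Im z0) => c s a b a' b' h.
  have -> : r ^+ 2 = r ^+ 2 * (c ^+ 2 + s ^+ 2) by rewrite h mulr1.
  by ring.
have bf : bounded_measurable f by apply: bmZ; case: cE.
split; first by apply: bm_ext E _; apply: bmD => //; exact: bm_cst.
rewrite -(aver_ext E) averD ?aver_cst //; last exact: bm_cst.
rewrite /f averZ; last by case: cE.
rewrite -Re_caver caverZ; last by apply: cbm_conj; exact: cbm_expi.
rewrite caver_conj; last exact: cbm_expi.
rewrite (_ : caver _ = 0) ?conjc0 ?mulr0 ?mulr0 ?addr0 //.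
by have := caver_expiX R (ltn0Sn 0); under caver_ext => t do rewrite expr1.
Qed.

(* Adding [e |z - z0|^2] to [F] makes the infinitesimal inequality strict, which
   excludes an interior maximum. *)
Lemma max_principle (Omega : set R[i]) (F : R[i] -> R) (z0 : R[i]) (r c : R) :
  0 < r -> closed_disc z0 r `<=` Omega -> usc_on Omega (fun z => (F z)%:E) ->
  (forall z, rnorm (z - z0) < r -> local_submean F z) ->
  (forall z s, 0 < s -> closed_disc z s `<=` Omega ->
     bounded_measurable (fun t => F (circle z s t))) ->
  (forall z, rnorm (z - z0) = r -> F z <= c) -> F z0 <= c.
Proof.
move=> r0 KO uF sF bF hc; rewrite leNgt; apply/negP => Fc.
(* On the bounding circle the added term equals half the excess of [F z0] over [c], so the maximum
   of [G] is not reached there. *)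
pose e := (F z0 - c) / (2 * r ^+ 2).
have r2 : 0 < r ^+ 2 by rewrite exprn_gt0.
have e0 : 0 < e by rewrite divr_gt0 ?subr_gt0 // mulr_gt0.
have eE : e * r ^+ 2 = (F z0 - c) / 2 by rewrite /e; field; rewrite gt_eqF.
pose G z := F z + e * rnorm (z - z0) ^+ 2.
have uG : usc_on Omega (fun z => (G z)%:E).
  apply/usc_onP => z a Oz Ga; have /usc_onP h := uF.
  pose k := (a - G z) / 2; have k0 : 0 < k by rewrite divr_gt0 // subr_gt0.
  have [d1 d10 h1] := h z (F z + k) Oz ltac:(by rewrite ltrDl).
  pose n := rnorm (z - z0); have n0 : 0 <= n by exact: rnorm_ge0.
  have D0 : 0 < e * (2 * n + 1) by rewrite mulr_gt0 // ltr_wpDl // mulr_ge0.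
  exists (Num.min d1 (Num.min 1 (k / (e * (2 * n + 1))))).
    by rewrite !lt_min d10 ltr01 divr_gt0.
  move=> y; rewrite !lt_min => /andP[yd1 /andP[y1 yk]] Oy.
  rewrite ltr_pdivlMr // in yk.
  have Fy := h1 y yd1 Oy.
  have ny : rnorm (y - z0) <= rnorm (y - z) + n by exact: rdist_tri.
  have : rnorm (y - z0) ^+ 2 <= (rnorm (y - z) + n) ^+ 2.
    by rewrite lerXn2r ?nnegrE ?addr_ge0 ?rnorm_ge0.
  move: (rnorm (y - z)) (rnorm_ge0 (y - z)) y1 yk => x x0 x1 xk hx.
  have hx2 : (x + n) ^+ 2 <= n ^+ 2 + x * (2 * n + 1).
    have : 0 <= x * (1 - x) by rewrite mulr_ge0 // subr_ge0 ltW.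
    by rewrite sqrrD; lra.
  have := ler_wpM2l (ltW e0) (le_trans hx hx2).
  move: Ga xk Fy; rewrite /k /G -/n => Ga xk Fy; lra.
have [z1 Kz1 hmax] := usc_max uG KO (ltW r0).
have Kz0 : closed_disc z0 r z0 by apply/closed_discE; rewrite subrr rnorm0 ltW.
have G01 := hmax _ Kz0; rewrite {1}/G subrr rnorm0 expr0n mulr0 addr0 in G01.
have z1r : rnorm (z1 - z0) < r.
  rewrite lt_neqAle; apply/andP; split; last exact/closed_discE.
  apply/eqP => z1r; have := hc _ z1r; move: G01; rewrite /G z1r eE; lra.
(* Half of [e] is tolerated, while maximality of [G] at [z1] forces the averages of [F] down by the
   full [e s^2]. *)
have [d d0 hd] := sF z1 z1r (e / 2) ltac:(by rewrite divr_gt0).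
pose s := Num.min (d / 2) ((r - rnorm (z1 - z0)) / 2).
have s0 : 0 < s by rewrite lt_min !divr_gt0 // subr_gt0.
have sd : s < d by rewrite gt_min; apply/orP; left; lra.
have sr : s <= r - rnorm (z1 - z0) by rewrite ge_min; apply/orP; right; lra.
have KK : closed_disc z1 s `<=` closed_disc z0 r.
  move=> y /closed_discE ys; apply/closed_discE.
  by have := rdist_tri y z1 z0; lra.
have bFs := bF z1 s s0 (subset_trans KK KO).
have [bD aD] := aver_sqr_dist z0 z1 s.
have aG : aver (fun t => G (circle z1 s t)) <= G z1.
  apply: aver_le_cst; first by apply: bmD => //; exact: bmZ.
  by move=> t; apply/hmax/KK/circle_closed_disc.
move: aG; rewrite /G averD //; last exact: bmZ.
rewrite averZ // aD => aG.
have := hd s s0 sd; have : 0 < e * s ^+ 2 by rewrite mulr_gt0 // exprn_gt0.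
by lra.
Qed.

Definition ccont (f : R[i] -> R[i]) : Prop := forall z (e : R), 0 < e ->
  exists2 d : R, 0 < d & forall y, rnorm (y - z) < d -> rnorm (f y - f z) <= e.

Lemma ccont_cst c : ccont (fun=> c).
Proof. by move=> z e e0; exists 1 => // y _; rewrite subrr rnorm0 ltW. Qed.

Lemma ccont_id : ccont (fun z => z).
Proof. by move=> z e e0; exists e => // y /ltW. Qed.

Lemma ccontD f g : ccont f -> ccont g -> ccont (fun z => f z + g z).
Proof.
move=> cf cg z e e0; have e2 : 0 < e / 2 by rewrite divr_gt0.
have [d1 d10 h1] := cf z _ e2; have [d2 d20 h2] := cg z _ e2.
exists (Num.min d1 d2); first by rewrite lt_min d10.
move=> y; rewrite lt_min => /andP[/h1 y1 /h2 y2].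
by rewrite opprD addrACA; have := rnormD (f y - f z) (g y - g z); lra.
Qed.

Lemma ccontM f g : ccont f -> ccont g -> ccont (fun z => f z * g z).
Proof.
move=> cf cg z e e0.
pose a := rnorm (f z); pose b := rnorm (g z).
have a0 : 0 <= a by exact: rnorm_ge0.
have b0 : 0 <= b by exact: rnorm_ge0.
pose k := Num.min 1 (e / (a + b + 1)).
have ab : 0 < a + b + 1 by rewrite ltr_wpDl // addr_ge0.
have k0 : 0 < k by rewrite lt_min ltr01 divr_gt0.
have k1 : k <= 1 by rewrite ge_min lexx.
have ke : k * (a + b + 1) <= e by rewrite -ler_pdivlMr // ge_min lexx orbT.
have [d1 d10 h1] := cf z _ k0; have [d2 d20 h2] := cg z _ k0.
exists (Num.min d1 d2); first by rewrite lt_min d10.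
move=> y; rewrite lt_min => /andP[/h1 y1 /h2 y2].
have -> : f y * g y - f z * g z =
    (f y - f z) * (g y - g z) + (f y - f z) * g z + f z * (g y - g z) by ring.
have := rnormD ((f y - f z) * (g y - g z) + (f y - f z) * g z) (f z * (g y - g z)).
have := rnormD ((f y - f z) * (g y - g z)) ((f y - f z) * g z).
rewrite (rnormM (f y - f z)) (rnormM (f y - f z) (g z)) (rnormM (f z)) -/a -/b.
have := ler_pM (rnorm_ge0 _) (rnorm_ge0 _) y1 y2.
have := ler_wpM2r b0 y1; have := ler_wpM2l a0 y2.
have : k * k <= k * 1 by rewrite ler_wpM2l // ltW.
by lra.
Qed.

Lemma ccontX f n : ccont f -> ccont (fun z => f z ^+ n).
Proof.
move=> cf; elim: n => [|n IH]; first exact: ccont_cst.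
by have := ccontM cf IH; congr ccont; apply/funext => z; rewrite exprS.
Qed.

Lemma ccont_conj f : ccont f -> ccont (fun z => conjc (f z)).
Proof.
move=> cf z e e0; have [d d0 h] := cf z e e0; exists d => // y /h.
by rewrite -conjcN -conjcD rnorm_conj.
Qed.

Lemma ccont_sum (I : Type) (s : seq I) (f : I -> R[i] -> R[i]) :
  (forall i, ccont (f i)) -> ccont (fun z => \sum_(i <- s) f i z).
Proof.
move=> cf; elim: s => [|i s IH].
  by have := ccont_cst 0; congr ccont; apply/funext => z; rewrite big_nil.
by have := ccontD (cf i) IH; congr ccont; apply/funext => z; rewrite big_cons.
Qed.

(* The harmonic extension of [trig n j] from the circle to its disc. *)
Definition hext (z0 : R[i]) (r : R) (n j : nat) (z : R[i]) : R[i] :=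
  if (n <= j)%N then ((z - z0) / r%:C) ^+ (j - n)
  else conjc ((z - z0) / r%:C) ^+ (n - j).

Lemma hext_circle z0 r n j t : 0 < r -> hext z0 r n j (circle z0 r t) = trig n j t.
Proof.
move=> r0; rewrite /hext circleB (_ : _ / _ = expi t); last first.
  by rewrite mulrAC divff ?mul1r //; apply/eqP => -[]; apply/eqP; rewrite gt_eqF.
rewrite /trig; case: leqP => nj.
  by rewrite -{2}(subnKC nj) exprD mulrAC -exprMn expi_conj expr1n mul1r.
by rewrite -{2}(subnKC (ltnW nj)) exprD mulrA -exprMn expi_conj expr1n mul1r.
Qed.

Lemma hext_center z0 r n j : hext z0 r n j z0 = (j == n)%:R.
Proof.
rewrite /hext subrr mul0r rmorph0 !expr0n !subn_eq0.
by case: (ltngtP n j).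
Qed.

Lemma hext_cont z0 r n j : ccont (hext z0 r n j).
Proof.
have c : ccont (fun z => (z - z0) / r%:C).
  apply: ccontM; last exact: ccont_cst.
  by apply: ccontD; [exact: ccont_id | exact: ccont_cst].
rewrite /hext; case: (n <= j)%N; first exact: ccontX.
by apply: ccontX; exact: ccont_conj.
Qed.

Lemma caver_affine_pow (a b : R[i]) k :
  cbm (fun t : R => (a + b * expi t) ^+ k) /\
  caver (fun t : R => (a + b * expi t) ^+ k) = a ^+ k.
Proof.
have ce n : cbm (fun t : R => expi t ^+ n) by apply: cbmX; exact: cbm_expi.
split.
  by apply: cbmX; apply: cbmD; [exact: cbm_cst | apply: cbmZ; exact: cbm_expi].
rewrite (_ : (fun t => _) = (fun t : R => \sum_(i < k.+1) (a ^+ (k - i) * b ^+ i *+ 'C(k, i)) * expi t ^+ i)).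
  rewrite caver_sum => [|i]; last exact: cbmZ.
  rewrite big_ord_recl big1 => [|i _]; rewrite caverZ //; last first.
    by rewrite caver_expiX ?mulr0.
  by rewrite addr0 expr0 caver_cst mulr1 subn0 mulr1 bin0.
apply/funext => t; rewrite exprDn; apply: eq_bigr => i _.
by rewrite exprMn mulrA -mulrnAl.
Qed.

(** A power of an affine function, or of the conjugate of one, has the mean value property on every
    circle of the plane. Of harmonicity only this is used. *)
Lemma hext_mean z0 r n j z s :
  cbm (fun t => hext z0 r n j (circle z s t)) /\
  caver (fun t => hext z0 r n j (circle z s t)) = hext z0 r n j z.
Proof.
have E t : (circle z s t - z0) / r%:C = (z - z0) / r%:C + s%:C / r%:C * expi t.
  by rewrite /circle; move: (r%:C^-1) => k; ring.
rewrite /hext; case: (n <= j)%N.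
  have [h1 h2] := caver_affine_pow ((z - z0) / r%:C) (s%:C / r%:C) (j - n).
  by under [in X in _ /\ X]caver_ext => t do rewrite E; split=> //; apply: cbm_ext h1 => t; rewrite E.
have [h1 h2] := caver_affine_pow ((z - z0) / r%:C) (s%:C / r%:C) (n - j).
split; first by apply: cbm_ext (cbm_conj h1) => t; rewrite E conjcX.
under caver_ext => t do rewrite E -conjcX.
by rewrite caver_conj // h2 conjcX.
Qed.

End SubMean.

(** * Lipschitz majorants of a semicontinuous function on the circle *)

Section SupConvolution.
Context (R : realType).
Variables (w : R -> R) (M : R).
Hypothesis w0 : forall t, 0 <= w t.
Hypothesis wM : forall t, w t <= M.

(* Lipschitz majorants of [w] that decrease to [w] when [w] is upper
   semicontinuous. *)
Definition sup_conv (m : nat) (t : R) : R :=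
  sup [set w s - m%:R * rnorm (expi s - expi t) | s in setT].

Let has_sup_conv m t : has_sup [set w s - m%:R * rnorm (expi s - expi t) | s in setT].
Proof.
split; first by exists (w t - m%:R * rnorm (expi t - expi t)), t.
by exists M => _ [s _ <-]; rewrite lerBlDr (le_trans (wM s)) // lerDl mulr_ge0 // rnorm_ge0.
Qed.

Lemma sup_conv_ge m s t : w s - m%:R * rnorm (expi s - expi t) <= sup_conv m t.
Proof. by apply: ub_le_sup; [case: (has_sup_conv m t) | exists s]. Qed.

Lemma sup_conv_ge_self m t : w t <= sup_conv m t.
Proof. by have := sup_conv_ge m t t; rewrite subrr rnorm0 mulr0 subr0. Qed.

Lemma sup_conv_le m t a :
  (forall s, w s - m%:R * rnorm (expi s - expi t) <= a) -> sup_conv m t <= a.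
Proof.
by move=> h; apply: ge_sup => [|_ [s _ <-]//]; case: (has_sup_conv m t).
Qed.

Lemma sup_conv_le_bound m t : sup_conv m t <= M.
Proof.
apply: sup_conv_le => s; rewrite lerBlDr (le_trans (wM s)) // lerDl.
by rewrite mulr_ge0 // rnorm_ge0.
Qed.

Lemma sup_conv_lip m s t : sup_conv m t - sup_conv m s <= m%:R * rnorm (expi s - expi t).
Proof.
rewrite lerBlDr; apply: sup_conv_le => s'.
have := sup_conv_ge m s' s.
have := ler_wpM2l (ler0n R m) (rdist_tri (expi s') (expi t) (expi s)).
by rewrite (rdistC (expi t)); lra.
Qed.

Lemma sup_conv_norm_lip m s t :
  `|sup_conv m s - sup_conv m t| <= m%:R * rnorm (expi s - expi t).
Proof.
rewrite ler_norml; have := sup_conv_lip m s t; have := sup_conv_lip m t s.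
by rewrite (rdistC (expi t)) => h1 h2; lra.
Qed.

Lemma sup_conv_bm m : bounded_measurable (sup_conv m).
Proof.
apply: (bm_continuous (M := M)) => [t|t]; last first.
  rewrite ger0_norm ?sup_conv_le_bound //.
  exact: le_trans (w0 t) (sup_conv_ge_self m t).
apply/cvgrPdist_lt => e e0.
have m1 : 0 < m%:R + 1 :> R by rewrite ltr_wpDl.
have := @circle_near R 0 1 t (e / (m%:R + 1)) ltac:(by rewrite divr_gt0).
apply: filterS => s; rewrite /circle !mul1r !add0r ltr_pdivlMr // => h.
apply: le_lt_trans (sup_conv_norm_lip m t s) _; rewrite rdistC.
by have := rnorm_ge0 (expi s - expi t); lra.
Qed.

Hypothesis wusc : forall t a, w t < a ->
  exists2 d : R, 0 < d & forall s, rnorm (expi s - expi t) < d -> w s < a.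

(** Once [m d >= M], a point at chordal distance at least [d] from [t] is penalised below
    [0 <= w t]; at closer points semicontinuity gives [w s < w t + e]. *)
Lemma sup_conv_cvg t : sup_conv ^~ t @ \oo --> w t.
Proof.
apply/cvgrPdist_le => e e0.
have [d d0 hd] := @wusc t (w t + e) ltac:(by rewrite ltrDl).
have [N hN] : exists N, M <= N%:R * d.
  exists (Num.truncn (M / d)).+1.
  by rewrite -ler_pdivrMr // ltW // truncnS_gt.
exists N => // m /= Nm.
rewrite distrC ger0_norm ?subr_ge0 ?sup_conv_ge_self // lerBlDl.
apply: sup_conv_le => s; have [/hd h|h] := ltP (rnorm (expi s - expi t)) d.
  by rewrite lerBlDr (le_trans (ltW h)) // lerDl mulr_ge0 // rnorm_ge0.
rewrite lerBlDr (le_trans (wM s)) //.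
have : N%:R * d <= m%:R * rnorm (expi s - expi t).
  by rewrite ler_pM // ?(ltW d0) // ler_nat.
by have := w0 t; lra.
Qed.

Lemma sup_conv_aver (e : R) : bounded_measurable w -> 0 < e ->
  exists m, aver (sup_conv m) <= aver w + e.
Proof.
move=> bw e0; have p0 := @twopi_gt0 R.
have mg m : measurable_fun (@angles R) (EFin \o sup_conv m).
  by apply/measurable_EFinP; apply: measurable_funTS; case: (sup_conv_bm m).
have mw : measurable_fun (@angles R) (EFin \o w).
  by apply/measurable_EFinP; apply: measurable_funTS; case: bw.
have iM : (@lebesgue_measure R).-integrable (@angles R) (EFin \o (fun=> M)).
  by apply: bm_integrable; exact: bm_cst.
have [||_ _] := @dominated_convergence _ _ _ (@lebesgue_measure R) _
  (@measurable_angles R) (fun m => EFin \o sup_conv m) (EFin \o w) (EFin \o (fun=> M)) mg mw _ iM.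
- by apply: aeW => t _; apply: cvg_EFin; [exact: nearW | exact: sup_conv_cvg].
- apply: aeW => t m _ /=; rewrite lee_fin ger0_norm ?sup_conv_le_bound //.
  exact: le_trans (w0 t) (sup_conv_ge_self m t).
have E f : bounded_measurable f ->
    (\int[@lebesgue_measure R]_(t in @angles R) (f t)%:E)%E = (2 * pi * aver f)%:E.
  move=> bf; rewrite EFinM -integral_aver // muleA -EFinM divff ?mul1e // gt_eqF //.
rewrite (E w bw) (_ : [sequence _]_n = (fun m => (2 * pi * aver (sup_conv m))%:E)); last first.
  by apply/funext => m /=; rewrite -E //; exact: sup_conv_bm.
move=> /fine_cvgP[_ /cvgrPdist_lt h].
have [N _ hN] := h (2 * pi * e) ltac:(by rewrite mulr_gt0).
exists N; have := hN N (leqnn _); rewrite /= -mulrBr normrM gtr0_norm // ltr_pM2l //.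
by rewrite ltr_norml; lra.
Qed.

End SupConvolution.

(** * The mean value inequality on every circle *)

Section SubharmonicCircle.
Context (R : realType).
Variables (Omega : set R[i]) (u : R[i] -> R).
Hypothesis u0 : forall z, Omega z -> 0 <= u z.
Hypothesis uscu : usc_on Omega (fun z => (u z)%:E).
Hypothesis subu : forall z, Omega z -> local_submean u z.

(** On the circle [u] lies below a Lipschitz majorant [g] of nearly the same average, and [g] is
    within [e] of a harmonic polynomial [h]. The maximum principle for [u - Re h] yields
    [u z0 <= Re (h z0) + e], where [Re (h z0)] is the average of [g]. *)
Lemma submean_circle (z0 : R[i]) (r : R) : 0 < r -> closed_disc z0 r `<=` Omega ->
  u z0 <= aver (fun t => u (circle z0 r t)).
Proof.
move=> r0 KO; apply/ler_addgt0Pr => e3 e30; pose e := e3 / 3.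
have e0 : 0 < e by rewrite divr_gt0.
pose w t := u (circle z0 r t).
have bu z s : 0 < s -> closed_disc z s `<=` Omega ->
    bounded_measurable (fun t => u (circle z s t)).
  by move=> s0 KsO; exact: (usc_circle_bm (u := u) uscu KsO s0 u0).
have bw : bounded_measurable w by exact: bu.
have cO t : Omega (circle z0 r t) by exact/KO/circle_closed_disc.
have [M hM] := usc_bounded uscu KO.
have wM t : w t <= M by apply: hM; exact: circle_closed_disc.
have w0 t : 0 <= w t by exact: u0.
have wusc t a : w t < a ->
    exists2 d : R, 0 < d & forall s, rnorm (expi s - expi t) < d -> w s < a.
  move=> wa; have /usc_onP h := uscu; have [d d0 hd] := h _ _ (cO t) wa.
  exists (d / r); first by rewrite divr_gt0.
  move=> s; rewrite ltr_pdivlMr // => st; apply: hd => //.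
  rewrite (_ : _ - _ = r%:C * (expi s - expi t)); last by rewrite /circle; ring.
  by rewrite rnormM rnorm_real gtr0_norm // mulrC.
have [m hm] := sup_conv_aver w0 wM wusc bw e0.
pose g := sup_conv w m.
have bg : bounded_measurable g by exact: sup_conv_bm w0 wM m.
have cg : cbm (fun t => (g t)%:C) by exact: cbm_real.
have M0 : 0 <= M by exact: le_trans (w0 0) (wM 0).
have gM t : rnorm (g t)%:C <= M.
  rewrite rnorm_real ger0_norm ?(sup_conv_le_bound wM) //.
  exact: le_trans (w0 t) (sup_conv_ge_self wM m t).
pose d := Num.min 1 (e / 2 / (m%:R + 1)).
have m1 : 0 < m%:R + 1 :> R by rewrite ltr_wpDl.
have d0 : 0 < d by rewrite lt_min ltr01 !divr_gt0.
have d1 : d <= 1 by rewrite ge_min lexx.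
have dm : m%:R * d <= e / 2.
  have : d * (m%:R + 1) <= e / 2 by rewrite -ler_pdivlMr // ge_min lexx orbT.
  by rewrite mulrDr mulr1 mulrC; lra.
have e20 : 0 < e / 2 by rewrite divr_gt0.
have [n hn] := @trig_error_small R d (e / 2 / (2 * M + 1)) d0 d1
  ltac:(by rewrite !divr_gt0 // ltr_wpDl // mulr_ge0).
pose h z := \sum_(j < (2 * n).+1)
  (kappa R n j)%:C * fourier n j (fun t => (g t)%:C) * hext z0 r n j z.
have hg t : rnorm (h (circle z0 r t) - (g t)%:C) <= e.
  have -> : h (circle z0 r t) = \sum_(j < (2 * n).+1)
      (kappa R n j)%:C * fourier n j (fun t => (g t)%:C) * trig n j t.
    by apply: eq_bigr => j _; rewrite hext_circle.
  apply: le_trans (trig_approx n cg (ltW d0) d1 (ltW e20) gM _) _.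
    move=> s st; rewrite -realcB rnorm_real.
    apply: le_trans (sup_conv_norm_lip wM m s t) _; apply: le_trans dm.
    by rewrite ler_wpM2l.
  move: hn; rewrite ltr_pdivlMr; last by rewrite ltr_wpDl // mulr_ge0.
  set B := _ * _ ^+ n.
  have B0 : 0 <= B.
    rewrite mulr_ge0 // exprn_ge0 //.
    by have : d ^+ 2 <= 1 by [apply: exprn_ile1 => //; exact: ltW]; lra.
  by lra.
(* At the centre only the frequency zero survives, and its coefficient in the kernel is one, so the
   equality is exact. *)
have hz0 : Re (h z0) = aver g.
  have nn : (n < (2 * n).+1)%N by rewrite ltnS mul2n -addnn leq_addl.
  rewrite /h (bigD1 (Ordinal nn)) //= big1 => [|j jn]; last first.
    by rewrite hext_center (_ : (j == n :> nat) = false) ?mulr0 //; apply/negbTE.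
  rewrite addr0 hext_center eqxx mulr1 kappa_diag mul1r /fourier.
  rewrite (@caver_ext _ _ (fun s => (g s)%:C)) ?caver_real // => s.
  by rewrite /trig -exprMn expi_conj expr1n conjc1 mulr1.
have hmean z s : cbm (fun t => h (circle z s t)) /\ caver (fun t => h (circle z s t)) = h z.
  have hj (j : 'I_(2 * n).+1) := hext_mean z0 r n j z s.
  have cj (j : 'I_(2 * n).+1) : cbm (fun t =>
      (kappa R n j)%:C * fourier n j (fun t => (g t)%:C) * hext z0 r n j (circle z s t)).
    by apply: cbmZ; case: (hj j).
  split; first exact: cbm_sum.
  by rewrite caver_sum //; apply: eq_bigr => j _; case: (hj j) => h1 h2; rewrite caverZ // h2.
have hcont : ccont h.
  by apply: ccont_sum => j; apply: ccontM; [exact: ccont_cst | exact: hext_cont].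
have Rmean z s : bounded_measurable (fun t => Re (h (circle z s t))) /\
    aver (fun t => Re (h (circle z s t))) = Re (h z).
  by have [[h1 _] h2] := hmean z s; split=> //; rewrite -Re_caver h2.
have key : u z0 - Re (h z0) <= e.
  apply: (@max_principle R Omega (fun z => u z - Re (h z)) z0 r e r0 KO).
  - apply/usc_onP => z a Oz ua; have /usc_onP hu := uscu.
    pose k := (a - (u z - Re (h z))) / 3.
    have k0 : 0 < k by rewrite divr_gt0 // subr_gt0.
    have [d1' d10 h1] := hu z (u z + k) Oz ltac:(by rewrite ltrDl).
    have [d2' d20 h2] := hcont z k k0.
    exists (Num.min d1' d2'); first by rewrite lt_min d10.
    move=> y; rewrite lt_min => /andP[/h1 y1 /h2 y2] Oy.
    have := y1 Oy; have := le_trans (normRe_le _) y2.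
    by rewrite ler_norml ReB /k => /andP[]; lra.
  - move=> z zr.
    have Oz : Omega z by apply/KO/closed_discE; exact: ltW.
    move=> e' e'0; have [d' d'0 hd] := subu Oz e'0.
    exists (Num.min d' (r - rnorm (z - z0))); first by rewrite lt_min d'0 subr_gt0.
    move=> s s0; rewrite lt_min => /andP[sd sr].
    have KsO : closed_disc z s `<=` Omega.
      move=> y /closed_discE ys; apply/KO/closed_discE.
      by have := rdist_tri y z z0; lra.
    have [b1 a1] := Rmean z s.
    by rewrite averB //; [rewrite a1; have := hd s s0 sd; lra | exact: bu].
  - move=> z s s0 KsO; apply: bmB; first exact: bu.
    by case: (Rmean z s).
  move=> z zr; have [t ->] := polar_circle r0 zr.
  have := le_trans (normRe_le _) (hg t); rewrite ReB /= ler_norml => /andP[h1 _].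
  by have := sup_conv_ge_self wM m t; rewrite -/g /w; lra.
move: key hm; rewrite hz0 -/g -/w /e; lra.
Qed.

End SubharmonicCircle.

(** * Curvature along holomorphic maps *)

Section HolomorphicProducts.
Context (R : realType).

Lemma holomorphic_atM (f g : R[i] -> R[i]) z :
  holomorphic_at f z -> holomorphic_at g z -> holomorphic_at (fun y => f y * g y) z.
Proof.
move=> hf hg; have [f' hf'] := hf; have [g' hg'] := hg.
exists (f' * g z + f z * g') => e e0.
pose a := rnorm (f z); pose b := rnorm (g z); pose c := rnorm f'.
have a0 : 0 <= a by exact: rnorm_ge0.
have b0 : 0 <= b by exact: rnorm_ge0.
have c0 : 0 <= c by exact: rnorm_ge0.
pose k := e / (a + b + c + 1).
have s0 : 0 < a + b + c + 1 by rewrite ltr_wpDl // !addr_ge0.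
have k0 : 0 < k by rewrite divr_gt0.
have kE : k * (a + b + c + 1) = e by rewrite divfK // gt_eqF.
have [d1 d10 h1] := hf' _ k0; have [d2 d20 h2] := hg' _ k0.
have [d3 d30 h3] := hf' 1 ltr01.
have [d4 d40 h4] := holomorphic_at_continuous hg k0.
exists (Num.min (Num.min d1 d2) (Num.min d3 d4)); first by rewrite !lt_min d10 d20 d30.
move=> y; rewrite !lt_min => /andP[/andP[/h1 y1 /h2 y2] /andP[/h3 y3 /h4 y4]].
have -> : f y * g y - f z * g z - (y - z) * (f' * g z + f z * g') =
  (f y - f z - (y - z) * f') * g z + f z * (g y - g z - (y - z) * g')
  + (f y - f z) * (g y - g z) by ring.
have y5 : rnorm (f y - f z) <= (1 + c) * rnorm (y - z).
  have := rnormD (f y - f z - (y - z) * f') ((y - z) * f'); rewrite subrK rnormM -/c.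
  by lra.
apply: le_trans (rnormD _ _) _; apply: le_trans (lerD (rnormD _ _) (lexx _)) _.
rewrite (rnormM _ (g z)) (rnormM (f z)) (rnormM (f y - f z)) -/a -/b.
have x0 := rnorm_ge0 (y - z).
have g1 := ler_wpM2r b0 y1; have g2 := ler_wpM2l a0 y2.
have g3 := ler_pM (rnorm_ge0 _) (rnorm_ge0 _) y5 y4.
rewrite -kE; lra.
Qed.

Lemma holomorphic_at_affine (a b z : R[i]) : holomorphic_at (fun y => (y - a) * b) z.
Proof.
exists b => e e0; exists 1 => // y _.
rewrite (_ : _ - _ - _ = 0) ?rnorm0 ?mulr_ge0 ?rnorm_ge0 ?(ltW e0) //; ring.
Qed.

Lemma holomorphic_atX (f : R[i] -> R[i]) n z :
  holomorphic_at f z -> holomorphic_at (fun y => f y ^+ n) z.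
Proof.
move=> hf; elim: n => [|n IH].
  exists 0 => e e0; exists 1 => // y _.
  by rewrite mulr0 subr0 subrr rnorm0 mulr_ge0 ?rnorm_ge0 ?(ltW e0).
by have := holomorphic_atM hf IH; congr holomorphic_at; apply/funext => y; rewrite exprS.
Qed.

End HolomorphicProducts.

(** * Second order expansions and continuity of vector-valued maps *)

Section Taylor.
Context (R : realType) (V : completeNormedModType R[i]).
Variable dot : {dot V for (@conjc R)}.
Hypothesis hV : hilbert_norm dot.
Let dp := dot_psd hV.
Implicit Types (phi : R[i] -> V) (z : R[i]).

(** All that is needed of a polynomial map: the error is cubic, hence negligible against [s^2].
    Confining [y] to the unit disc around [z] makes the property stable under multiplication by
    affine functions. *)
Definition taylor2 phi z : Prop := exists v w x (C : R), 0 <= C /\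
  forall y, rnorm (y - z) <= 1 ->
    rnorm (phi y - (v + (y - z) *: w + (y - z) ^+ 2 *: x)) <= C * rnorm (y - z) ^+ 3.

Lemma taylor2_cst a z : taylor2 (fun=> a) z.
Proof.
exists a, 0, 0, 0; split=> // y _.
by rewrite !scaler0 !addr0 subrr rnorm0 mul0r.
Qed.

Lemma taylor2D phi psi z : taylor2 phi z -> taylor2 psi z ->
  taylor2 (fun y => phi y + psi y) z.
Proof.
move=> [v [w [x [C [C0 h]]]]] [v' [w' [x' [C' [C'0 h']]]]].
exists (v + v'), (w + w'), (x + x'), (C + C'); split=> [|y yz]; first exact: addr_ge0.
have -> : phi y + psi y - (v + v' + (y - z) *: (w + w') + (y - z) ^+ 2 *: (x + x')) =
  (phi y - (v + (y - z) *: w + (y - z) ^+ 2 *: x)) +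
  (psi y - (v' + (y - z) *: w' + (y - z) ^+ 2 *: x')).
  (* Tested against an arbitrary [q], the vector identity becomes one between scalars, within reach
     of [ring]. *)
  apply: (dot_inj hV) => q.
  rewrite ?(formDl dp, formZl dp, formBl dp, formNl dp); ring.
by rewrite mulrDl (le_trans (rnormD _ _)) // lerD ?h ?h'.
Qed.

Lemma taylor2_sum (I : Type) (s : seq I) (F : I -> R[i] -> V) z :
  (forall i, taylor2 (F i) z) -> taylor2 (fun y => \sum_(i <- s) F i y) z.
Proof.
move=> tF; elim: s => [|i s IH].
  by have := taylor2_cst 0 z; congr taylor2; apply/funext => y; rewrite big_nil.
by have := taylor2D (tF i) IH; congr taylor2; apply/funext => y; rewrite big_cons.
Qed.

(** Written around [z], the factor is [k + (y - z) b]. The product creates one new cubic term,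
    [(y - z)^3 b x], and multiplies the old remainder by at most [|k| + |b|]. *)
Lemma taylor2_mul_affine phi z (a b : R[i]) : taylor2 phi z ->
  taylor2 (fun y => ((y - a) * b) *: phi y) z.
Proof.
move=> [v [w [x [C [C0 h]]]]]; pose k := (z - a) * b.
exists (k *: v), (k *: w + b *: v), (k *: x + b *: w),
  (rnorm b * rnorm x + (rnorm k + rnorm b) * C); split=> [|y yz].
  by rewrite addr_ge0 // mulr_ge0 ?addr_ge0 ?rnorm_ge0.
pose T := phi y - (v + (y - z) *: w + (y - z) ^+ 2 *: x).
have -> : ((y - a) * b) *: phi y
    - (k *: v + (y - z) *: (k *: w + b *: v) + (y - z) ^+ 2 *: (k *: x + b *: w)) =
  ((y - z) ^+ 3 * b) *: x + (k + (y - z) * b) *: T.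
  apply: (dot_inj hV) => q; rewrite /T.
  rewrite ?(formDl dp, formZl dp, formBl dp, formNl dp) /k; ring.
have hT := h y yz; rewrite -/T in hT.
apply: le_trans (rnormD _ _) _; rewrite (rnormZ (_ * b)) (rnormZ (k + _)) (rnormM _ b) rnormX.
have n0 := rnorm_ge0 (y - z).
have g1 : rnorm (k + (y - z) * b) <= rnorm k + rnorm b.
  rewrite (le_trans (rnormD _ _)) // lerD2l rnormM.
  by rewrite ler_piMl // rnorm_ge0.
have g2 := ler_pM (rnorm_ge0 _) (rnorm_ge0 _) g1 hT.
lra.
Qed.

Lemma taylor2_pow (a b : R[i]) n (v : V) z : taylor2 (fun y => ((y - a) * b) ^+ n *: v) z.
Proof.
elim: n => [|n IH].
  by have := taylor2_cst v z; congr taylor2; apply/funext => y; rewrite expr0 scale1r.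
have := taylor2_mul_affine a b IH; congr taylor2; apply/funext => y.
by rewrite scalerA exprS.
Qed.

Definition vcont phi (Omega : set R[i]) : Prop := forall z (e : R), Omega z -> 0 < e ->
  exists2 d : R, 0 < d & forall y, rnorm (y - z) < d -> rnorm (phi y - phi z) <= e.

Lemma taylor2_value phi z v w x C :
  (forall y, rnorm (y - z) <= 1 ->
    rnorm (phi y - (v + (y - z) *: w + (y - z) ^+ 2 *: x)) <= C * rnorm (y - z) ^+ 3) ->
  phi z = v.
Proof.
move=> h; have := h z; rewrite subrr rnorm0 !expr0n /= !scale0r !addr0 mulr0 => /(_ ler01) h1.
apply/eqP; rewrite -subr_eq0; apply/eqP/rnorm_eq0/eqP.
by rewrite eq_le h1 rnorm_ge0.
Qed.

Lemma taylor2_vcont phi Omega : (forall z, taylor2 phi z) -> vcont phi Omega.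
Proof.
move=> tp z e _ e0; have [v [w [x [C [C0 h]]]]] := tp z.
have vE := taylor2_value h.
pose K := rnorm w + rnorm x + C.
have K0 : 0 <= K by rewrite !addr_ge0 ?rnorm_ge0.
have K1 : 0 < K + 1 by rewrite ltr_wpDl.
exists (Num.min 1 (e / (K + 1))); first by rewrite lt_min ltr01 divr_gt0.
move=> y; rewrite lt_min ltr_pdivlMr // => /andP[y1 ye].
pose T := phi y - (v + (y - z) *: w + (y - z) ^+ 2 *: x).
have hT : rnorm T <= C * rnorm (y - z) ^+ 3 := h y (ltW y1).
have -> : phi y - phi z = T + ((y - z) *: w + (y - z) ^+ 2 *: x).
  by rewrite /T vE -[v + _ + _]addrA opprD [phi y + (_ - _)]addrA subrK.
apply: le_trans (rnormD _ _) _; apply: le_trans (lerD hT (rnormD _ _)) _.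
rewrite (rnormZ _ w) (rnormZ _ x) rnormX; move: (rnorm (y - z)) (rnorm_ge0 (y - z)) y1 ye => s s0 s1 se.
have s2 : s ^+ 2 <= s by rewrite expr2 ler_piMl // ltW.
have s3 : s ^+ 3 <= s by rewrite exprS ler_piMr // (le_trans s2) // ltW.
have := ler_wpM2l C0 s3; have := ler_wpM2r (rnorm_ge0 x) s2.
move: se; rewrite /K; lra.
Qed.

Lemma holomorphic_vcont phi Omega : holomorphic_on Omega phi -> vcont phi Omega.
Proof.
move=> hphi z e Oz e0; have /derivable_rnorm[w hw] := hphi z Oz.
have [d d0 hd] := hw 1 ltr01.
have K1 : 0 < 1 + rnorm w by rewrite ltr_pwDl // rnorm_ge0.
exists (Num.min d (e / (1 + rnorm w))); first by rewrite lt_min d0 divr_gt0.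
move=> y; rewrite lt_min ltr_pdivlMr // => /andP[yd ye].
have := rnormD (phi y - phi z - (y - z) *: w) ((y - z) *: w); rewrite subrK rnormZ.
by have := hd y yd; lra.
Qed.

(** Heine-Cantor. Only [z] is confined to the piece [A] while [y] ranges over the whole disc, which
    makes the property stable under unions. *)
Lemma vcont_unif phi Omega z0 (r e : R) : vcont phi Omega ->
  closed_disc z0 r `<=` Omega -> 0 < e ->
  exists2 d : R, 0 < d & forall y z, closed_disc z0 r y -> closed_disc z0 r z ->
    rnorm (y - z) < d -> rnorm (phi y - phi z) <= e.
Proof.
move=> cp KO e0.
pose Q (A : set R[i]) := exists2 d : R, 0 < d & forall y z, closed_disc z0 r y -> A z ->
    rnorm (y - z) < d -> rnorm (phi y - phi z) <= e.
have [||A B|z Kz|d d0 hd] := @closed_disc_ind _ z0 r Q.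
- by move=> A B AB [d d0 hd]; exists d => // y z Ky /AB; exact: hd.
- by exists 1.
- move=> [d1 d10 hd1] [d2 d20 hd2]; exists (Num.min d1 d2); first by rewrite lt_min d10.
  by move=> y z Ky [Az|Bz]; rewrite lt_min => /andP[h1 h2]; [exact: hd1 h1 | exact: hd2 h2].
- have [d d0 hd] := cp z (e / 2) (KO _ Kz) ltac:(by rewrite divr_gt0).
  exists (d / 2); first by rewrite divr_gt0.
  exists (d / 2) => [|y x Ky [_ xz] yx]; first by rewrite divr_gt0.
  have h1 := hd x ltac:(lra).
  have h2 := hd y ltac:(have := rdist_tri y x z; lra).
  by have := rdist_tri (phi y) (phi z) (phi x); rewrite (rdistC (phi z)); lra.
by exists d.
Qed.

Lemma vcont_bounded phi Omega z0 (r : R) : vcont phi Omega ->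
  closed_disc z0 r `<=` Omega ->
  exists2 L : R, 0 <= L & forall z, closed_disc z0 r z -> rnorm (phi z) <= L.
Proof.
move=> cp KO.
pose Q (A : set R[i]) := exists2 L : R, 0 <= L & forall z, A z -> rnorm (phi z) <= L.
apply: (@closed_disc_ind _ z0 r Q).
- by move=> A B AB [L L0 hL]; exists L => // z /AB; exact: hL.
- by exists 0.
- move=> A B [L L0 hL] [L' L'0 hL']; exists (L + L'); first exact: addr_ge0.
  by move=> z [/hL|/hL'] h; lra.
move=> z Kz; have [d d0 hd] := cp z 1 (KO _ Kz) ltr01.
exists d => //; exists (1 + rnorm (phi z)) => [|y [_ /hd h]].
  by rewrite addr_ge0 // rnorm_ge0.
by have := rnormD (phi y - phi z) (phi z); rewrite subrK; lra.
Qed.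

Lemma holomorphic_at_dot phi Omega z (w : V) : holomorphic_on Omega phi -> Omega z ->
  holomorphic_at (fun y => dot (phi y) w) z.
Proof.
move=> hphi Oz; have /derivable_rnorm[p hp] := hphi z Oz.
exists (dot p w) => e e0; have w1 : 0 < rnorm w + 1 by rewrite ltr_wpDl // rnorm_ge0.
have [d d0 hd] := hp (e / (rnorm w + 1)) ltac:(by rewrite divr_gt0).
exists d => // y /hd h; rewrite -(formZl dp) -!(formBl dp).
apply: le_trans (rnorm_dot_le hV _ _) _.
apply: le_trans (ler_wpM2r (rnorm_ge0 w) h) _.
rewrite mulrAC ler_wpM2r ?rnorm_ge0 // -mulrA ger_pMr // mulrC ler_pdivrMr // mul1r lerDl.
exact: ler01.
Qed.

Lemma cbm_dot phi Omega z0 (r : R) (w : V) : 0 < r -> vcont phi Omega ->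
  closed_disc z0 r `<=` Omega -> cbm (fun t => dot (phi (circle z0 r t)) w).
Proof.
move=> r0 cp KO; have [L L0 hL] := vcont_bounded cp KO.
have cO t : Omega (circle z0 r t) by exact/KO/circle_closed_disc.
have dL t : rnorm (dot (phi (circle z0 r t)) w) <= L * rnorm w.
  rewrite (le_trans (rnorm_dot_le hV _ _)) // ler_wpM2r ?rnorm_ge0 // hL //.
  exact: circle_closed_disc.
have cont (p : R[i] -> R) : (forall z, `|p z| <= rnorm z) ->
    (forall z y, p (z - y) = p z - p y) ->
    continuous (fun t => p (dot (phi (circle z0 r t)) w)).
  move=> pn pB t; apply/cvgrPdist_lt => e e0.
  have w1 : 0 < rnorm w + 1 by rewrite ltr_wpDl // rnorm_ge0.
  have [d d0 hd] := cp _ (e / 2 / (rnorm w + 1)) (cO t) ltac:(by rewrite !divr_gt0).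
  have := circle_near z0 r t d0; apply: filterS => s /hd h.
  rewrite distrC -pB -(formBl dp) (le_lt_trans (pn _)) //.
  apply: le_lt_trans (rnorm_dot_le hV _ _) _.
  move: h; rewrite ler_pdivlMr // => h.
  by have := rnorm_ge0 (phi (circle z0 r s) - phi (circle z0 r t)); lra.
split; apply: (bm_continuous (M := L * rnorm w)) => [|t].
- exact: cont (@normRe_le R) (@ReB R).
- exact: le_trans (normRe_le _) (dL t).
- exact: cont (@normIm_le R) (@ImB R).
- exact: le_trans (normIm_le _) (dL t).
Qed.

End Taylor.

Section PolynomialApproximation.
Context (R : realType) (V : completeNormedModType R[i]).
Variable dot : {dot V for (@conjc R)}.
Hypothesis hV : hilbert_norm dot.
Let dp := dot_psd hV.

(* On the circle the Fourier coefficients of negative index of [phi] vanish, by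
   the mean value property of [(z - z0)^k phi]; hence the trigonometric
   approximation is a polynomial in [z - z0]. *)
Lemma holomorphic_approx (phi : R[i] -> V) (Omega : set R[i]) (z0 : R[i]) (r e : R) :
  open Omega -> holomorphic_on Omega phi -> 0 < r -> closed_disc z0 r `<=` Omega -> 0 < e ->
  exists psi, [/\ forall z, taylor2 psi z, psi z0 = phi z0 &
    forall t, rnorm (psi (circle z0 r t) - phi (circle z0 r t)) <= e].
Proof.
move=> oO hphi r0 KO e0; have cphi := holomorphic_vcont hphi.
have [L L0 hL] := vcont_bounded cphi KO.
have bphi t : rnorm (phi (circle z0 r t)) <= L by apply/hL/circle_closed_disc.
have cF w := cbm_dot hV w r0 cphi KO.
have e20 : 0 < e / 2 by rewrite divr_gt0.
have [d' d'0 hd'] := vcont_unif cphi KO e20.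
pose d := Num.min 1 (d' / (2 * r)).
have d0 : 0 < d by rewrite lt_min ltr01 divr_gt0 // mulr_gt0.
have d1 : d <= 1 by rewrite ge_min lexx.
have [n hn] := @trig_error_small R d (e / 2 / (2 * L + 1)) d0 d1
  ltac:(by rewrite !divr_gt0 // ltr_wpDl // mulr_ge0).
(* Vector-valued Fourier coefficients of [phi], obtained weakly by Riesz representation. *)
have ax j : exists a : V, forall w, dot a w =
    fourier n j (fun t => dot (phi (circle z0 r t)) w).
  have c1 w : cbm (fun s => dot (phi (circle z0 r s)) w * conjc (trig n j s)).
    by apply: cbmM => //; apply: cbm_conj; exact: cbm_trig.
  apply: (lax_milgram (m := 1) (M := 1) (K := L) dp) => // [u v|v|k u v|v].
  - by rewrite mul1r rnorm_dot_le.
  - by rewrite mul1r quad_dot.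
  - rewrite /fourier -caverZ // -caverD //; last exact: cbmZ.
    by apply: caver_ext => s; rewrite (formDr dp) (formZr dp); ring.
  apply: rnorm_caver_le => // s; rewrite rnormM rnorm_conj /trig rnormM !rnormX rnorm_conj.
  rewrite rnorm_expi !expr1n !mulr1 (le_trans (rnorm_dot_le hV _ _)) //.
  by rewrite ler_wpM2r ?rnorm_ge0.
have [a ha] := choice ax.
(* Here the coefficient is the average of the holomorphic function
   [<phi, w> ((z - z0) / r)^(n - j)], hence its value at [z0]. Index [n] is the frequency zero and
   carries [phi z0]. *)
have aE j : (j <= n)%N -> a j = (j == n)%:R *: phi z0.
  move=> jn; apply: (dot_inj hV) => w; rewrite ha (formZl dp).
  pose f z := dot (phi z) w * ((z - z0) * r%:C^-1) ^+ (n - j).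
  have <- : f z0 = (j == n)%:R * dot (phi z0) w.
    rewrite /f subrr mul0r expr0n subn_eq0 mulrC; congr (_%:R * _).
    by rewrite eqn_leq jn.
  rewrite -(circle_mean_value r0 oO KO (f := f)).
    apply: caver_ext => t; rewrite /f circleB (_ : _ / _ = expi t); last first.
      by rewrite mulrAC divff ?mul1r //; apply/eqP => -[]; apply/eqP; rewrite gt_eqF.
    rewrite /trig conjcM !conjcX conjcK; congr (_ * _).
    by rewrite -{1}(subnKC jn) exprD mulrA -exprMn (mulrC (conjc _)) expi_conj expr1n mul1r.
  move=> z Oz; apply: holomorphic_atM; first exact: (holomorphic_at_dot hV w hphi Oz).
  by apply: holomorphic_atX; exact: holomorphic_at_affine.
pose psi z := \sum_(j < (2 * n).+1) ((kappa R n j)%:C * hext z0 r n j z) *: a j.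
exists psi; split.
- move=> z; apply: (taylor2_sum hV) => j; case: (leqP n j) => nj; last first.
    rewrite (aE _ (ltnW nj)) (_ : (j == n :> nat) = false); last first.
      by apply/negbTE; rewrite neq_ltn nj.
    have := @taylor2_cst _ V 0 z; congr taylor2; apply/funext => y.
    by rewrite scale0r scaler0.
  have := taylor2_pow hV z0 r%:C^-1 (j - n) ((kappa R n j)%:C *: a j) z.
  congr taylor2; apply/funext => y; rewrite /hext nj scalerA mulrC //.
- have nn : (n < (2 * n).+1)%N by rewrite ltnS mul2n -addnn leq_addl.
  rewrite /psi (bigD1 (Ordinal nn)) //= big1 => [|j jn]; last first.
    rewrite hext_center (_ : (j == n :> nat) = false) ?mulr0 ?scale0r //.
    exact/negbTE.
  by rewrite addr0 hext_center eqxx mulr1 kappa_diag scale1r aE // eqxx scale1r.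
(* The error vector is tested against itself: [|D|^2] is the scalar approximation error of
   [<phi, D>] at [t], and all its bounds contain a factor [|D|] that cancels. *)
move=> t; set D := _ - _.
have [D0|D0] := eqVneq (rnorm D) 0; first by rewrite D0 ltW.
have {}D0 : 0 < rnorm D by rewrite lt_neqAle rnorm_ge0 andbT eq_sym.
rewrite -(ler_pM2r D0) -expr2 -(quad_dot hV) /quad.
apply: le_trans (Re_le _) _.
pose F s := dot (phi (circle z0 r s)) D.
have -> : dot D D = \sum_(j < (2 * n).+1) (kappa R n j)%:C * fourier n j F * trig n j t - F t.
  rewrite {1}/D (formBl dp); congr (_ - _); rewrite /psi.
  have dsum (s : seq 'I_(2 * n).+1) (G : 'I_(2 * n).+1 -> V) :
      dot (\sum_(i <- s) G i) D = \sum_(i <- s) dot (G i) D.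
    by elim/big_rec2: _ => [|i y x _ <-]; rewrite ?(form0l dp) ?(formDl dp).
  rewrite dsum; apply: eq_bigr => j _.
  by rewrite (formZl dp) ha hext_circle // mulrAC.
have hF s : rnorm (F s) <= L * rnorm D.
  by rewrite (le_trans (rnorm_dot_le hV _ _)) // ler_wpM2r ?rnorm_ge0.
apply: le_trans (trig_approx n (cF D) (ltW d0) d1 (e := e / 2 * rnorm D) _ hF _) _.
- by rewrite mulr_ge0 ?rnorm_ge0 // ltW.
- move=> s st; rewrite /F -(formBl dp) (le_trans (rnorm_dot_le hV _ _)) //.
  rewrite ler_wpM2r ?rnorm_ge0 // hd' //; try exact: circle_closed_disc.
  rewrite (_ : circle z0 r s - circle z0 r t = r%:C * (expi s - expi t)); last by rewrite /circle; ring.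
  rewrite rnormM rnorm_real gtr0_norm // mulrC.
  have : d * (2 * r) <= d' by rewrite -ler_pdivlMr ?mulr_gt0 // ge_min lexx orbT.
  have := ler_wpM2r (ltW r0) st; have : 0 < d * r by rewrite mulr_gt0.
  by lra.
move: hn; rewrite ltr_pdivlMr; last by rewrite ltr_wpDl // mulr_ge0.
set B := _ * _ ^+ n => hn.
have B0 : 0 <= B.
  rewrite mulr_ge0 // exprn_ge0 //.
  by have : d ^+ 2 <= 1 by [apply: exprn_ile1 => //; exact: ltW]; lra.
have := ler_wpM2r (ltW D0) (ltW hn); have := mulr_ge0 B0 (ltW D0); lra.
Qed.

End PolynomialApproximation.

(** * From affine to holomorphic maps *)

Section Curvature.
Context (R : realType) (V : completeNormedModType R[i]).
Variable dot : {dot V for (@conjc R)}.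
Hypothesis hV : hilbert_norm dot.
Variables (Omega : set R[i]) (P : R[i] -> V -> V).
Hypothesis hOmega : open Omega.
Hypothesis hP : forall z, Omega z -> End_ge0 dot (P z).
Hypothesis husc : weakly_usc dot Omega P.

Local Notation p := (pform dot P).
Let pp z (Oz : Omega z) := pform_psd hV hP Oz.

Lemma open_closed_disc z : Omega z -> exists2 d : R, 0 < d & closed_disc z d `<=` Omega.
Proof.
move=> Oz; have [d d0 hd] := open_rnorm hOmega Oz.
exists (d / 2); first by rewrite divr_gt0.
by move=> y /closed_discE yz; apply: hd; lra.
Qed.

Lemma quad_perturb z M v h : Omega z -> 0 <= M ->
  (forall w, quad (p z) w <= M * rnorm w ^+ 2) ->
  `|quad (p z) (v + h) - quad (p z) v| <= M * rnorm h * (rnorm h + 2 * rnorm v).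
Proof.
move=> Oz M0 hM; rewrite quadD; last exact: pp.
have b := psd_form_bounded (pp Oz) M0 hM v h.
have := le_trans (normRe_le _) b; have := form_ge0 (pp Oz) h; rewrite -/(quad (p z) h).
have := hM h; rewrite !ler_norml => h1 h2 /andP[h3 h4]; rewrite expr2 in h1.
have nh := rnorm_ge0 h.
have : 0 <= M * rnorm h * rnorm h by rewrite !mulr_ge0 // rnorm_ge0.
by move=> h5; apply/andP; split; lra.
Qed.

(** Weak semicontinuity applies to the vector frozen at [phi z]. Replacing it by [phi y] costs
    little, uniformly in [y], since the forms are uniformly bounded near [z]. *)
Lemma curve_usc (phi : R[i] -> V) : vcont phi Omega ->
  usc_on Omega (fun z => (quad (p z) (phi z))%:E).
Proof.
move=> cphi; apply/usc_onP => z a Oz ua.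
have [r r0 KO] := open_closed_disc Oz.
have [M M0 hM] := pform_bounded hV hP husc KO.
pose k := (a - quad (p z) (phi z)) / 2.
have k0 : 0 < k by rewrite divr_gt0 // subr_gt0.
have /usc_onP hu := @pform_usc _ _ _ _ _ husc (phi z).
have [d1 d10 h1] := hu z (quad (p z) (phi z) + k) Oz ltac:(by rewrite ltrDl).
pose C := M * (1 + 2 * rnorm (phi z)) + 1.
have n0 := rnorm_ge0 (phi z).
have C0 : 0 < C by rewrite ltr_wpDl // mulr_ge0 // addr_ge0 // mulr_ge0.
pose e := Num.min 1 (k / C); have e0 : 0 < e by rewrite lt_min ltr01 divr_gt0.
have eC : e * C <= k by rewrite -ler_pdivlMr // ge_min lexx orbT.
have e1 : e <= 1 by rewrite ge_min lexx.
have [d2 d20 h2] := cphi z e Oz e0.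
exists (Num.min (Num.min d1 d2) r); first by rewrite !lt_min d10 d20.
move=> y; rewrite !lt_min => /andP[/andP[/h1 y1 /h2 y2] yr] Oy.
have hMy := hM y ltac:(by apply/closed_discE; exact: ltW).
have := quad_perturb (phi z) (phi y - phi z) Oy M0 hMy.
rewrite (addrC (phi z)) subrK ler_norml => /andP[_].
set x := rnorm (phi y - phi z) in y2 *; have x0 : 0 <= x by exact: rnorm_ge0.
have g1 : M * x * (x + 2 * rnorm (phi z)) <= M * e * (1 + 2 * rnorm (phi z)).
  apply: ler_pM; rewrite ?mulr_ge0 ?addr_ge0 // ?mulr_ge0 //.
    by rewrite ler_wpM2l.
  by rewrite lerD2r (le_trans y2).
have := y1 Oy; move: eC; rewrite /C /k; lra.
Qed.

Hypothesis affine : forall (z0 : R[i]) (r : R), 0 < r -> closed_disc z0 r `<=` Omega ->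
  forall v w, quad (p z0) v <= aver (fun t => quad (p (circle z0 r t)) (v + om_dz t *: w)).

Lemma affine_submean (z0 : R[i]) (r : R) v w : 0 < r -> closed_disc z0 r `<=` Omega ->
  quad (p z0) v <=
  aver (fun t => quad (p (circle z0 r t)) (v + (circle z0 r t - z0) *: w)).
Proof.
move=> r0 KO; have := affine r0 KO v ((- 'i * r%:C) *: w).
move/le_trans; apply; rewrite le_eqVlt; apply/orP; left; apply/eqP.
apply: aver_ext => t; rewrite circleB scalerA (_ : om_dz t * _ = r%:C * expi t) //.
have aux (i x y : R[i]) : i * i = -1 -> i * x * (- i * y) = y * x.
  by move=> ii; transitivity (- (i * i) * (y * x)); [ring | rewrite ii opprK mul1r].
by apply: aux; rewrite -expr2 sqr_i.
Qed.

(* Upper semicontinuity bounds the oscillation from above, and the mean value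
   inequality for the constant map [y] bounds its average from below. *)
Lemma aver_quad_cvg z y (e : R) : Omega z -> 0 < e -> exists2 d : R, 0 < d &
  forall r, 0 < r -> r < d -> closed_disc z r `<=` Omega /\
    aver (fun t => `|quad (p (circle z r t)) y - quad (p z) y|) <= 2 * e.
Proof.
move=> Oz e0; have [d1 d10 h1] := open_rnorm hOmega Oz.
have /usc_onP hu := @pform_usc _ _ _ _ _ husc y.
have [d2 d20 h2] := hu z (quad (p z) y + e) Oz ltac:(by rewrite ltrDl).
exists (Num.min d1 d2); first by rewrite lt_min d10.
move=> r r0; rewrite lt_min => /andP[rd1 rd2].
have KO : closed_disc z r `<=` Omega.
  by move=> x /closed_discE xz; apply: h1; lra.
split=> //; have bq := bm_quad_pform hV hP husc r0 KO y.
pose D t := quad (p (circle z r t)) y - quad (p z) y.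
have bD : bounded_measurable D by apply: bmB => //; exact: bm_cst.
have aD : 0 <= aver D.
  rewrite averB ?aver_cst ?subr_ge0 //; last exact: bm_cst.
  have := affine r0 KO y 0; congr (_ <= _); apply: aver_ext => t.
  by rewrite scaler0 addr0.
have De t : D t <= e.
  rewrite lerBlDl ltW // h2 //; last exact/KO/circle_closed_disc.
  by rewrite rnorm_circle.
(* From [D <= e] follows [|D| <= 2 e - D], and the average of [D] is nonnegative. *)
apply: (@le_trans _ _ (aver (fun t => 2 * e - D t))).
  apply: le_aver; [exact: bm_norm | by apply: bmB => //; exact: bm_cst | move=> t].
  have := De t; rewrite -/(D t) ler_norml; lra.
by rewrite averB ?aver_cst //; [lra | exact: bm_cst].
Qed.

(** Polarisation expresses the coefficient by four diagonal values, each within [e] in mean and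
    weighted by [1 / 4]. *)
Lemma aver_form_cvg z v x (e : R) : Omega z -> 0 < e -> exists2 d : R, 0 < d &
  forall r, 0 < r -> r < d -> closed_disc z r `<=` Omega /\
    aver (fun t => rnorm (p (circle z r t) v x - p z v x)) <= e.
Proof.
move=> Oz e0; have e2 : 0 < e / 2 by rewrite divr_gt0.
have [d1 d10 h1] := aver_quad_cvg (v + x) Oz e2.
have [d2 d20 h2] := aver_quad_cvg (v - x) Oz e2.
have [d3 d30 h3] := aver_quad_cvg (v + 'i *: x) Oz e2.
have [d4 d40 h4] := aver_quad_cvg (v - 'i *: x) Oz e2.
exists (Num.min (Num.min d1 d2) (Num.min d3 d4)); first by rewrite !lt_min d10 d20 d30.
move=> r r0; rewrite !lt_min => /andP[/andP[r1 r2] /andP[r3 r4]].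
have [KO a1] := h1 r r0 r1; have [_ a2] := h2 r r0 r2.
have [_ a3] := h3 r r0 r3; have [_ a4] := h4 r r0 r4; split=> //.
pose D y t := `|quad (p (circle z r t)) y - quad (p z) y|.
have bD y : bounded_measurable (D y).
  apply: bm_norm; apply: bmB; last exact: bm_cst.
  exact: (bm_quad_pform hV hP husc r0 KO).
have bS := bmD (bmD (bD (v + x)) (bD (v - x))) (bmD (bD (v + 'i *: x)) (bD (v - 'i *: x))).
apply: (@le_trans _ _ (aver (fun t => 4^-1 * (D (v + x) t + D (v - x) t +
    (D (v + 'i *: x) t + D (v - 'i *: x) t))))).
  apply: le_aver; last 1 first.
  - move=> t; apply: le_trans (rnorm_le_ReIm _) _; rewrite ReB ImB.
    have Oc : Omega (circle z r t) by exact/KO/circle_closed_disc.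
    rewrite !(polar_Re (pp Oc)) !(polar_Im (pp Oc)) !(polar_Re (pp Oz)) !(polar_Im (pp Oz)).
    rewrite /D; set q1 := quad _ _; set q2 := quad _ _; set q3 := quad _ _; set q4 := quad _ _.
    set s1 := quad _ (v + 'i *: x); set s2 := quad _ (v - 'i *: x).
    set s3 := quad _ (v + 'i *: x); set s4 := quad _ (v - 'i *: x).
    have := ler_normB (q1 - q3) (q2 - q4); have := ler_normB (s1 - s3) (s2 - s4).
    have -> : 4^-1 * (q1 - q2) - 4^-1 * (q3 - q4) = 4^-1 * (q1 - q3 - (q2 - q4)) by ring.
    have -> : 4^-1 * (s1 - s2) - 4^-1 * (s3 - s4) = 4^-1 * (s1 - s3 - (s2 - s4)) by ring.
    rewrite !normrM ger0_norm ?invr_ge0 //; lra.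
  - apply: cbm_rnorm; apply: cbmD; first exact: (cbm_pform hV hP husc r0 KO).
    exact: cbm_cst.
  - exact: bmZ.
rewrite averZ // averD ?averD //; try exact: bmD.
by rewrite -/(D _ _) in a1 a2 a3 a4; move: a1 a2 a3 a4; rewrite /D; lra.
Qed.

Lemma curve_bm (phi : R[i] -> V) z (r : R) : vcont phi Omega -> 0 < r ->
  closed_disc z r `<=` Omega ->
  bounded_measurable (fun t => quad (p (circle z r t)) (phi (circle z r t))).
Proof.
move=> cphi r0 KO.
apply: (usc_circle_bm (u := fun z => quad (p z) (phi z)) (curve_usc cphi) KO r0).
by move=> y Oy; exact: form_ge0 (pp Oy) _.
Qed.

(* With [phi = v + (y - z) w + (y - z)^2 x + O(s^3)] on the circle of radius [s],
   the affine part obeys the mean value inequality, and the only other term of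
   order [s^2] is the average of [2 s^2 Re (e^{-2it} <P v, x>)]. It is [o(s^2)]
   because [<P v, x>] converges in mean to a constant. *)
Lemma curve_local_submean (phi : R[i] -> V) z : Omega z -> (forall y, taylor2 phi y) ->
  local_submean (fun y => quad (p y) (phi y)) z.
Proof.
move=> Oz tphi e e0; have cphi := taylor2_vcont (Omega := Omega) tphi.
have [v [w [x [C [C0 hC]]]]] := tphi z.
have vE := taylor2_value hC.
have [r r0 KO] := open_closed_disc Oz.
have [M M0 hM] := pform_bounded hV hP husc KO.
(* Coefficient of [s^3] in the cross terms left over: [v] against the Taylor remainder, and the
   linear term against everything of higher order. The remaining term [quad h] is nonnegative and
   dropped. *)
pose N := M * (rnorm v * C + rnorm w * (rnorm x + C)).
have N0 : 0 <= N by rewrite mulr_ge0 // addr_ge0 // mulr_ge0 ?addr_ge0 ?rnorm_ge0.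
(* The deviation of [<P v, x>] and the cubic terms each enter with a factor [2], so a quarter of [e]
   is allotted to each. *)
have e4 : 0 < e / 4 by rewrite divr_gt0.
have [d1 d10 h1] := aver_form_cvg v x Oz e4.
pose d2 := e / (4 * (N + 1)).
have d20 : 0 < d2 by rewrite divr_gt0 // mulr_gt0 // ltr_wpDl.
exists (Num.min (Num.min d1 d2) (Num.min 1 r)); first by rewrite !lt_min d10 d20 ltr01.
move=> s s0; rewrite !lt_min => /andP[/andP[sd1 sd2] /andP[s1 sr]].
have [KsO a1] := h1 s s0 sd1.
have Ns : N * s <= e / 4.
  move: sd2; rewrite /d2 ltr_pdivlMr; last by rewrite mulr_gt0 // ltr_wpDl.
  by lra.
pose c t := circle z s t.
have cO t : Omega (c t) by exact/KsO/circle_closed_disc.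
have cz t : rnorm (c t - z) = s by exact: rnorm_circle.
have hMc t : forall y, quad (p (c t)) y <= M * rnorm y ^+ 2.
  by apply: hM; apply/closed_discE; rewrite cz ltW.
have bnd t u y : rnorm (p (c t) u y) <= M * rnorm u * rnorm y.
  exact: psd_form_bounded (pp (cO t)) M0 (hMc t) u y.
pose E t := conjc (expi t) ^+ 2 * (p (c t) v x - p z v x).
have cpf : cbm (fun t => p (c t) v x - p z v x).
  by apply: cbmD; [exact: (cbm_pform hV hP husc s0 KsO) | exact: cbm_cst].
have ce2 : cbm (fun t : R => conjc (expi t) ^+ 2).
  by apply: cbmX; apply: cbm_conj; exact: cbm_expi.
have cE : cbm E by exact: cbmM.
have aE : `|aver (fun t => Re (E t))| <= e / 4.
  rewrite -Re_caver (le_trans (normRe_le _)) // (le_trans (rnorm_caver cE)) //.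
  rewrite (le_trans _ a1) // le_eqVlt; apply/orP; left; apply/eqP; apply: aver_ext => t.
  by rewrite rnormM rnormX rnorm_conj rnorm_expi expr1n mul1r.
pose Z t := Re (conjc (expi t) ^+ 2 * p z v x).
have cZ : cbm (fun t : R => conjc (expi t) ^+ 2 * p z v x).
  by apply: cbmM => //; exact: cbm_cst.
(* With [<P v, x>] frozen at the centre only [e^{-2it}] varies, and it averages to zero. *)
have aZ : aver Z = 0.
  rewrite -Re_caver (@caver_ext _ _ (fun t => p z v x * conjc (expi t ^+ 2))) => [|t].
    rewrite caverZ; last by apply: cbm_conj; apply: cbmX; exact: cbm_expi.
    rewrite caver_conj; last by apply: cbmX; exact: cbm_expi.
    by rewrite caver_expiX // conjc0 mulr0.
  by rewrite conjcX mulrC.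
pose Q t := quad (p (c t)) (v + (c t - z) *: w).
have lowb t : Q t + 2 * s ^+ 2 * (Re (E t) + Z t) - 2 * N * s ^+ 3 <= quad (p (c t)) (phi (c t)).
  pose a := v + (c t - z) *: w.
  pose eta := phi (c t) - (a + (c t - z) ^+ 2 *: x).
  have heta : rnorm eta <= C * s ^+ 3.
    by have := hC (c t); rewrite cz; apply; exact: ltW.
  pose h := (c t - z) ^+ 2 *: x + eta.
  have phiE : phi (c t) = a + h by rewrite /h /eta addrA addrC subrK.
  have hh : rnorm h <= s ^+ 2 * (rnorm x + C).
    apply: le_trans (rnormD _ _) _; rewrite (rnormZ _ x) rnormX cz mulrDr lerD2l.
    apply: le_trans heta _; rewrite [leRHS]mulrC ler_wpM2l //.
    by rewrite exprS ler_piMl ?sqr_ge0 // ltW.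
  rewrite phiE (quadD (pp (cO t))) -/a -/(Q t).
  have := form_ge0 (pp (cO t)) h; rewrite -/(quad (p (c t)) h) => qh.
  have -> : Re (E t) + Z t = Re (conjc (expi t) ^+ 2 * p (c t) v x).
    by rewrite /Z -ReD /E -mulrDr subrK.
  have k1 : p (c t) a h = s%:C ^+ 2 * (conjc (expi t) ^+ 2 * p (c t) v x)
      + p (c t) v eta + p (c t) ((c t - z) *: w) h.
    rewrite {1}/a (formDl (pp (cO t))); congr (_ + _).
    rewrite /h (formDr (pp (cO t))) (formZr (pp (cO t))); congr (_ + _).
    by rewrite /c circleB conjcX conjcM conjcR; ring.
  have k2 : Re (s%:C ^+ 2 * (conjc (expi t) ^+ 2 * p (c t) v x)) =
      s ^+ 2 * Re (conjc (expi t) ^+ 2 * p (c t) v x).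
    by rewrite -[s%:C ^+ 2](rmorphXn (real_complex R)) ReM /= mul0r subr0.
  have k3 := le_trans (normRe_le _) (bnd t v eta).
  have k4 := le_trans (normRe_le _) (bnd t ((c t - z) *: w) h).
  rewrite rnormZ cz in k4.
  have k5 : M * rnorm v * rnorm eta <= M * rnorm v * (C * s ^+ 3).
    by rewrite ler_wpM2l // mulr_ge0 // rnorm_ge0.
  have k6 : M * (s * rnorm w) * rnorm h <= M * (s * rnorm w) * (s ^+ 2 * (rnorm x + C)).
    by rewrite ler_wpM2l // !mulr_ge0 ?rnorm_ge0 // ltW.
  have k7 : Re (p (c t) a h) >= s ^+ 2 * Re (conjc (expi t) ^+ 2 * p (c t) v x) - N * s ^+ 3.
    rewrite k1 !ReD k2; move: k3 k4; rewrite !ler_norml => /andP[k3 _] /andP[k4 _].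
    have NE : N * s ^+ 3 = M * rnorm v * (C * s ^+ 3) + M * (s * rnorm w) * (s ^+ 2 * (rnorm x + C)).
      by rewrite /N; ring.
    by lra.
  rewrite -/a; lra.
have bQ : bounded_measurable Q.
  apply: (curve_bm (phi := fun y => v + (y - z) *: w)) => //.
  by apply: holomorphic_vcont; exact: affine_holomorphic.
have bphi := curve_bm cphi s0 KsO.
have bR : bounded_measurable (fun t => Re (E t) + Z t).
  by apply: bmD; [case: cE | case: cZ].
have bL : bounded_measurable (fun t => Q t + 2 * s ^+ 2 * (Re (E t) + Z t)).
  by apply: bmD => //; exact: bmZ.
have := le_aver (bmB bL (bm_cst (2 * N * s ^+ 3))) bphi lowb.
rewrite averB //; last exact: bm_cst.
rewrite averD ?aver_cst //; last exact: bmZ.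
rewrite averZ // averD ?aZ ?addr0; [|by case: cE|by case: cZ].
have := affine_submean v w s0 KsO; rewrite -/(Q _) vE => aff.
have {}aff : quad (p z) v <= aver Q by exact: aff.
move: aE; rewrite ler_norml => /andP[aE _].
have s2 : 0 <= s ^+ 2 by exact: sqr_ge0.
have g1 := ler_wpM2l s2 aE; have g2 := ler_wpM2l s2 Ns.
have -> : 2 * N * s ^+ 3 = 2 * (s ^+ 2 * (N * s)) by ring.
move: (aver _) g1 => A g1; rewrite -/(c _); lra.
Qed.

(** Semicontinuity of [<P phi, phi>] alone would not let the inequality pass to the limit at the
    centre; there the approximant [psi] has the exact value of [phi]. On the circle [quad_perturb]
    makes the error at most [M e1 (1 + 2 L)], with [M] bounding the forms and [L] the map on the
    disc. *)
Lemma affine_curvature : seminegative_curvature dot Omega P.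
Proof.
move=> phi hphi; have cphi := holomorphic_vcont hphi.
split=> [z _||z0 r r0 KO]; [exact: ltry | exact: curve_usc|].
rewrite (integral_aver (curve_bm cphi r0 KO)) lee_fin.
have [M M0 hM] := pform_bounded hV hP husc KO.
have [L L0 hL] := vcont_bounded cphi KO.
apply/ler_addgt0Pr => e e0; pose k := M * (1 + 2 * L) + 1.
have k0 : 0 < k by rewrite ltr_wpDl // mulr_ge0 // addr_ge0 // mulr_ge0.
pose e1 := Num.min 1 (e / k).
have e10 : 0 < e1 by rewrite lt_min ltr01 divr_gt0.
have e11 : e1 <= 1 by rewrite ge_min lexx.
have e1k : e1 * k <= e by rewrite -ler_pdivlMr // ge_min lexx orbT.
have [psi [tpsi psi0 hpsi]] := holomorphic_approx hV hOmega hphi r0 KO e10.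
have cpsi := taylor2_vcont (Omega := Omega) tpsi.
have sub : quad (p z0) (psi z0) <= aver (fun t => quad (p (circle z0 r t)) (psi (circle z0 r t))).
  apply: (submean_circle (Omega := Omega) (u := fun z => quad (p z) (psi z))) => //.
  - by move=> z Oz; exact: form_ge0 (pp Oz) _.
  - exact: curve_usc.
  - by move=> z Oz; exact: curve_local_submean.
rewrite psi0 in sub; apply: le_trans sub _.
have bphi := curve_bm cphi r0 KO.
rewrite -[e](aver_cst) -averD //; last exact: bm_cst.
apply: le_aver; [exact: curve_bm | by apply: bmD => //; exact: bm_cst | move=> t].
have Kc := circle_closed_disc z0 t r0.
have := quad_perturb (phi (circle z0 r t)) (psi (circle z0 r t) - phi (circle z0 r t)) (KO _ Kc) M0 (hM _ Kc).
rewrite [_ + (_ - _)]addrC subrK ler_norml => /andP[_ h]; rewrite -lerBlDl (le_trans h) //.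
have := hpsi t; have := rnorm_ge0 (psi (circle z0 r t) - phi (circle z0 r t)).
move: (rnorm (psi _ - _)) => x x0 xe.
have Lc := hL _ Kc; have nc := rnorm_ge0 (phi (circle z0 r t)).
apply: (@le_trans _ _ (M * e1 * (1 + 2 * L))).
  apply: ler_pM; rewrite ?mulr_ge0 ?addr_ge0 ?mulr_ge0 //.
    by rewrite ler_wpM2l.
  by rewrite lerD ?ler_wpM2l // (le_trans xe).
by move: e1k; rewrite /k; lra.
Qed.

End Curvature.

Theorem theorem4p2 (R : realType) (V : completeNormedModType R[i])
  (dot : {dot V for (@conjc R)}) (hV : hilbert_norm dot)
  (Omega : set R[i]) (hOmega : open Omega)
  (P : R[i] -> V -> V)
  (hP : forall z, Omega z -> End_ge0 dot (P z))
  (husc : weakly_usc dot Omega P) :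
  [<-> (* (i) *)
       seminegative_curvature dot Omega P ;
       (* (ii) *)
       forall (z0 : R[i]) (r : R), 0 < r -> closed_disc z0 r `<=` Omega ->
       exists A B C : V -> V,
         [/\ is_weak_avg dot P z0 r (@arc_length R) A,
             is_weak_avg dot P z0 r (@dz R) B,
             is_weak_avg dot P z0 r (@dzbar R) C
           & op_le (U := (V * V)%type) (dot_sum dot)
               (block_op (P z0) (fun=> 0) (fun=> 0) (fun=> 0))
               (block_op A B C A)] ;
       (* (iii) *)
       forall (z0 : R[i]) (r : R), 0 < r -> closed_disc z0 r `<=` Omega ->
       forall t : R, 0 < t ->
       exists A B C S : V -> V,
         [/\ is_weak_avg dot P z0 r (@arc_length R) A,
             is_weak_avg dot P z0 r (@dz R) B,
             is_weak_avg dot P z0 r (@dzbar R) C,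
             is_End_inverse (fun v => t%:C *: v + A v) S
           & op_le dot (P z0) (fun v => A v - B (S (C v)))]].
Proof.
tfae.
- by move=> sc z0 r r0 KO; exact: (curvature_block hV hP husc r0 KO sc).
- by move=> bl z0 r r0 KO t t0; exact: (block_schur hV hP husc r0 KO t0 (bl z0 r r0 KO)).
- move=> sch; apply: (affine_curvature hV hOmega hP husc) => z0 r r0 KO v w.
  exact: (schur_affine_submean hV hP husc r0 KO v w (sch z0 r r0 KO)).
Qed.
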